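(* Let $Q$ be a natural join query with hypergraph $\mathcal{H}$ and input size $n$, and let $p$ be the number of machines, with $n \geq p^3$. Suppose $Q$ is $\Sigma$-uniformized for some family of constraint sets $\Sigma=\{\sigma_R\}_{R\in Q}$. Then there is an MPC algorithm (the $\kappa$-Join algorithm) that computes the output of $Q$ in a constant number of rounds (depending only on the query) with maximum load $\tilde{O}(n/p^{1/\kappa(\mathcal{H})})$ with high probability, where $\tilde{O}$ hides polylogarithmic factors in $n$ and $p$.
   Context: A relation $R$ with schema $\mathrm{vars}(R)$ is a set of tuples over the variables $\mathrm{vars}(R)$. A natural join query $Q$ is a set of relations (no relation repeated, no two with the same schema); its output is $\bowtie_{R\in Q} R$, and its input size is the total number of tuples over all relations. Its hypergraph is $\mathcal{H}=(V,E)$ with $V=\bigcup_{R\in Q}\mathrm{vars}(R)$ and $E=\{\mathrm{vars}(R): R\in Q\}$. For $S\subseteq V$, $\mathcal{H}[S]$ is the hypergraph with vertex set $S$ and edge set $\{S\cap e : e\in E,\ S\cap e\neq\emptyset\}$. The reduced hypergraph $\mathsf{red}(\mathcal{H})$ is obtained from $\mathcal{H}$ by removing every edge $e$ for which there is another edge $e'\neq e$ with $e\subseteq e'$. $\tau^*(\mathcal{H})$ is the value of a maximum fractional edge packing (weights $u_e\ge 0$ with $\sum_{e\ni v}u_e\le 1$ for all $v$), equivalently of a minimum fractional vertex cover (weights $w_v\ge0$ with $\sum_{v\in e}w_v\ge 1$ for all $e$). The reduced quasi vertex-cover is $\kappa(\mathcal{H})=\max_{S\subseteq V}\tau^*(\mathsf{red}(\mathcal{H}[S]))$.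 For a relation $R$ and $X,Y\subseteq \mathrm{vars}(R)$, $\deg_R(Y\mid X)=\max_{\mathbf{x}}|\pi_Y(\sigma_{X=\mathbf{x}}R)|$. A constraint set for $R$ is a function $\sigma_R:\mathcal{P}(\mathrm{vars}(R))\to\mathbb{R}_{\ge 0}$; $R$ satisfies $\sigma_R$ if $\deg_R(Y\mid X)\le 2\sigma_R(X)/\sigma_R(Y)$ for all $X\subseteq Y\subseteq \mathrm{vars}(R)$. $Q$ is $\Sigma$-uniformized if each $R\in Q$ satisfies $\sigma_R$. MPC model: $p$ machines, input initially spread evenly; computation proceeds in synchronous rounds of communication followed by local computation; the load is the maximum amount of data received by any machine in any round; the union of the machines' outputs must be the query output. *)

(* Defs.v *)
From HB Require Import structures.
From mathcomp Require Import all_boot all_order all_algebra.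
From mathcomp Require Import finmap.
From mathcomp Require Import reals exp Rstruct.
Notation R := Rdefinitions.R (only parsing).

Set Implicit Arguments.
Unset Strict Implicit.
Unset Printing Implicit Defensive.

Import Order.TTheory GRing.Theory Num.Theory.
Local Open Scope ring_scope.
Local Open Scope fset_scope.

(* The variables (attributes) form a finite type V.  Attribute values are
   natural numbers.  A tuple over a schema e : {set V} is represented by a
   function V -> nat that is 0 outside e (normal form, see [restr]). *)
Definition rtuple (V : finType) := {ffun V -> nat}.

Definition restr (V : finType) (X : {set V}) (t : rtuple V) : rtuple V :=
  [ffun v => if v \in X then t v else 0%N].

(* A query is given by its set of schemas E (the hyperedges) and, for each
   schema e, a finite relation Rl e (only e \in E matters).  Distinct
   relations have distinct schemas by construction. *)
Definition well_formed (V : finType) (E : {set {set V}})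
  (Rl : {set V} -> {fset rtuple V}) : Prop :=
  forall e t, e \in E -> t \in Rl e -> restr e t = t.

Definition input_size (V : finType) (E : {set {set V}})
  (Rl : {set V} -> {fset rtuple V}) : nat :=
  (\sum_(e in E) #|` Rl e|)%N.

Definition in_join (V : finType) (E : {set {set V}})
  (Rl : {set V} -> {fset rtuple V}) (t : rtuple V) : bool :=
  [forall e in E, restr e t \in Rl e].

Definition in_adom (V : finType) (E : {set {set V}})
  (Rl : {set V} -> {fset rtuple V}) (w : nat) : bool :=
  [exists e in E, [exists v in e, has (fun t : rtuple V => t v == w) (enum_fset (Rl e))]].

(* deg_R(Y | X) = max_x |pi_Y (sigma_{X = x} R)|  (values x not occurring
   in pi_X R contribute 0, so the max can range over tuples of R) *)
Definition deg (V : finType) (Rel : {fset rtuple V}) (X Y : {set V}) : nat :=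
  (\max_(t0 <- enum_fset Rel)
     #|` [fset restr Y t | t in Rel & restr X t == restr X t0] |)%N.

Definition satisfies (V : finType) (Rel : {fset rtuple V}) (e : {set V})
  (sigma : {set V} -> R) : Prop :=
  forall X Y : {set V}, X \subset Y -> Y \subset e ->
    (deg Rel X Y)%:R <= 2 * sigma X / sigma Y.

Definition uniformized (V : finType) (E : {set {set V}})
  (Rl : {set V} -> {fset rtuple V}) (Sig : {set V} -> {set V} -> R) : Prop :=
  forall e, e \in E ->
    (forall X : {set V}, X \subset e -> 0 <= Sig e X) /\ satisfies (Rl e) e (Sig e).

Definition induced_edges (V : finType) (E : {set {set V}}) (S : {set V})
  : {set {set V}} :=
  [set S :&: e | e in E & S :&: e != set0].

Definition reduce (V : finType) (F : {set {set V}}) : {set {set V}} :=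
  [set f in F | [forall f' in F, (f' != f) ==> ~~ (f \subset f')]].

Definition is_edge_packing (V : finType) (S : {set V}) (F : {set {set V}})
  (u : {set V} -> R) : Prop :=
  (forall f, f \in F -> 0 <= u f) /\
  (forall v, v \in S -> \sum_(f in F | v \in f) u f <= 1).

Definition is_tau_star (V : finType) (S : {set V}) (F : {set {set V}}) (x : R)
  : Prop :=
  (exists u, is_edge_packing S F u /\ \sum_(f in F) u f = x) /\
  (forall u, is_edge_packing S F u -> \sum_(f in F) u f <= x).

Definition is_kappa (V : finType) (E : {set {set V}}) (x : R) : Prop :=
  (exists S, is_tau_star S (reduce (induced_edges E S)) x) /\
  (forall S y, is_tau_star S (reduce (induced_edges E S)) y -> y <= x).

Definition item (V : finType) := ({set V} * rtuple V)%type.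

Definition input_items (V : finType) (E : {set {set V}})
  (Rl : {set V} -> {fset rtuple V}) : seq (item V) :=
  flatten [seq [seq (e, t) | t <- enum_fset (Rl e)] | e <- enum E].

Definition even_distribution (V : finType) (p : nat) (E : {set {set V}})
  (Rl : {set V} -> {fset rtuple V}) (inp : 'I_p -> seq (item V)) : Prop :=
  perm_eq (flatten [seq inp i | i <- enum 'I_p]) (input_items E Rl) /\
  forall i, (size (inp i) <= (input_size E Rl + p.-1) %/ p)%N.

(* A (deterministic, for a fixed random seed) MPC algorithm on p machines.
   Messages are sequences of words (nat).  Since local computation is
   unrestricted, each machine's state is w.l.o.g. its full history: its
   initial input and everything it received so far (a list, one entry per
   past round, each entry listing the messages from machines 0..p-1).
   [send k j inp_j hist_j i] is the message machine j sends to machine i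
   in round k; [output i inp_i hist_i] is the output of machine i. *)
Record mpc_alg (V : finType) (p : nat) := MPCAlg {
  rounds : nat;
  send : nat -> 'I_p -> seq (item V) -> seq (seq (seq nat)) -> 'I_p -> seq nat;
  output : 'I_p -> seq (item V) -> seq (seq (seq nat)) -> seq (rtuple V)
}.

Fixpoint hist (V : finType) (p : nat) (A : mpc_alg V p)
  (inp : 'I_p -> seq (item V)) (k : nat) : 'I_p -> seq (seq (seq nat)) :=
  match k with
  | 0 => fun _ => [::]
  | k'.+1 => let h := hist A inp k' in
      fun i => rcons (h i) [seq send A k' j (inp j) (h j) i | j <- enum 'I_p]
  end.

Definition msg (V : finType) (p : nat) (A : mpc_alg V p)
  (inp : 'I_p -> seq (item V)) (k : nat) (j i : 'I_p) : seq nat :=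
  send A k j (inp j) (hist A inp k j) i.

Definition recv_load (V : finType) (p : nat) (A : mpc_alg V p)
  (inp : 'I_p -> seq (item V)) (k : nat) (i : 'I_p) : nat :=
  (\sum_(j < p) size (msg A inp k j i))%N.

Definition max_load (V : finType) (p : nat) (A : mpc_alg V p)
  (inp : 'I_p -> seq (item V)) : nat :=
  (\max_(k < rounds A) \max_(i < p) recv_load A inp k i)%N.

(* every word communicated is a legal word: either a value of the active
   domain or an integer of O(log n) bits, i.e. at most (n+p)^d *)
Definition words_legal (V : finType) (p : nat) (A : mpc_alg V p)
  (inp : 'I_p -> seq (item V)) (legal : nat -> bool) : Prop :=
  forall k (j i : 'I_p), (k < rounds A)%N -> all legal (msg A inp k j i).

Definition computes (V : finType) (p : nat) (A : mpc_alg V p)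
  (inp : 'I_p -> seq (item V)) (E : {set {set V}})
  (Rl : {set V} -> {fset rtuple V}) : Prop :=
  forall t : rtuple V, in_join E Rl t <->
    exists i : 'I_p, t \in output A i (inp i) (hist A inp (rounds A) i).

(* Main.v *)
Require Import Defs.
From HB Require Import structures.
From mathcomp Require Import all_boot all_order all_algebra.
From mathcomp Require Import finmap.
From mathcomp Require Import boolp reals Rstruct sequences exp.
From mathcomp Require Import lra ring zify.
Import Order.TTheory GRing.Theory Num.Theory.
Set Implicit Arguments.
Unset Strict Implicit.
Unset Printing Implicit Defensive.

(* The tuples of every relation are split by type: the type of a tuple t of R
   is the vector of floor (log2 deg_R(vars R | t_X)) over all X.  There are
   polylogarithmically many combinations of types, and within one type sigma
   every degree satisfies deg(Y | X) <= 2 sigma(X) / sigma(Y) with sigma(empty)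
   at most n.  Write L = n / p^(1/kappa) and let h(X) be the logarithm of
   n / sigma(X) in base p^(1/kappa).

   For one combination of types the hypercube shares p^(y_v / kappa) are found
   by water filling.  Start with y = 0 and Z = empty and increase y along a
   minimum fractional vertex cover of red(H[V \ Z]), whose weight is at most
   kappa by LP duality, until h(X) + y(e \ X) = s for some edge e and X not
   inside Z, where s is the time elapsed.  Then X takes only O(1) values in each
   cell of the hypercube, X is added to Z, and the process goes on up to time 1.
   At the end every edge outside Z is contained, outside Z, in an edge e with
   h(X) + y(e \ X) >= 1 for all X, whose tuples are spread with load O~(L).

   The cells receive these well-spread edges and the few values of the
   variables of Z.  The tuples of any other edge that matter to a cell lie in a
   set of O~(L) candidates computed by the cell, which looks them up at the
   machines that store the tuples under an independent hash.  Degrees and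
   compact names of values come from sorting by regular sampling, for which
   p^3 <= n suffices. *)

(** * Linear programming duality for edge packings *)

(** Values are arbitrary naturals, so hashing them directly would need an infinite seed space. Names
    bounded by a polynomial in [n] and [p] make a seed a finite function that depends on the sizes
    only, and keep the union bounds polynomial. The obstacle in the join is an edge that meets [Z]:
    the shares do not spread its tuples, so they cannot be shipped to every compatible cell. A cell
    guesses them instead. Each variable of [Z] has polylogarithmically many values there, and the
    other variables are read off one tuple of the dominating edge, of which O~(L) are present; a
    bounded product of polylogarithms times O~(L) is again O~(L). The queries of a cell depend on
    the bucket hash. Concentration at the owners is therefore proved with the bucket seed fixed,
    over the second seed alone. A witness projection may reach a cell from all [p] machines, and
    there are up to [p^2] samples; both fit because [kappa >= 1] gives [p^2 <= n/p <= L]. Every hash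
    load may exceed its mean by a factor [lam] of order [log n], chosen so that [exp(2 - lam/2)]
    outweighs the number of bad events. *)

Section LinearProgramming.
Local Open Scope ring_scope.

(** Picks the value of an eliminated variable in Fourier-Motzkin elimination: [A] holds its lower
    bounds and [B] its upper bounds, and either list may be empty. *)
Lemma seq_separation (R : realFieldType) (A B : seq R) :
  (forall a b, a \in A -> b \in B -> a <= b) ->
  exists t, (forall a, a \in A -> a <= t) /\ (forall b, b \in B -> t <= b).
Proof.
have maxs (s : seq R) : s != [::] -> exists2 m, m \in s & forall a, a \in s -> a <= m.
  elim: s => // a s IH _; have [->|/IH[m ms mP]] := eqVneq s [::].
    by exists a; rewrite ?mem_head // => b; rewrite inE => /eqP->.
  have [le_am|/ltW le_ma] := lerP a m.
    exists m; first by rewrite inE ms orbT.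
    by move=> b; rewrite inE => /predU1P[->//|/mP].
  exists a; first exact: mem_head.
  by move=> b; rewrite inE => /predU1P[->//|/mP/le_trans->].
have [A0|/maxs[m mA mP] leAB] := eqVneq A [::]; last first.
  by exists m; split=> // b; apply: leAB.
rewrite {}A0 => _.
have [->|B0] := eqVneq B [::]; first by exists 0.
have /maxs[m mB mP]: [seq - b | b <- B] != [::] by case: B B0.
exists (- m); split=> // b bB; rewrite lerNl; apply: mP; exact: map_f.
Qed.

Section Farkas.
Variables (R : realFieldType) (I : finType).
Local Notation con := ({ffun I -> R} * R)%type.
Implicit Types (c d : con) (C : seq con).

Inductive cone C : {ffun I -> R} * R -> Prop :=
| cone_in c : c \in C -> cone C c
| cone_add c d : cone C c -> cone C d ->
    cone C ([ffun i => c.1 i + d.1 i], c.2 + d.2)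
| cone_scale k c : 0 < k -> cone C c -> cone C ([ffun i => k * c.1 i], k * c.2).

Lemma cone_trans C C' c :
  (forall c', c' \in C' -> cone C c') -> cone C' c -> cone C c.
Proof.
move=> CC'; elim=> [c'|c1 c2 _ h1 _ h2|k c' k0 _ h]; first exact: CC'.
  exact: cone_add.
exact: cone_scale.
Qed.

(* Fourier-Motzkin elimination, one variable of [J] at a time. *)
Lemma farkas_on (J : {set I}) C :
  (forall c i, c \in C -> i \notin J -> c.1 i = 0) ->
  (exists x : I -> R, forall c, c \in C -> \sum_i c.1 i * x i <= c.2) \/
  (exists c, [/\ cone C c, forall i, c.1 i = 0 & c.2 < 0]).
Proof.
have [m] := ubnP #|J|; elim: m J C => // m IH J C; rewrite ltnS => cardJ CJ.
have [J0|[j jJ]] := set_0Vmem J.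
  have C0 c i : c \in C -> c.1 i = 0 by move=> /CJ->//; rewrite J0 inE.
  have [/hasP[c cC c0]|/hasPn Cge] := boolP (has (fun c => c.2 < 0) C).
    by right; exists c; split=> //; [exact: cone_in|move=> i; exact: C0].
  left; exists (fun=> 0) => c cC; rewrite big1 ?leNgt ?Cge // => i _.
  by rewrite mulr0.
(* The scaling makes the coefficients of [j] equal to 1 and -1, so that they cancel in the sum. *)
pose comb c d : con := ([ffun i => [ffun i => (c.1 j)^-1 * c.1 i] i +
     [ffun i => (- d.1 j)^-1 * d.1 i] i], (c.1 j)^-1 * c.2 + (- d.1 j)^-1 * d.2).
pose P := [seq c : con <- C | 0 < c.1 j]; pose N := [seq c : con <- C | c.1 j < 0].
pose C' := [seq c : con <- C | c.1 j == 0] ++ [seq comb c d | c <- P, d <- N].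
have combC c d : c \in P -> d \in N -> cone C (comb c d).
  rewrite !mem_filter => /andP[c0 cC] /andP[d0 dC].
  have h1 := @cone_scale C (c.1 j)^-1 c _ (cone_in cC).
  have h2 := @cone_scale C (- d.1 j)^-1 d _ (cone_in dC).
  apply: (cone_add (h1 _) (h2 _)); by rewrite invr_gt0 ?oppr_gt0.
have [|c i|[x xP]|[c [cC' c0 cneg]]] := IH (J :\ j) C'.
- by move: cardJ; rewrite (cardsD1 j) jJ.
- rewrite mem_cat !inE negb_and negbK => /orP[].
    rewrite mem_filter => /andP[/eqP cj cC] /orP[/eqP->//|]; exact: CJ.
  case/allpairsP=> -[c1 c2] /= [c1P c2N ->] /=.
  move: c1P c2N; rewrite !mem_filter => /andP[c10 c1C] /andP[c20 c2C].
  rewrite !ffunE => /orP[/eqP->|iJ]; last first.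
    by rewrite (CJ c1 i) // (CJ c2 i) // !mulr0 addr0.
  by field; rewrite (gt_eqF c10) (lt_eqF c20).
- left.
  pose s c := \sum_(i | i != j) c.1 i * x i.
  have [|t [tN tP]] := @seq_separation R
     [seq (c.2 - s c) / c.1 j | c : con <- N] [seq (c.2 - s c) / c.1 j | c : con <- P].
    move=> _ _ /mapP[d dN ->] /mapP[c cP ->].
    have /xP : comb c d \in C' by rewrite mem_cat allpairs_f ?orbT.
    move: cP dN; rewrite !mem_filter => /andP[c0 cC] /andP[d0 dC].
    have combj : (comb c d).1 j = 0.
      by rewrite /= !ffunE; field; rewrite (gt_eqF c0) (lt_eqF d0).
    have sE : s (comb c d) = (c.1 j)^-1 * s c - (d.1 j)^-1 * s d.
      rewrite /s !mulr_sumr -sumrB; apply: eq_bigr => i _.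
      by rewrite /= !ffunE invrN; ring.
    by rewrite (bigD1 j) // -/(s _) combj sE /= invrN; lra.
  exists (fun i => if i == j then t else x i) => c cC.
  rewrite (bigD1 j) //= eqxx.
  have -> : \sum_(i | i != j) c.1 i * (if i == j then t else x i) = s c.
    by apply: eq_bigr => i /negPf ->.
  have [cj|cj|cj] := ltgtP (c.1 j) 0.
  + have /tN : (c.2 - s c) / c.1 j \in [seq (c.2 - s c) / c.1 j | c : con <- N].
      by apply: map_f; rewrite mem_filter cj.
    rewrite ler_ndivrMr //; lra.
  + have /tP : (c.2 - s c) / c.1 j \in [seq (c.2 - s c) / c.1 j | c : con <- P].
      by apply: map_f; rewrite mem_filter cj.
    rewrite ler_pdivlMr //; lra.
  + have /xP : c \in C' by rewrite mem_cat mem_filter cj eqxx cC.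
    by rewrite (bigD1 j) //= cj !mul0r !add0r.
- right; exists c; split=> //; apply: cone_trans cC' => c'.
  rewrite mem_cat mem_filter => /orP[/andP[_]|]; first exact: cone_in.
  by case/allpairsP=> -[c1 c2] /= [c1P c2N ->]; apply: combC.
Qed.

Lemma farkas C :
  (exists x : I -> R, forall c, c \in C -> \sum_i c.1 i * x i <= c.2) \/
  (exists c, [/\ cone C c, forall i, c.1 i = 0 & c.2 < 0]).
Proof. by apply: (@farkas_on setT) => c i _; rewrite inE. Qed.

End Farkas.

(** * Strong duality between fractional edge packings and vertex covers *)

Section CoverDuality.
Variables (R : realFieldType) (V : finType) (F : {set {set V}}).
Implicit Types (u : {set V} -> R) (w : V -> R).

Lemma exchange_incidence u w :
  \sum_(f in F) u f * (\sum_(v in f) w v) =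
  \sum_v w v * (\sum_(f in F | v \in f) u f).
Proof.
under eq_bigr do rewrite mulr_sumr.
rewrite (exchange_big_dep xpredT) //=; apply: eq_bigr => v _.
by rewrite mulr_sumr; apply: eq_bigr => f _; rewrite mulrC.
Qed.

Lemma weak_duality u w :
  (forall f, f \in F -> 0 <= u f) ->
  (forall v, \sum_(f in F | v \in f) u f <= 1) ->
  (forall v, 0 <= w v) -> (forall f, f \in F -> 1 <= \sum_(v in f) w v) ->
  \sum_(f in F) u f <= \sum_v w v.
Proof.
move=> u0 u1 w0 w1.
have : \sum_(f in F) u f <= \sum_(f in F) u f * (\sum_(v in f) w v).
  by apply: ler_sum => f fF; rewrite ler_peMr ?u0 ?w1.
move/le_trans; apply; rewrite exchange_incidence; apply: ler_sum => v _.
by rewrite ler_piMr ?w0 ?u1.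
Qed.

Hypothesis F0 : set0 \notin F.

(** Farkas is applied to one system in [u] and [w] together: both feasibility conditions and the
    reversed inequality between the objectives. If it has no solution, the multipliers of the
    refutation are, after rescaling, a cover and a packing that violate weak duality. *)
Lemma packing_cover_duality : exists u w, 
  [/\ (forall f, f \in F -> 0 <= u f),
      (forall v, \sum_(f in F | v \in f) u f <= 1),
      (forall v, 0 <= w v), (forall f, f \in F -> 1 <= \sum_(v in f) w v) &
      \sum_v w v <= \sum_(f in F) u f].
Proof.
pose I : finType := ({set V} + V)%type.
pose mk (a : {set V} -> R) (b : V -> R) : {ffun I -> R} :=
  [ffun i => match i with inl f => a f | inr v => b v end].
pose con := ({ffun I -> R} * R)%type.
pose ud (f g : {set V}) : R := (g == f)%:R.
pose C : seq con :=
  [seq (mk (fun g => - ud f g) (fun=> 0), 0) | f : {set V} <- enum F] ++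
  [seq (mk (fun=> 0) (fun v' => - (v' == v)%:R), 0) | v <- enum V] ++
  [seq (mk (fun f => ((f \in F) && (v \in f))%:R) (fun=> 0), 1) | v <- enum V] ++
  [seq (mk (fun=> 0) (fun v => - (v \in f)%:R), -1) | f : {set V} <- enum F] ++
  [:: (mk (fun f => - (f \in F)%:R) (fun=> 1), 0)].
have mkE a b (x : I -> R) : \sum_i mk a b i * x i =
    \sum_f a f * x (inl f) + \sum_v b v * x (inr v).
  by rewrite big_sumType; congr (_ + _); apply: eq_bigr => i _; rewrite ffunE.
have sum1 (T : finType) (P : pred T) (G : T -> R) :
    \sum_t (P t)%:R * G t = \sum_(t | P t) G t.
  by rewrite [RHS]big_mkcond; apply: eq_bigr => t _; case: (P t); rewrite ?mul1r ?mul0r.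
have sum0 (T : finType) (G : T -> R) : \sum_t 0 * G t = 0.
  by rewrite big1 // => t _; rewrite mul0r.
have [[x xC]|[c [cC c0 cneg]]] := farkas C.
  exists (fun f => x (inl f)), (fun v => x (inr v)); split.
  - move=> f fF.
    have /xC : (mk (fun g => - ud f g) (fun=> 0), 0) \in C.
      by rewrite mem_cat map_f ?mem_enum.
    rewrite mkE sum0 addr0; under eq_bigr do rewrite mulNr.
    by rewrite sumrN (sum1 _ (pred1 f)) big_pred1_eq oppr_le0.
  - move=> v.
    have /xC : (mk (fun f => ((f \in F) && (v \in f))%:R) (fun=> 0), 1) \in C.
      by rewrite !mem_cat (map_f (fun v => (mk _ _, 1))) ?mem_enum ?orbT.
    by rewrite mkE sum0 addr0 sum1.
  - move=> v.
    have /xC : (mk (fun=> 0) (fun v' => - (v' == v)%:R), 0) \in C.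
      by rewrite !mem_cat (map_f (fun v => (mk _ (fun v' => - (v' == v)%:R), 0))) ?mem_enum ?orbT.
    rewrite mkE sum0 add0r; under eq_bigr do rewrite mulNr.
    by rewrite sumrN (sum1 _ (pred1 v)) big_pred1_eq oppr_le0.
  - move=> f fF.
    have /xC : (mk (fun=> 0) (fun v => - (v \in f)%:R), -1) \in C.
      by rewrite !mem_cat (map_f (fun f : {set V} => (mk _ (fun v => - (v \in f)%:R), -1))) ?mem_enum ?orbT.
    rewrite mkE sum0 add0r; under eq_bigr do rewrite mulNr.
    by rewrite sumrN sum1 lerN2.
  - have /xC : (mk (fun f => - (f \in F)%:R) (fun=> 1), 0) \in C.
      by rewrite !mem_cat inE eqxx !orbT.
    rewrite mkE; under eq_bigr do rewrite mulNr.
    rewrite sumrN sum1 /=; under [X in _ + X]eq_bigr do rewrite mul1r.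
    by rewrite addrC subr_le0.
exfalso.
(* [a], [b] and [g] are the multipliers of the packing constraints, the cover constraints and the
   objective inequality. Those of the sign constraints are not recorded; they only weaken equalities
   to [<=]. *)
have [a [b [g [a0 b0 g0 [ca cb c2]]]]] : exists a b (g : R),
    [/\ forall v, 0 <= a v, forall f, 0 <= b f, 0 <= g &
     [/\ forall f, f \in F -> c.1 (inl f) <= \sum_(v in f) a v - g,
         forall v, c.1 (inr v) <= g - \sum_(f in F | v \in f) b f &
         \sum_v a v - \sum_(f in F) b f <= c.2]].
  elim: cC => {c c0 cneg} [c|c d _ [a [b [g [a0 b0 g0 [ca cb c2]]]]] _
      [a' [b' [g' [a0' b0' g0' [ca' cb' c2']]]]]|
      k c k0 _ [a [b [g [a0 b0 g0 [ca cb c2]]]]]].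
  - rewrite !mem_cat => /orP[/mapP[f]|/orP[/mapP[v _]|/orP[/mapP[v _]|/orP[/mapP[f]|]]]].
    + rewrite mem_enum => fF ->.
      exists (fun=> 0), (fun=> 0), 0; split=> //=; split=> //= [h hF|v|].
      * by rewrite ffunE big1 // subr0 oppr_le0 ler0n.
      * by rewrite ffunE big1 // subr0.
      * by rewrite !big1 // subr0.
    + move=> ->.
      exists (fun=> 0), (fun=> 0), 0; split=> //=; split=> //= [h hF|v'|].
      * by rewrite ffunE big1 // subr0.
      * by rewrite ffunE big1 // subr0 oppr_le0 ler0n.
      * by rewrite !big1 // subr0.
    + move=> ->.
      exists (fun v' => (v' == v)%:R), (fun=> 0), 0; split=> //=; split=> //= [h hF|v'|].
      * rewrite ffunE subr0 hF /=; case: (boolP (v \in h)) => vh; last by rewrite sumr_ge0.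
        by rewrite (bigD1 v) //= eqxx lerDl sumr_ge0.
      * by rewrite ffunE big1 // subr0.
      * rewrite [X in _ - X]big1 // subr0 (bigD1 v) //= eqxx big1 ?addr0 // => v' /negPf->//.
    + rewrite mem_enum => fF ->.
      exists (fun=> 0), (fun h => (h == f)%:R), 0; split=> //=; split=> //= [h hF|v'|].
      * by rewrite ffunE big1 // subr0.
      * rewrite ffunE sub0r lerN2; case: (boolP (v' \in f)) => vf.
          rewrite (bigD1 f) ?fF //= eqxx big1 ?addr0 // => h /andP[_ /negPf->] //.
        by rewrite big1 // => h /andP[_ vh]; case: eqP vh vf => // ->->.
      * rewrite big1 // sub0r lerN2 (bigD1 f) //= eqxx big1 ?addr0 // => h /andP[_ /negPf->] //.
    + rewrite inE => /eqP->.
      exists (fun=> 0), (fun=> 0), 1; split=> //=; split=> //= [h hF|v'|].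
      * by rewrite ffunE hF big1 // sub0r.
      * by rewrite ffunE big1 // subr0.
      * by rewrite !big1 // subr0.
  - exists (fun v => a v + a' v), (fun f => b f + b' f), (g + g'); split.
    + by move=> v; rewrite addr_ge0.
    + by move=> f; rewrite addr_ge0.
    + by rewrite addr_ge0.
    split=> [f fF|v|] /=; rewrite ?ffunE.
    + by rewrite big_split /=; move: (ca _ fF) (ca' _ fF); lra.
    + by rewrite big_split /=; move: (cb v) (cb' v); lra.
    + by rewrite !big_split /=; move: c2 c2'; lra.
  - exists (fun v => k * a v), (fun f => k * b f), (k * g); split.
    + by move=> v; rewrite mulr_ge0 // ltW.
    + by move=> f; rewrite mulr_ge0 // ltW.
    + by rewrite mulr_ge0 // ltW.
    split=> [f fF|v|] /=; rewrite ?ffunE -!mulr_sumr -mulrBr ler_pM2l //.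
    + exact: ca.
have {}ca f : f \in F -> g <= \sum_(v in f) a v by move/ca; rewrite c0; lra.
have {}cb v : \sum_(f in F | v \in f) b f <= g by have := cb v; rewrite c0; lra.
have sa0 : 0 <= \sum_v a v by rewrite sumr_ge0.
have : \sum_(f in F) b f <= \sum_v a v; last lra.
(* For [g = 0] no rescaling is possible, but then the bound at any vertex of an edge [f] forces
   [b f = 0]; edges have a vertex by [F0]. *)
move: g0; rewrite le_eqVlt => /predU1P[g0|g0].
  rewrite (le_trans _ sa0) // big1 // => f fF.
  have [f0|[v vf]] := set_0Vmem f; first by move: F0; rewrite -f0 fF.
  apply/le_anti; rewrite b0 andbT g0; apply: le_trans (cb v).
  by rewrite (bigD1 f) ?fF //= lerDl sumr_ge0.
rewrite -(ler_pM2l g0) mulr_sumr.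
have : \sum_(f in F) g * b f <= \sum_(f in F) b f * (\sum_(v in f) a v).
  by apply: ler_sum => f fF; rewrite mulrC ler_wpM2l // ca.
move/le_trans; apply; rewrite exchange_incidence mulr_sumr; apply: ler_sum => v _.
by rewrite mulrC ler_wpM2r.
Qed.

End CoverDuality.

End LinearProgramming.

(** * Hypercube shares *)

Section HypercubeShares.
Local Open Scope ring_scope.

Lemma set0_induced (V : finType) (E : {set {set V}}) S :
  set0 \notin induced_edges E S.
Proof. by apply/negP => /imsetP[e]; rewrite inE => /andP[_ /negP h] h'; case: h; rewrite -h'. Qed.

Lemma reduce_dominates (V : finType) (F : {set {set V}}) f0 :
  f0 \in F -> exists2 f, f \in reduce F & f0 \subset f.
Proof.
move=> f0F; pose P f := (f \in F) && (f0 \subset f).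
have P0 : P f0 by rewrite /P f0F subxx.
case: (arg_maxnP (fun f : {set V} => #|f|) P0) => f /andP[fF f0f] fmax.
exists f => //; rewrite inE fF /=; apply/forall_inP => f' f'F; apply/implyP => ne.
apply: contra ne => ff'; rewrite eq_sym eqEcard ff'.
by apply: fmax; rewrite /P f'F (subset_trans f0f).
Qed.

Lemma reduce_maximal (V : finType) (F : {set {set V}}) f f' :
  f \in reduce F -> f' \in F -> f \subset f' -> f' = f.
Proof.
rewrite inE => /andP[_ /forall_inP fmax] /fmax; rewrite implybN => /implyP h /h.
by rewrite negbK => /eqP.
Qed.

(** By duality the optimal packing attains [tau*] of the reduced hypergraph, so [is_kappa] bounds
    its value and with it the weight of the matching cover. Vertices outside [S] lie in no induced
    edge, which reconciles packings on [S] with packings on [V]. *)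
Lemma kappa_cover (V : finType) (E : {set {set V}}) (kappa : R) (S : {set V}) :
  is_kappa E kappa ->
  exists w : V -> R, [/\ forall v, 0 <= w v,
    forall f, f \in reduce (induced_edges E S) -> 1 <= \sum_(v in f) w v &
    \sum_v w v <= kappa].
Proof.
move=> [_ kmax]; set F := reduce _.
have F0 : set0 \notin F.
  by apply/negP; rewrite inE => /andP[h _]; have := set0_induced E S; rewrite h.
have [u [w [u0 u1 w0 w1 wu]]] := packing_cover_duality Rdefinitions.R F0.
exists w; split=> //; apply: (le_trans wu); apply: (kmax S); split.
  by exists u; split=> //; split.
move=> u' [u'0 u'1]; apply: le_trans wu; apply: weak_duality => // v.
have [vS|vS] := boolP (v \in S); first exact: u'1.
rewrite big1 ?ler01 // => f /andP[]; rewrite inE => /andP[/imsetP[e _ ->] _].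
by rewrite inE (negPf vS).
Qed.

(** A one-vertex [S] already induces an edge, and covering it costs at least 1. The bound is what
    makes [p^(1/kappa)] at most [p]. *)
Lemma kappa_ge1 (V : finType) (E : {set {set V}}) (kappa : R) :
  E != set0 -> set0 \notin E -> is_kappa E kappa -> 1 <= kappa.
Proof.
case/set0Pn=> e eE E0 hk.
have [e0|[v ve]] := set_0Vmem e; first by move: E0; rewrite -e0 eE.
have [w [w0 w1 wk]] := kappa_cover [set v] hk.
have iv : [set v] :&: e = [set v] by apply/setIidPl; rewrite sub1set.
have /reduce_dominates[f fF vf] : [set v] \in induced_edges E [set v].
  by rewrite -{1}iv imset_f // inE eE iv -cards_eq0 cards1.
apply: le_trans (w1 _ fF) (le_trans _ wk).
by rewrite [leRHS](bigID (mem f)) /= lerDl sumr_ge0.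
Qed.

(** * The water-filling process for the exponents of the shares *)

Section WaterFilling.
Variables (R : realFieldType) (V : finType) (E : {set {set V}}) (kappa : R).
Variable h : {set V} -> {set V} -> R.
Hypothesis cover : forall S : {set V}, exists w : V -> R, [/\ forall v, 0 <= w v,
    forall f, f \in reduce (induced_edges E S) -> 1 <= \sum_(v in f) w v &
    \sum_v w v <= kappa].
Hypothesis h0 : forall e (X : {set V}), e \in E -> X \subset e -> 0 <= h e X.

(** With base [P = p^(1/kappa)], a value on [X] has about [n P^(- h e X)] extensions in [e];
    spreading them over the shares [P^(y v)] of the other variables leaves at most [n P^(-s)] per
    bucket. *)
Definition balanced s (y : V -> R) (e : {set V}) :=
  forall X : {set V}, X \subset e -> s <= h e X + \sum_(v in e :\: X) y v.

(** [h e X - h e X'] bounds, in logarithm, the number of values on [X] that extend one value on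
    [X']. Once the shares of [X :\: X'] reach this for all [X'], a cell sees O(1) values on [X] on
    average. *)
Definition separated (y : V -> R) (z : V) := exists e X : {set V},
  [/\ e \in E, X \subset e, z \in X &
   forall X' : {set V}, X' \subset X -> h e X - h e X' <= \sum_(v in X :\: X') y v].

Definition filled s (y : V -> R) (Z : {set V}) :=
  [/\ forall v, 0 <= y v, \sum_v y v <= kappa * s,
      forall z, z \in Z -> separated y z &
      forall e0, e0 \in E -> ~~ (e0 \subset Z) ->
        exists e, [/\ e \in E, e0 :\: Z \subset e & balanced s y e]].

Lemma separatedW (y y' : V -> R) z : (forall v, y v <= y' v) ->
  separated y z -> separated y' z.
Proof.
move=> yy' [e [X [eE Xe zX hX]]]; exists e, X; split=> // X' /hX/le_trans; apply.
exact: ler_sum.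
Qed.

(* A set [X] at which the constraint of [e] is tight has at least as large a
   share as it has values in [e], so its variables may be discarded. *)
Lemma tight_separated s y e (X : {set V}) : e \in E -> X \subset e -> balanced s y e ->
  h e X + \sum_(v in e :\: X) y v = s -> forall z, z \in X -> separated y z.
Proof.
move=> eE Xe bal tight z zX; exists e, X; split=> // X' X'X.
have := bal _ (subset_trans X'X Xe).
have -> : \sum_(v in e :\: X') y v = \sum_(v in e :\: X) y v + \sum_(v in X :\: X') y v.
  rewrite (bigID (mem X)) /= addrC; congr (_ + _); apply: eq_bigl => v; rewrite !inE.
    case: (boolP (v \in X)) => vX; rewrite ?andbF ?andbT //=.
    by case: (boolP (v \in X')) => // /(subsetP X'X); rewrite (negPf vX).
  case: (boolP (v \in X)) => vX; rewrite ?andbF ?andbT //=.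
  by rewrite (subsetP Xe) ?andbT.
lra.
Qed.

(** For [X] inside [Z] the cover gives [e :\: X] weight at least 1, so that constraint gains at
    least as fast as time passes. Only an [X] with cover weight below 1 on [e :\: X] can become
    tight; such an [X] is not inside [Z], so every interruption enlarges [Z]. *)
Lemma water_filling_step s y (Z : {set V}) : s <= 1 -> filled s y Z ->
  (exists y', filled 1 y' Z) \/
  (exists s' y' (Z' : {set V}), [/\ s' <= 1, filled s' y' Z' & Z \proper Z']).
Proof.
move=> s1 [y0 ysum ysep ydom].
have [w [w0 w1 wk]] := cover (~: Z).
(* The balanced edges whose trace outside [Z] is maximal. It is enough to keep these balanced, since
   they dominate all other edges. *)
pose top e := [&& e \in E, ~: Z :&: e \in reduce (induced_edges E (~: Z)) &
  [forall X : {set V}, (X \subset e) ==> (s <= h e X + \sum_(v in e :\: X) y v)]].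
have topP e : top e -> balanced s y e.
  by move=> /and3P[_ _ /forallP b] X Xe; have /implyP := b X; apply.
have domtop e0 : e0 \in E -> ~~ (e0 \subset Z) -> exists2 e, top e & e0 :\: Z \subset e.
  have Zne (e : {set V}) : ~~ (e \subset Z) = (~: Z :&: e != set0).
    by rewrite setIC -setDE setD_eq0.
  move=> e0E e0Z.
  have /reduce_dominates[f fF e0f] : ~: Z :&: e0 \in induced_edges E (~: Z).
    by rewrite imset_f // inE e0E -Zne.
  have /imsetP[e1] : f \in induced_edges E (~: Z) by move: fF; rewrite inE => /andP[].
  rewrite inE => /andP[e1E e1Z] f1; rewrite -Zne in e1Z.
  have [e2 [e2E e12 b2]] := ydom _ e1E e1Z.
  (* The balanced edge [e2] supplied by the invariant contains the maximal trace [f], hence has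
     trace [f] and is itself a top edge. *)
  have fe2 : f \subset ~: Z :&: e2.
    by rewrite f1 subsetI subsetIl /= setIC -setDE.
  have e2f : ~: Z :&: e2 = f.
    apply: reduce_maximal fF _ fe2; rewrite imset_f // inE e2E -Zne.
    by apply: contra e1Z => /(subset_trans e12); rewrite subDset setUid.
  exists e2; last first.
    by rewrite setDE setIC (subset_trans e0f) // (subset_trans fe2) // subsetIr.
  rewrite /top e2E e2f fF; apply/forallP => X; apply/implyP; exact: b2.
have grow (eps : R) : 0 <= eps ->
    (forall e (X : {set V}), top e -> X \subset e ->
      eps * (1 - \sum_(v in e :\: X) w v) <= h e X + \sum_(v in e :\: X) y v - s) ->
    (forall e, top e -> balanced (s + eps) (fun v => y v + eps * w v) e) /\
    filled (s + eps) (fun v => y v + eps * w v) Z.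
  move=> eps0 epsP.
  have bal e : top e -> balanced (s + eps) (fun v => y v + eps * w v) e.
    move=> te X Xe; rewrite big_split /= -mulr_sumr.
    by have := epsP _ _ te Xe; lra.
  split=> //; split.
  - by move=> v; rewrite addr_ge0 // mulr_ge0.
  - by rewrite big_split /= -mulr_sumr mulrDr lerD // mulrC ler_wpM2r.
  - by move=> z /ysep; apply: separatedW => v; rewrite lerDl mulr_ge0.
  move=> e0 e0E e0Z; have [e te e0e] := domtop _ e0E e0Z.
  by exists e; split=> //; [case/and3P: te|exact: bal].
(* The time that remains until the constraint of edge [i.1] at the set [i.2] becomes tight. *)
pose slack (i : {set V} * {set V}) :=
  (h i.1 i.2 + \sum_(v in i.1 :\: i.2) y v - s) / (1 - \sum_(v in i.1 :\: i.2) w v).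
pose P (i : {set V} * {set V}) :=
  [&& top i.1, i.2 \subset i.1 & \sum_(v in i.1 :\: i.2) w v < 1].
have slack0 e (X : {set V}) : top e -> X \subset e -> 0 <= h e X + \sum_(v in e :\: X) y v - s.
  by move=> te Xe; rewrite subr_ge0; exact: topP.
have epsW (eps : R) : 0 <= eps -> (forall i, P i -> eps <= slack i) ->
    forall e (X : {set V}), top e -> X \subset e ->
      eps * (1 - \sum_(v in e :\: X) w v) <= h e X + \sum_(v in e :\: X) y v - s.
  move=> eps0 epsP e X te Xe.
  have [wX|wX] := ltP (\sum_(v in e :\: X) w v) 1.
    by have := epsP (e, X); rewrite /P te Xe wX ler_pdivlMr ?subr_gt0 //; apply.
  by apply: le_trans (slack0 _ _ te Xe); rewrite mulr_ge0_le0 // subr_le0.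
have [/existsP[i0 /andP[Pi0 i0s]]|] := boolP [exists i, P i && (slack i < 1 - s)]; last first.
  rewrite negb_exists => /forallP none; left.
  have [||_ fil] := grow (1 - s); rewrite ?subr_ge0 //.
    apply: epsW; rewrite ?subr_ge0 // => i Pi; have := none i.
    by rewrite Pi /= -leNgt.
  by exists (fun v => y v + (1 - s) * w v); move: fil; rewrite addrC subrK.
right.
have [[e X] Pi imin] := Order.TotalTheory.arg_minP slack Pi0.
have /and3P[/= te Xe wX] := Pi.
have eps0 : 0 <= slack (e, X) by rewrite divr_ge0 ?slack0 // subr_ge0 ltW.
have [//||bal fil] := grow (slack (e, X)).
  exact: epsW.
have eE : e \in E by case/and3P: te.
have tight : h e X + \sum_(v in e :\: X) (y v + slack (e, X) * w v) = s + slack (e, X).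
  rewrite big_split /= -mulr_sumr /slack /=; field.
  by rewrite subr_eq0 gt_eqF.
exists (s + slack (e, X)), (fun v => y v + slack (e, X) * w v), (Z :|: X); split.
- by rewrite addrC -lerBrDr; apply: le_trans (ltW i0s); exact: imin.
- case: fil => y0' ysum' ysep' ydom'; split=> //.
    move=> z; rewrite inE => /orP[/ysep'//|].
    exact: (tight_separated eE Xe (bal _ te) tight).
  move=> e0 e0E e0Z.
  have [|e1 [e1E e01 b1]] := ydom' e0 e0E.
    by apply: contra e0Z => h1; apply: subset_trans h1 (subsetUl _ _).
  exists e1; split=> //; apply: subset_trans e01; apply: setDS; exact: subsetUl.
rewrite properE subsetUl andTb; rewrite subUset subxx andTb; apply/negP => XZ.
move: wX; rewrite ltNge; case/negP.
have /w1 : ~: Z :&: e \in reduce (induced_edges E (~: Z)) by case/and3P: te.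
move/le_trans; apply.
rewrite [leRHS](bigID (mem (~: Z))) /=.
rewrite [X in X + _](eq_bigl (fun v => v \in ~: Z :&: e)) ?lerDl ?sumr_ge0 // => v.
rewrite !inE; case: (boolP (v \in Z)) => vZ; rewrite ?andbF ?andbT //=.
by rewrite andb_idl // => _; apply: contra vZ; exact: (subsetP XZ).
Qed.

Lemma water_filling : exists y Z, filled 1 y Z.
Proof.
have start : filled 0 (fun=> 0) set0.
  split=> //; first by rewrite big1 // mulr0.
    by move=> z; rewrite inE.
  move=> e eE _; exists e; split=> //; first by rewrite setD0.
  by move=> X Xe; rewrite big1 // addr0 h0.
have : (0 : R) <= 1 by exact: ler01.
move: (fun=> 0) set0 {1 3}0 start => y Z s.
have [m] := ubnP #|~: Z|; elim: m s y Z => // m IH s y Z; rewrite ltnS => Zm fil s1.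
have [[y' ?]|[s' [y' [Z' [s'1 fil' ZZ']]]]] := water_filling_step s1 fil.
  by exists y', Z.
apply: (IH s' y' Z') => //; apply: leq_trans Zm; apply: proper_card.
by rewrite properC.
Qed.

End WaterFilling.

(* [sq v] is the number of hash buckets of the variable [v] and [sZ] the set of
   variables that take few values in every cell; [swit z] is a pair (e, X)
   whose projection bounds the values of [z], and [sdom e] a hyperedge that
   covers [e] outside [sZ] and whose tuples spread evenly. *)
Record share (V : finType) := Share {
  sq : V -> nat;
  sZ : {set V};
  swit : V -> {set V} * {set V};
  sdom : {set V} -> {set V} }.

(** Integer form of a filled state at time 1: [2 ^ gam e X] stands for the degree of a value on [X]
    in [e], and [M] for the target load. The factor [2 ^ #|V|] pays for rounding the shares to
    integers. *)
Definition share_spec (V : finType) (E : {set {set V}}) (p M : nat)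
  (gam : {set V} -> {set V} -> nat) (s : share V) : Prop :=
  [/\ forall v, (0 < sq s v)%N,
      (\prod_v sq s v <= p)%N,
      forall z, z \in sZ s -> let: (e, X) := swit s z in
        [/\ e \in E, X \subset e, z \in X &
          forall X' : {set V}, X' \subset X ->
            (2 ^ gam e X' <= 2 ^ #|V| * 2 ^ gam e X * \prod_(v in X :\: X') sq s v)%N] &
      forall e0, e0 \in E -> ~~ (e0 \subset sZ s) ->
        [/\ sdom s e0 \in E, e0 :\: sZ s \subset sdom s e0 &
          forall X : {set V}, X \subset sdom s e0 ->
            (2 ^ gam (sdom s e0) X <= M * \prod_(v in sdom s e0 :\: X) sq s v)%N]].

(** The power of two is the loss from rounding the shares; the successor makes the truncation an
    upper bound. *)
Definition target_load (V : finType) (n p : nat) (kappa : R) : nat :=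
  (Num.truncn (2 ^+ #|V| * (n%:R / p%:R `^ (1 / kappa)) : R)).+1.

Section Shares.
Variables (V : finType) (E : {set {set V}}) (kappa : R) (n p : nat).
Hypotheses (hE : E != set0) (hE0 : set0 \notin E) (hk : is_kappa E kappa).
Hypotheses (p1 : (1 < p)%N) (n0 : (0 < n)%N).

Lemma shares_exist (gam : {set V} -> {set V} -> nat) :
  (forall e (X : {set V}), e \in E -> X \subset e -> (2 ^ gam e X <= n)%N) ->
  exists s, share_spec E p (target_load V n p kappa) gam s.
Proof.
move=> gamn.
have kappa1 := kappa_ge1 hE hE0 hk.
pose c : R := ln p%:R / kappa.
have lnp : 0 < ln (p%:R : R) by apply: ln_gt0; rewrite ltr1n.
have c0 : 0 < c by rewrite divr_gt0 //; lra.
pose g e X : R := ln ((2 ^ gam e X)%:R : R).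
have gE e X : (2 ^ gam e X)%:R = expR (g e X).
  by rewrite /g lnK // posrE ltr0n expn_gt0.
have nE : (n%:R : R) = expR (ln n%:R) by rewrite lnK // posrE ltr0n.
pose h e X : R := (ln n%:R - g e X) / c.
have h0 e (X : {set V}) : e \in E -> X \subset e -> 0 <= h e X.
  move=> eE Xe; rewrite divr_ge0 ?(ltW c0) // subr_ge0 -ler_expR -gE -nE.
  by rewrite ler_nat gamn.
have [y [Z [y0 ysum ysep ydom]]] := water_filling (fun S => kappa_cover S hk) h0.
rewrite mulr1 in ysum.
(* Rounding down keeps the product within [p]. As [y v] is nonnegative, the share is at least 1 and
   loses at most a factor 2. *)
pose q v := Num.truncn (expR (c * y v)).
have q0 v : (0 < q v)%N.
  by rewrite truncn_gt0 -[leLHS]exp.expR0 ler_expR mulr_ge0 // ltW.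
have qle v : (q v)%:R <= expR (c * y v) by rewrite truncn_le expR_ge0.
have qge v : expR (c * y v) <= 2 * (q v)%:R.
  have /andP[_ /ltW/le_trans] := truncn_itv (expR_ge0 (c * y v)); apply.
  rewrite -/(q v) -natrM ler_nat; have := q0 v; lia.
have prodQ (A : {set V}) : \prod_(v in A) expR (c * y v) = expR (c * \sum_(v in A) y v).
  by rewrite mulr_sumr expR_sum.
have prodq (A : {set V}) : expR (c * \sum_(v in A) y v) <= 2 ^+ #|V| * (\prod_(v in A) q v)%:R.
  rewrite -prodQ natr_prod.
  apply: (@le_trans _ _ (\prod_(v in A) (2 * (q v)%:R))).
    by apply: ler_prod => v _; rewrite expR_ge0 qge.
  rewrite big_split /= prodr_const ler_wpM2r ?prodr_ge0 //.
  by rewrite ler_eXn2l ?max_card // ltr1n.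
have PE : (p%:R : R) `^ (1 / kappa) = expR c.
  by rewrite /powR pnatr_eq0 gtn_eqF ?(ltnW p1) // /c mulrC mulrA mulr1.
have /boolp.choice[wit witP] : forall z, exists w : {set V} * {set V}, z \in Z ->
    [/\ w.1 \in E, w.2 \subset w.1, z \in w.2 &
     forall X' : {set V}, X' \subset w.2 ->
       h w.1 w.2 - h w.1 X' <= \sum_(v in w.2 :\: X') y v].
  move=> z; have [/ysep[e [X ?]]|zZ] := boolP (z \in Z); first by exists (e, X).
  by exists (set0, set0).
have /boolp.choice[dom domP] : forall e0, exists d : {set V}, e0 \in E -> ~~ (e0 \subset Z) ->
    [/\ d \in E, e0 :\: Z \subset d & balanced h 1 y d].
  move=> e0; have [e0E|_] := boolP (e0 \in E); last by exists set0.
  have [_|e0Z] := boolP (e0 \subset Z); first by exists set0.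
  by have [e ?] := ydom _ e0E e0Z; exists e.
exists (Share q Z wit dom); split=> //=.
- rewrite -(ler_nat R) natr_prod.
  apply: (@le_trans _ _ (\prod_v expR (c * y v))).
    by apply: ler_prod => v _; rewrite ler0n qle.
  rewrite -expR_sum -mulr_sumr -[leRHS]lnK ?posrE ?ltr0n ?(ltnW p1) // ler_expR.
  by rewrite /c mulrAC ler_pdivrMr ?ler_pM2l //; lra.
- move=> z /witP; case: (wit z) => e X /= [eE Xe zX hX]; split=> // X' X'X.
  rewrite -(ler_nat R) !natrM (natrX _ 2 #|V|) !gE.
  rewrite mulrAC; apply: le_trans (ler_wpM2r (expR_ge0 _) (prodq (X :\: X'))).
  rewrite -exp.expRD ler_expR; have := hX _ X'X.
  rewrite /h -mulrBl ler_pdivrMr //; lra.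
- move=> e0 e0E e0Z; have [dE ed bal] := domP _ e0E e0Z; split=> // X Xd.
  have := bal _ Xd; rewrite /h -lerBlDr ler_pdivlMr // mulrBl mul1r => hX.
  have : (2 ^ gam (dom e0) X)%:R <=
      2 ^+ #|V| * (n%:R / p%:R `^ (1 / kappa)) * (\prod_(v in dom e0 :\: X) q v)%:R :> R.
    rewrite gE mulrAC PE; apply: le_trans (ler_wpM2r _ (prodq (dom e0 :\: X))).
      rewrite nE -exp.expRN -!exp.expRD ler_expR; lra.
    by rewrite divr_ge0 ?expR_ge0.
  move=> le1; rewrite -(ler_nat R) natrM; apply: le_trans le1 _.
  by rewrite ler_wpM2r // ltW // truncnS_gt.
Qed.

End Shares.

End HypercubeShares.

(** * Random hashing *)

Lemma card_subsets (V : finType) : #|{: {set V}}| = 2 ^ #|V|.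
Proof. by rewrite -(cardsT {set V}) -powersetT card_powerset cardsT. Qed.

Lemma card_bigcup_le (I T : finType) (F : I -> {set T}) :
  #|\bigcup_i F i| <= \sum_i #|F i|.
Proof.
elim/big_rec2: _ => [|i x S _ IH]; first by rewrite cards0.
by apply: leq_trans (leq_card_setU _ _) _; rewrite leq_add2l.
Qed.

(** A uniform element of ['I_p] need not stay uniform modulo [q]. A residue class has at most
    [p %/ q + 1] elements, and [q <= p] turns this into probability at most [2 / q]. *)
Lemma card_mod_class (p q b : nat) : 0 < q <= p ->
  #|[set i : 'I_p | i %% q == b]| * q <= 2 * p.
Proof.
move=> /andP[q0 qp].
have inj : {in [set i : 'I_p | i %% q == b] &, injective (fun i : 'I_p => inord (i %/ q) : 'I_(p %/ q).+1)}.
  move=> i j; rewrite !inE => /eqP ib /eqP jb /(congr1 val).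
  have le (k : 'I_p) : k %/ q < (p %/ q).+1 by rewrite ltnS leq_div2r // ltnW.
  rewrite /= !inordK // => ij; apply: val_inj.
  by rewrite /= (divn_eq i q) ij ib -jb -divn_eq.
rewrite -(card_in_imset inj); apply: (@leq_trans ((p %/ q).+1 * q)).
  by rewrite leq_mul2r (leq_trans (max_card _)) ?card_ord ?orbT.
have := leq_trunc_div p q; lia.
Qed.

Section BallsIntoBins.
Variables (R : realType) (K : finType) (p : nat).
Local Notation Om := {ffun K -> 'I_p}.
Implicit Types (om : Om).
Local Open Scope ring_scope.

Lemma card_set_sum (T : finType) (P : pred T) :
  #|[set t | P t]|%:R = \sum_t (P t)%:R :> R.
Proof.
rewrite cardsE -sum1_card natr_sum big_mkcond; apply: eq_bigr => t _.
by rewrite /in_mem /=; case: (P t).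
Qed.

(** From [exp(-x/2) >= 1 - x/2] and [(1 - x/2) (1 + x) >= 1] on the unit interval. *)
Lemma expR_half_le (x : R) : 0 <= x <= 1 -> expR (x / 2) <= 1 + x.
Proof.
move=> /andP[x0 x1]; have := expR_ge1Dx (- (x / 2)); rewrite expRN => h.
have e0 := expR_gt0 (x / 2).
have : (1 - x / 2) * expR (x / 2) <= 1 by rewrite -ler_pdivlMr // div1r.
move: (expR _) e0 => y y0 {}h; rewrite -(@ler_pM2l _ (1 - x / 2)); last lra.
apply: le_trans h _; nra.
Qed.

(* The exponential-moment bound; the factor [1 + x] replaces [expR x] on
   [0, 1], and a bucket has probability at most [2 / q]. *)
Lemma balls_into_bins (w : K -> nat) (q b lam M : nat) : (0 < q <= p)%N ->
  (forall k, w k <= M)%N -> (\sum_k w k <= M * q)%N ->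
  #|[set om : Om | lam * M < \sum_(k | om k %% q == b) w k]%N|%:R
    <= expR (2 - lam%:R / 2) * #|{: Om}|%:R :> R.
Proof.
move=> qp wM wsum; have /andP[q0 qlep] := qp.
have [M0|M0] := posnP M.
  rewrite (_ : [set _ | _] = set0) ?cards0 ?mulr_ge0 ?expR_ge0 //.
  apply/setP => om; rewrite !inE M0 muln0 big1 // => k _.
  by have := wM k; rewrite M0 leqn0 => /eqP.
have MR : 0 < (M%:R : R) by rewrite ltr0n.
pose x k : R := (w k)%:R / M%:R.
have x01 k : 0 <= x k <= 1.
  by rewrite divr_ge0 //= ler_pdivrMr // mul1r ler_nat.
pose f k (i : 'I_p) : R := 1 + x k * (i %% q == b)%N%:R.
have f0 k i : 0 <= f k i by rewrite addr_ge0 // mulr_ge0 //; case/andP: (x01 k).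
(* Markov's inequality for the exponential moment at parameter 1/2, with [expR (x / 2)] already
   replaced by [1 + x]. *)
have step1 om : (lam * M < \sum_(k | om k %% q == b) w k)%N%:R
    <= expR (- (lam%:R / 2)) * \prod_k f k (om k).
  case: ltnP => lt_load; last by rewrite mulr_ge0 ?expR_ge0 ?prodr_ge0.
  rewrite expRN ler_pdivlMl ?expR_gt0 // mulr1.
  apply: (@le_trans _ _ (\prod_(k | (om k %% q == b)%N) expR (x k / 2))).
    rewrite -expR_sum ler_expR -mulr_suml ler_pM2r ?invr_gt0 ?ltr0n //.
    rewrite -mulr_suml ler_pdivlMr // -natr_sum -natrM ler_nat; exact: ltnW.
  rewrite big_mkcond /=; apply: ler_prod => k _.
  rewrite /f; case: (_ == b); rewrite ?mulr1 ?mulr0 ?addr0 ?ler01 ?lexx //.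
  by rewrite expR_ge0 expR_half_le.
rewrite card_set_sum.
apply: le_trans (ler_sum _ (fun om _ => step1 om)) _.
rewrite -mulr_sumr -(bigA_distr_bigA f) card_ffun card_ord.
have -> : (2 - lam%:R / 2 : R) = - (lam%:R / 2) + 2 by ring.
rewrite expRD -mulrA ler_pM2l ?expR_gt0 //.
(* Each factor averages to at most [1 + 2 x / q], and the [x k] sum to at most [q]: this is the
   constant 2 in the exponent. *)
apply: (@le_trans _ _ (\prod_k (p%:R * expR (x k * (2 / q%:R))))).
  apply: ler_prod => k _; rewrite sumr_ge0 //=.
  rewrite big_split /= sumr_const card_ord -mulr_sumr -card_set_sum.
  have qR : 0 < (q%:R : R) by rewrite ltr0n.
  apply: (@le_trans _ _ (p%:R * (1 + x k * (2 / q%:R)))); last first.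
    by rewrite ler_wpM2l ?ler0n ?expR_ge1Dx.
  rewrite mulrDr mulr1 lerD2l mulrCA ler_wpM2l //; first by case/andP: (x01 k).
  by rewrite mulrA ler_pdivlMr // -!natrM ler_nat mulnC [(p * 2)%N]mulnC mulnC card_mod_class.
rewrite big_split /= prodr_const natrX mulrC.
rewrite ler_wpM2r ?exprn_ge0 // -expR_sum ler_expR -mulr_suml.
have xq : \sum_k x k <= q%:R.
  by rewrite -mulr_suml ler_pdivrMr // -natr_sum -natrM ler_nat mulnC.
by rewrite mulrA ler_pdivrMr ?ltr0n // mulrC ler_pM2l.
Qed.

(* [mix] replaces the coordinates in [A]; exchanging them between two functions
   is an involution, so resampling them preserves the uniform distribution. *)
Definition mix (A : {set K}) om om' : Om := [ffun k => if k \in A then om' k else om k].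

Lemma card_resample (A : {set K}) (B : {set Om}) :
  (#|B| * #|{: Om}| = \sum_om #|[set om' | mix A om om' \in B]|)%N.
Proof.
pose T (z : Om * Om) := (mix A z.1 z.2, mix A z.2 z.1).
have TK : involutive T.
  case=> om om'; rewrite /T /=; congr (_, _); apply/ffunP => k; rewrite !ffunE;
    by case: (k \in A).
rewrite -[#|{: Om}|]cardsT -cardsX -(card_preimset (setX B setT) (can_inj TK)).
rewrite -sum1_card (eq_bigl (fun z : Om * Om => xpredT z.1 && (mix A z.1 z.2 \in B))); last first.
  by move=> z; rewrite !inE andbT.
rewrite -(pair_big_dep xpredT (fun om om' => mix A om om' \in B) (fun _ _ => 1%N)) /=.
apply: eq_bigr => om _; rewrite sum1_card; apply: eq_card => om'; by rewrite inE.
Qed.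

(** The weights may be random as long as they read only coordinates outside [A] and vanish off [A]:
    resampling [A] then leaves them fixed and the previous bound applies. The bounds on the weights
    belong to the event, because they hold for some outcomes only. *)
Lemma balls_into_bins_resample (A : {set K}) (w : Om -> K -> nat) (q b lam M : nat) :
  (0 < q <= p)%N ->
  (forall om k, k \notin A -> w om k = 0%N) ->
  (forall om om', w (mix A om om') =1 w om) ->
  #|[set om : Om | [&& [forall k, w om k <= M], \sum_k w om k <= M * q &
      lam * M < \sum_(k | om k %% q == b) w om k]%N]|%:R
    <= expR (2 - lam%:R / 2) * #|{: Om}|%:R :> R.
Proof.
move=> qp wA wmix; set B := [set _ | _].
have [Om0|Om0] := posnP #|{: Om}|.
  by rewrite (_ : #|B| = 0%N) ?mulr_ge0 ?expR_ge0 //; apply/eqP; rewrite -leqn0 -Om0 max_card.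
rewrite -(@ler_pM2r _ #|{: Om}|%:R) ?ltr0n // -natrM (card_resample A) natr_sum.
rewrite [leRHS]mulr_natr -sumr_const; apply: ler_sum => om _.
have [cond|cond] := boolP ([forall k, w om k <= M] && (\sum_k w om k <= M * q))%N; last first.
  rewrite (_ : [set _ | _] = set0) ?cards0 ?mulr_ge0 ?expR_ge0 //.
  apply/setP => om'; rewrite !inE; apply: contraNF cond => /and3P[/forallP h1 h2 _].
  rewrite -(eq_bigr _ (fun k _ => wmix om om' k)) h2 andbT.
  by apply/forallP => k; rewrite -(wmix om om').
have /andP[/forallP h1 h2] := cond.
apply: le_trans (balls_into_bins b lam qp h1 h2); rewrite ler_nat.
apply: subset_leq_card; apply/subsetP => om'; rewrite !inE => /and3P[_ _].
rewrite (eq_bigr (w om)) => [|k _]; last exact: wmix.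
move/leq_trans; apply; rewrite [leqLHS]big_mkcond [leqRHS]big_mkcond /=.
apply: leq_sum => k _; rewrite ffunE; case: (boolP (k \in A)) => // /wA ->.
by rewrite if_same.
Qed.

End BallsIntoBins.

(** * Concentration for a hypercube distribution with several hashed variables *)

Section HyperCube.
Variables (R : realType) (K V A : finType) (p lam M : nat).
Variables (key : V -> A -> K) (q : V -> nat) (e : {set V}) (T : {set {ffun V -> A}}).
Local Notation Om := {ffun K -> 'I_p}.
Hypothesis key_inj : forall v a v' a', key v a = key v' a' -> v = v' /\ a = a'.
Hypothesis qp : forall v, 0 < q v <= p.
Hypothesis lam0 : 0 < lam.
Implicit Types (om : Om) (U X : {set V}) (x : {ffun V -> A}) (c : {ffun V -> 'I_p}).

Definition agree X x (t : {ffun V -> A}) := [forall v in X, t v == x v].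

Definition hashed om U c (t : {ffun V -> A}) :=
  [forall v in U, om (key v (t v)) %% q v == c v].

Definition cell_part om U X x c :=
  [set t in T | agree X x t && hashed om U c t].

Hypothesis degT : forall X x, X \subset e ->
  #|[set t in T | agree X x t]| <= M * \prod_(v in e :\: X) q v.

(* Bound on the tuples that agree with a given tuple on [X] once the variables
   in [U] are hashed: each variable hashed outside [X] saves a factor [q v] up to
   a loss of [lam]. *)
Definition part_bound U X := lam ^ #|U| * M * \prod_(v in e :\: (X :|: U)) q v.

Definition upd x v a : {ffun V -> A} := [ffun u => if u == v then a else x u].

(* The values of [v] are the balls, weighted by the number of tuples. *)
Definition overflow (i : {set V} * V * {set V} * {ffun V -> A} * {ffun V -> 'I_p}) om :=
  let: (U, v, X, x, c) := i in
  [&& v \notin U, v \notin X,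
      [forall a, #|cell_part om U (v |: X) (upd x v a) c| <= part_bound U (v |: X)],
      #|cell_part om U X x c| <= part_bound U (v |: X) * q v &
      lam * part_bound U (v |: X) < #|cell_part om (v |: U) X x c|].

Lemma agreeU1 X x v a t : v \notin X ->
  agree (v |: X) (upd x v a) t = (t v == a) && agree X x t.
Proof.
move=> vX; apply/forall_inP/andP => [h|[/eqP tv /forall_inP h] u].
  split; first by have := h v (setU11 _ _); rewrite ffunE eqxx.
  apply/forall_inP => u uX; have := h u (setU1r _ uX); rewrite ffunE.
  by case: (eqVneq u v) => // uv; move: vX; rewrite -uv uX.
by rewrite !inE ffunE; case: (eqVneq u v) => [-> _|_ /= /h //]; apply/eqP.
Qed.

Lemma hashedU1 om U v c t :
  hashed om (v |: U) c t = (om (key v (t v)) %% q v == c v) && hashed om U c t.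
Proof.
apply/forall_inP/andP => [h|[tv /forall_inP h] u].
  split; first by have := h v (setU11 _ _).
  by apply/forall_inP => u uX; have := h u (setU1r _ uX).
by rewrite !inE => /predU1P[->//|/h].
Qed.

Lemma cell_part_split om U X x c v (P : pred A) : v \notin X ->
  #|[set t in cell_part om U X x c | P (t v)]| =
  \sum_(a | P a) #|cell_part om U (v |: X) (upd x v a) c|.
Proof.
move=> vX; rewrite -sum1_card.
rewrite (partition_big (fun t : {ffun V -> A} => t v) P) /=; last first.
  by move=> t; rewrite inE => /andP[].
apply: eq_bigr => a Pa; rewrite -sum1_card; apply: eq_bigl => t.
by rewrite !inE agreeU1 //; case: (eqVneq (t v) a) => [->|]; rewrite ?Pa ?andbT ?andbF.
Qed.

(** As [v] is not in [U], the weights of its values do not read the buckets of [v], so these buckets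
    can be resampled. *)
Lemma card_overflow i :
  (#|[set om | overflow i om]|%:R <= expR (2 - lam%:R / 2) * #|{: Om}|%:R :> R)%R.
Proof.
case: i => -[[[U v] X] x] c.
have [vUX|vUX] := boolP ((v \notin U) && (v \notin X)); last first.
  rewrite (_ : [set _ | _] = set0) ?cards0 ?mulr_ge0 ?expR_ge0 //.
  by apply/setP => om; rewrite !inE /overflow andbA (negPf vUX).
have /andP[vU vX] := vUX.
pose W om k := \sum_(a | key v a == k) #|cell_part om U (v |: X) (upd x v a) c|.
pose B := [set key v a | a : A].
have keyv a a' : (key v a == key v a') = (a == a').
  by apply/eqP/eqP => [/key_inj[]|->].
have WE om a : W om (key v a) = #|cell_part om U (v |: X) (upd x v a) c|.
  by rewrite /W (eq_bigl (pred1 a)) ?big_pred1_eq // => a'; rewrite /= keyv.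
have Wsum om (P : pred K) :
    \sum_(k | P k) W om k = #|[set t in cell_part om U X x c | P (key v (t v))]|.
  rewrite (cell_part_split om U x c (fun a => P (key v a)) vX).
  rewrite /W (exchange_big_dep (fun a => P (key v a))) /=.
    apply: eq_bigr => a Pa; rewrite (eq_bigl (pred1 (key v a))) ?big_pred1_eq //.
    by move=> k /=; rewrite eq_sym; case: eqP => [->|]; rewrite ?Pa ?andbF.
  by move=> k a Pk /eqP->.
have W0 om k : k \notin B -> W om k = 0.
  by move=> kB; rewrite /W big1 // => a /eqP ka; case/negP: kB; rewrite -ka imset_f.
have Wmix om om' : W (mix B om om') =1 W om.
  move=> k; apply: eq_bigr => a _; apply: eq_card => t; rewrite !inE; congr (_ && (_ && _)).
  apply: eq_forallb_in => u uU; rewrite ffunE (_ : key u (t u) \in B = false) //.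
  apply/negP => /imsetP[a' _ /key_inj[uv _]]; by move: vU; rewrite -uv uU.
have := balls_into_bins_resample R (c v) lam (part_bound U (v |: X)) (qp v) W0 Wmix.
move/(le_trans _); apply; rewrite ler_nat; apply: subset_leq_card.
apply/subsetP => om; rewrite !inE /overflow => /and5P[_ _ /forallP h1 h2 h3].
rewrite !Wsum; apply/and3P; split.
- apply/forallP => k; have [/imsetP[a _ ->]|/W0->//] := boolP (k \in B).
  by rewrite WE.
- by apply: leq_trans h2; apply: subset_leq_card; apply/subsetP => t; rewrite inE => /andP[].
- apply: leq_trans h3 _; apply: subset_leq_card; apply/subsetP => t.
  by rewrite !inE hashedU1 => /and4P[-> -> -> ->].
Qed.

(** One variable [v] of [U] is hashed last. The induction hypothesis at [v |: X] bounds each ball,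
    at [X] the total weight, and the absence of overflow then bounds the bucket. *)
Lemma cell_part_bound om : (forall i, ~~ overflow i om) ->
  forall U X x c, U \subset e -> X \subset e ->
    #|cell_part om U X x c| <= part_bound U X.
Proof.
move=> good U; have [m] := ubnP #|U|; elim: m U => // m IH U.
have [->|[v vU]] := set_0Vmem U.
  move=> _ X x c _ Xe; rewrite /part_bound cards0 expn0 mul1n setU0.
  apply: leq_trans (degT x Xe); apply: subset_leq_card; apply/subsetP => t.
  by rewrite !inE => /and3P[-> ->].
rewrite ltnS (cardsD1 v) vU => Um X x c Ue Xe.
pose U' := U :\ v.
have UE : U = v |: U' by rewrite setD1K.
have vU' : v \notin U' by rewrite !inE eqxx.
have U'e : U' \subset e by apply: subset_trans Ue; apply: subsetDl.
have ve : v \in e by rewrite (subsetP Ue).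
have {}IH := IH U' Um.
(* A variable fixed by [X] gains nothing from hashing: its condition is dropped, at the cost of one
   factor [lam]. *)
have [vX|vX] := boolP (v \in X).
  apply: leq_trans (leq_trans (IH X x c U'e Xe) _).
    apply: subset_leq_card; apply/subsetP => t; rewrite !inE UE hashedU1.
    by case/and4P=> -> -> _ ->.
  rewrite /part_bound (_ : X :|: U = X :|: U').
    rewrite leq_mul2r leq_mul2r leq_pexp2l ?subset_leq_card ?orbT //.
    exact: subsetDl.
  by rewrite UE setUA (setUC X) -!setUA; apply/setUidPr; rewrite sub1set inE vX.
have vXe : v |: X \subset e by rewrite subUset sub1set ve.
have bE : part_bound U' (v |: X) * q v = part_bound U' X.
  rewrite /part_bound -mulnA; congr (_ * _).
  have vin : v \in e :\: (X :|: U') by rewrite in_setD in_setU negb_or vX vU' ve.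
  rewrite [RHS](big_setD1 v vin) /= mulnC; congr (_ * _).
  apply: eq_bigl => u; rewrite !inE.
  by case: (u == v); case: (u \in X); case: (u \in U); case: (u \in e).
have := good (U', v, X, x, c); rewrite /overflow vU' vX /= -UE bE (IH X) //=.
have -> : [forall a, #|cell_part om U' (v |: X) (upd x v a) c| <= part_bound U' (v |: X)].
  by apply/forallP => a; rewrite IH.
rewrite /= -leqNgt => /leq_trans; apply.
rewrite /part_bound UE cardsU1 vU' expnS -!mulnA leq_mul2l; apply/orP; right.
by rewrite leq_mul2l (_ : v |: X :|: U' = X :|: (v |: U')) ?leqnn ?orbT // setUCA setUA.
Qed.

Definition hypercube_bad :=
  [set om | [exists c, lam ^ #|e| * M < #|[set t in T | hashed om e c t]|]].

Lemma hypercube_whp :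
  (#|hypercube_bad|%:R <= #|{: {set V} * V * {set V} * {ffun V -> A} * {ffun V -> 'I_p}}|%:R
     * (expR (2 - lam%:R / 2) * #|{: Om}|%:R) :> R)%R.
Proof.
have sub : hypercube_bad \subset \bigcup_i [set om | overflow i om].
  apply/subsetP => om; rewrite inE => /existsP[c]; apply: contraTT => nov.
  have good i : ~~ overflow i om.
    by apply: contra nov => ov; apply/bigcupP; exists i; rewrite ?inE.
  (* For empty [X] any tuple can serve as [x]; an empty [T] is treated apart because there might be
     no tuple at all. *)
  have [T0|[t0 t0T]] := set_0Vmem T.
    rewrite (_ : [set _ in _ | _] = set0) ?cards0 //.
    by apply/setP => t; rewrite T0 !inE.
  have := cell_part_bound good t0 c (subxx e) (sub0set e).
  rewrite /part_bound set0U setDv big_set0 muln1 -leqNgt; apply: leq_trans.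
  apply: subset_leq_card; apply/subsetP => t; rewrite !inE => /andP[-> ->].
  by rewrite andbT; apply/forall_inP => v; rewrite inE.
apply: (@le_trans _ _ (\sum_i #|[set om | overflow i om]|)%:R%R).
  by rewrite ler_nat; apply: leq_trans (subset_leq_card sub) (card_bigcup_le _).
rewrite natr_sum mulr_natl -sumr_const; apply: ler_sum => i _; exact: card_overflow.
Qed.

End HyperCube.

(** * Regular sampling *)

Section RegularSampling.
Variables (T : eqType) (f : T -> nat) (x0 : T) (g : nat).
Hypotheses (f_inj : injective f) (g0 : 0 < g).
Implicit Types (l s : seq T) (x y : T).

Definition increasing l := sorted (fun x y => f x < f y) l.

Definition rk s x := count (fun y => f y <= f x) s.

Definition samples l :=
  [seq nth x0 l (g * i) | i <- iota 0 (size l %/ g).+1 & g * i < size l].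

Lemma increasing_cons x l : increasing (x :: l) ->
  (forall y, y \in l -> f x < f y) /\ increasing l.
Proof.
rewrite /increasing /= => h; split; last exact: path_sorted h.
move=> y; apply/allP: y; apply: order_path_min h => a b c; exact: ltn_trans.
Qed.

Lemma nth_le_rk l x i : increasing l -> i < size l -> (f (nth x0 l i) <= f x) = (i < rk l x).
Proof.
elim: l i => // y l IH i /increasing_cons[ymin /IH{}IH].
have [yx|xy] := boolP (f y <= f x); last rewrite -ltnNge in xy.
  rewrite /rk /= yx -/(rk l x) add1n; case: i => [|i] /=; first by rewrite yx.
  by rewrite !ltnS; apply: IH.
have -> : rk (y :: l) x = 0.
  rewrite /rk; apply/eqP; rewrite -leqn0 leqNgt -has_count; apply/hasPn => z.
  rewrite inE -ltnNge => /predU1P[->//|/ymin]; exact: ltn_trans.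
move=> il; rewrite ltn0; apply/negbTE; rewrite -ltnNge.
by case: i il => //= i il; apply: ltn_trans xy _; rewrite ymin ?mem_nth.
Qed.

Lemma rk_size l x : rk l x <= size l.
Proof. exact: count_size. Qed.

(** Samples sit at the positions divisible by [g], so the rank among them is [rk l x / g] rounded
    up. *)
Lemma rk_samples l x : increasing l ->
  rk l x <= g * rk (samples l) x /\ g * rk (samples l) x < rk l x + g.
Proof.
move=> inc; set r := rk l x.
have -> : rk (samples l) x = count (fun i => i < (r + g.-1) %/ g) (iota 0 (size l %/ g).+1).
  rewrite /rk count_map count_filter; apply: eq_in_count => i _ /=.
  rewrite leq_divRL // [i.+1 * g]mulnC.
  have [il|il] := boolP (g * i < size l).
    rewrite nth_le_rk // andbT -/r; lia.
  rewrite andbF; have := rk_size l x; rewrite -/r; lia.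
have count_iota m c : count (fun i => i < c) (iota 0 m) = minn m c.
  elim: m c => [c|m IH c]; first by rewrite min0n.
  rewrite -addn1 iotaD count_cat IH /= add0n addn0; lia.
rewrite count_iota.
have rl : r <= size l by exact: rk_size.
have -> : minn (size l %/ g).+1 ((r + g.-1) %/ g) = (r + g.-1) %/ g.
  apply/minn_idPr; rewrite -ltnS ltn_divLR //.
  have := ltn_ceil (size l) g0; move: (_ %/ _) => d; nia.
have := divn_eq (r + g.-1) g; have := ltn_pmod (r + g.-1) g0.
set d := _ %/ _; set m := _ %% _; nia.
Qed.

Lemma size_samples l p : size l <= g * p -> size (samples l) <= p.
Proof.
move=> lp; rewrite size_map -(size_iota 0 p); apply: uniq_leq_size.
  by rewrite filter_uniq ?iota_uniq.
move=> i; rewrite mem_filter !mem_iota add0n => /andP[il _] /=.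
by rewrite -(ltn_pmul2l g0); apply: leq_trans il lp.
Qed.

Variables (p : nat) (l : 'I_p -> seq T).
Hypothesis l_inc : forall j, increasing (l j).
Let S := flatten [seq samples (l j) | j <- enum 'I_p].

(** The predecessor puts the sample ranks 1 to [p] into block 0. With at most [p * p] samples there
    are at most [p] blocks, one per machine. *)
Definition sample_owner x := (rk S x).-1 %/ p.

Lemma rk_flatten x : rk S x = \sum_j rk (samples (l j)) x.
Proof. by rewrite /rk count_flatten -map_comp sumnE big_map big_enum. Qed.

Lemma sample_owner_lt x : (forall j, size (l j) <= g * p) -> 0 < p -> sample_owner x < p.
Proof.
move=> lp p0; rewrite /sample_owner ltn_divLR //.
have : rk S x <= p * p.
  rewrite rk_flatten; apply: (@leq_trans (\sum_(j < p) p)).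
    by apply: leq_sum => j _; apply: leq_trans (rk_size _ _) (size_samples (lp j)).
  by rewrite sum_nat_const card_ord.
have pp : 0 < p * p by rewrite muln_gt0 p0.
by case: (rk S x).
Qed.

Lemma increasing_uniq l' : increasing l' -> uniq l'.
Proof.
have tr : transitive (fun x y => f x < f y) by move=> y x z; exact: ltn_trans.
exact: (sorted_uniq tr (fun x => ltnn (f x))).
Qed.

Lemma count_between l' x y : increasing l' -> f x <= f y ->
  count (fun z => f x <= f z <= f y) l' + g * rk (samples l') x <= g * rk (samples l') y + g.
Proof.
move=> inc xy; have [_ h1] := rk_samples x inc; have [h2 _] := rk_samples y inc.
(* Counting [x] itself costs the extra 1, which the strict inequality of [rk_samples] pays for. *)
suff : count (fun z => f x <= f z <= f y) l' + rk l' x <= rk l' y + 1 by lia.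
have cx : count_mem x l' <= 1 by rewrite count_uniq_mem ?increasing_uniq ?leq_b1.
have -> : rk l' x = count_mem x l' + count (fun z => f z < f x) l'.
  elim: l' {inc h1 h2 cx} => //= z l' IH; rewrite /rk /= -/(rk l' x) IH.
  rewrite leq_eqVlt (inj_eq f_inj); case: eqP => [->|_] /=; rewrite ?ltnn; lia.
have -> : rk l' y = count (fun z => f x <= f z <= f y) l' + count (fun z => f z < f x) l'.
  elim: l' {inc h1 h2 cx} => //= z l' IH; rewrite /rk /= -/(rk l' y) IH; lia.
lia.
Qed.

(** A block lies between its least and its greatest element, whose sample ranks differ by less than
    [p]. This accounts for at most [p * g] elements, and rounding in each of the [p] lists for [g]
    more. *)
Lemma sample_owner_load b : \sum_j count (fun x => sample_owner x == b) (l j) <= 2 * p * g.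
Proof.
pose inb x := sample_owner x == b; pose L := [seq x <- flatten [seq l j | j <- enum 'I_p] | inb x].
have memL x : (x \in L) = inb x && [exists j, x \in l j].
  rewrite mem_filter; congr (_ && _); apply/flattenP/existsP => [[_ /mapP[j _ ->]]|[j xj]].
    by exists j.
  by exists (l j); rewrite ?map_f ?mem_enum.
have [L0|[x xL]] : L = [::] \/ exists x, x \in L.
  by case: (L) => [|x s]; [left|right; exists x; rewrite mem_head].
  rewrite big1 // => j _; apply/eqP; rewrite -leqn0 leqNgt -has_count.
  apply/hasPn => x xj; apply/negP => xb; have := memL x; rewrite L0 /inb xb.
  by move/esym/negbT/existsPn/(_ j); rewrite xj.
have p0 : 0 < p by move: xL; rewrite memL => /andP[_ /existsP[[j jp] _]]; apply: leq_ltn_trans jp.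
have exmin : exists2 y, y \in L & forall z, z \in L -> f y <= f z.
  have exn : exists n, has (fun z => f z == n) L.
    by exists (f x); apply/hasP; exists x.
  case: (ex_minnP exn) => m /hasP[y yL /eqP fy] mmin; exists y => // z zL.
  by rewrite fy mmin //; apply/hasP; exists z.
have exmax : exists2 y, y \in L & forall z, z \in L -> f z <= f y.
  have exn : exists n, has (fun z => f z == n) L.
    by exists (f x); apply/hasP; exists x.
  have bnd n : has (fun z => f z == n) L -> n <= sumn (map f L).
    case/hasP=> z zL /eqP<-; elim: (L) zL => //= u s IH; rewrite inE.
    by case/predU1P => [->|/IH/leq_trans]; [exact: leq_addr|apply; exact: leq_addl].
  case: (ex_maxnP exn bnd) => m /hasP[y yL /eqP fy] mmax; exists y => // z zL.
  by rewrite fy mmax //; apply/hasP; exists z.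
have [y yL ymin] := exmin; have [z zL zmax] := exmax.
have yz := ymin _ zL.
have : \sum_j count (fun x => sample_owner x == b) (l j) + g * rk S y <= g * rk S z + g * p.
  have -> : g * p = \sum_(j < p) g by rewrite sum_nat_const card_ord mulnC.
  rewrite !rk_flatten !big_distrr /= -!big_split /=.
  apply: leq_sum => j _; apply: leq_trans (count_between (l_inc j) yz).
  rewrite leq_add2r -!size_filter; apply: uniq_leq_size.
    by rewrite filter_uniq ?increasing_uniq.
  move=> u; rewrite !mem_filter => /andP[ub uj]; rewrite uj andbT.
  have uL : u \in L by rewrite memL /inb ub; apply/existsP; exists j.
  by rewrite ymin ?zmax.
have rky : b * p < rk S y.
  have rk0 : 0 < rk S y.
    rewrite rk_flatten; move: yL; rewrite memL => /andP[_ /existsP[j yj]].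
    rewrite (bigD1 j) //= addn_gt0; apply/orP; left.
    have [h _] := rk_samples y (l_inc j).
    rewrite -(ltn_pmul2l g0) muln0; apply: leq_trans h.
    by rewrite /rk -has_count; apply/hasP; exists y.
  move: yL; rewrite memL /inb /sample_owner => /andP[/eqP <- _].
  by apply: leq_ltn_trans (leq_trunc_div _ _) _; rewrite prednK.
have rkz : rk S z <= b * p + p.
  move: zL; rewrite memL /inb /sample_owner => /andP[/eqP <- _].
  have := ltn_ceil (rk S z).-1 p0; lia.
nia.
Qed.

End RegularSampling.

(** * The protocol *)

Section TypedProtocol.
Variables (V : finType) (p : nat) (T : Type) (enc : T -> seq nat) (dec : seq nat -> seq T).
Hypothesis encK : forall s, dec (flatten (map enc s)) = s.

Variable r : nat.
Variable tsend : nat -> 'I_p -> seq (item V) -> seq (seq (seq T)) -> 'I_p -> seq T.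
Variable tout : 'I_p -> seq (item V) -> seq (seq (seq T)) -> seq (rtuple V).

Definition compile : mpc_alg V p :=
  MPCAlg r (fun k j s h i => flatten (map enc (tsend k j s (map (map dec) h) i)))
    (fun i s h => tout i s (map (map dec) h)).

Variable inp : 'I_p -> seq (item V).

Fixpoint thist (k : nat) : 'I_p -> seq (seq (seq T)) :=
  match k with
  | 0 => fun _ => [::]
  | k'.+1 => let h := thist k' in
      fun i => rcons (h i) [seq tsend k' j (inp j) (h j) i | j <- enum 'I_p]
  end.

Definition tmsg k (j i : 'I_p) := tsend k j (inp j) (thist k j) i.

Lemma thistE k i : map (map dec) (hist compile inp k i) = thist k i.
Proof.
elim: k i => //= k IH i; rewrite map_rcons IH; congr rcons.
by rewrite -map_comp; apply: eq_map => j /=; rewrite encK IH.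
Qed.

Lemma msg_compile k j i : msg compile inp k j i = flatten (map enc (tmsg k j i)).
Proof. by rewrite /msg /tmsg /= thistE. Qed.

Lemma output_compile i :
  output compile i (inp i) (hist compile inp r i) = tout i (inp i) (thist r i).
Proof. by rewrite /= thistE. Qed.

Lemma size_thist k i : size (thist k i) = k.
Proof. by elim: k => //= k IH; rewrite size_rcons IH. Qed.

Definition rcv k i := [seq tmsg k j i | j <- enum 'I_p].

Lemma nth_thist k k' i : k' < k -> nth [::] (thist k i) k' = rcv k' i.
Proof.
elim: k => //= k IH; rewrite ltnS leq_eqVlt nth_rcons size_thist => /predU1P[->|lt].
  by rewrite ltnn eqxx.
by rewrite lt IH.
Qed.

Lemma nth_rcv k i (j : 'I_p) : nth [::] (rcv k i) j = tmsg k j i.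
Proof. by rewrite (nth_map j) ?size_enum_ord // nth_ord_enum. Qed.

Lemma recv_load_compile m k i : (forall t, size (enc t) = m) ->
  recv_load compile inp k i = m * \sum_(j < p) size (tmsg k j i).
Proof.
move=> sz; rewrite /recv_load big_distrr; apply: eq_bigr => j _.
rewrite msg_compile; elim: (tmsg _ _ _) => [|t s IH] /=; first by rewrite muln0.
by rewrite size_cat sz IH mulnS.
Qed.

End TypedProtocol.

Section Encoding.
Variables (V F : finType) (c0 : F).

(** The finite part becomes a single word, its rank; the values of the tuple are sent unchanged,
    since the active domain is legal. All records have the same length, so a concatenation can be
    cut without separators. *)
Definition enc_rec (r : F * rtuple V) : seq nat :=
  (enum_rank r.1 : nat) :: [seq r.2 v | v <- enum V].

Definition dec_rec (s : seq nat) : F * rtuple V :=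
  (nth c0 (enum F) (head 0 s), [ffun v => nth 0 (behead s) (index v (enum V))]).

Definition dec_recs (s : seq nat) : seq (F * rtuple V) :=
  map dec_rec (reshape (nseq (size s %/ #|V|.+1) #|V|.+1) s).

Lemma size_enc_rec r : size (enc_rec r) = #|V|.+1.
Proof. by rewrite /= size_map -cardE. Qed.

Lemma enc_recK : cancel enc_rec dec_rec.
Proof.
move=> [c t]; rewrite /dec_rec /= nth_enum_rank; congr (_, _).
apply/ffunP => v; rewrite ffunE (nth_map v) ?index_mem ?mem_enum //.
by rewrite nth_index ?mem_enum.
Qed.

Lemma dec_recsK s : dec_recs (flatten (map enc_rec s)) = s.
Proof.
rewrite /dec_recs; have shp : shape (map enc_rec s) = nseq (size s) #|V|.+1.
  by elim: s => //= r s ->; rewrite size_map -cardE.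
have -> : size (flatten (map enc_rec s)) %/ #|V|.+1 = size s.
  by rewrite size_flatten shp sumn_nseq mulKn.
by rewrite -shp flattenK -map_comp (eq_map enc_recK) map_id.
Qed.

End Encoding.

(** * Messages and local computations of the join protocol *)

Section Protocol.
Variables (V : finType) (E : {set {set V}}) (p B D g : nat).
Local Notation num := 'I_D.+1.
Local Notation ids := {ffun V -> num}.
Local Notation conf := {ffun {set V} * {set V} -> 'I_B.+1}.
Local Notation key := ({set V} * {set V} * rtuple V)%type.
Local Notation code := ({set V} * {set V} * conf * (num * num) * ids)%type.
Local Notation rec := (code * rtuple V)%type.
Local Notation annotated := (item V * ids * {ffun {set V} -> 'I_B.+1})%type.

Variables (sh : conf -> share V) (w1 : conf -> V -> num -> nat) (w2 : {set V} -> ids -> nat).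

Definition zero_tuple : rtuple V := [ffun=> 0].
Definition zero_ids : ids := [ffun=> ord0].
Definition zero_conf : conf := [ffun=> ord0].
Definition code0 : code := (set0, set0, zero_conf, (ord0, ord0), zero_ids).
Definition key0 : key := (set0, set0, zero_tuple).

Definition mk_rec e X (gam : conf) (a b : num) (x : ids) (t : rtuple V) : rec :=
  (e, X, gam, (a, b), x, t).
Definition rE (r : rec) : {set V} := r.1.1.1.1.1.
Definition rX (r : rec) : {set V} := r.1.1.1.1.2.
Definition rC (r : rec) : conf := r.1.1.1.2.
Definition rA (r : rec) : num := r.1.1.2.1.
Definition rB (r : rec) : num := r.1.1.2.2.
Definition rI (r : rec) : ids := r.1.2.
Definition rT (r : rec) : rtuple V := r.2.

Definition key_rec (k : key) (a : num) : rec :=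
  mk_rec k.1.1 k.1.2 zero_conf a ord0 zero_ids k.2.
Definition rec_key (r : rec) : key := (rE r, rX r, rT r).

(* A key (e, X, x) stands for the value x of the tuples of e on X; a key with
   first component [set0], which is not a hyperedge, names the value of a
   variable. *)
Definition val_key v (a : nat) : key :=
  (set0, [set v], [ffun u => if u \in [set v] then a else 0]).

Definition item_keys (it : item V) : seq key :=
  [seq (it.1, X, restr X it.2) | X <- enum (powerset it.1)] ++
  [seq val_key v (it.2 v) | v <- enum it.1].

Definition pkey (k : key) : nat := choice.pickle k.

Definition local_keys (s : seq (item V)) : seq key :=
  sort (fun k k' => pkey k <= pkey k') (undup (flatten (map item_keys s))).

Definition matches (k : key) (it : item V) :=
  (it.1 == k.1.1) && (restr k.1.2 it.2 == k.2).

Definition send_samples s : seq rec :=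
  [seq key_rec k ord0 | k <- samples key0 g (local_keys s)].

Definition key_owner (R0 : seq (seq rec)) (k : key) :=
  (rk pkey (map rec_key (flatten R0)) k).-1 %/ p.

Definition keys_to s R0 (i : nat) := [seq k <- local_keys s | key_owner R0 k == i].

Definition send_keys s R0 i : seq rec :=
  [seq key_rec k (inord (count (matches k) s)) | k <- keys_to s R0 i].

(** The name is the position in the owner's list times [p] plus the owner's index, so names given by
    different owners differ modulo [p]. *)
Definition answer_key (R1 : seq (seq rec)) (i : nat) (k : key) : rec :=
  mk_rec set0 set0 zero_conf
    (inord (\sum_(r <- flatten R1 | rec_key r == k) rA r))
    (inord (index k (undup (map rec_key (flatten R1))) * p + i)) zero_ids zero_tuple.

(** Replies repeat no key: they come in the order of the questions and are found by position.
    [send_bits] does the same. *)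
Definition send_answers R1 (i j : nat) : seq rec :=
  [seq answer_key R1 i (rec_key r) | r <- nth [::] R1 j].

Definition answer s R0 (R2 : seq (seq rec)) (k : key) : rec :=
  let i := key_owner R0 k in
  nth (key_rec key0 ord0) (nth [::] R2 i) (index k (keys_to s R0 i)).

Definition annotate s R0 R2 : seq annotated :=
  [seq (it, [ffun v => if v \in it.1 then rB (answer s R0 R2 (val_key v (it.2 v))) else ord0],
       [ffun X : {set V} => if X \subset it.1 then
          inord (trunc_log 2 (rA (answer s R0 R2 (it.1, X, restr X it.2)))) else ord0])
   | it : item V <- s].

Definition restr_ids (X : {set V}) (x : ids) : ids :=
  [ffun v => if v \in X then x v else ord0].

Definition send_to_owner (L : seq annotated) (i : nat) : seq rec :=
  [seq mk_rec a.1.1.1 set0 zero_conf ord0 ord0 a.1.2 zero_tuple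
  | a <- L & w2 a.1.1.1 a.1.2 == i].

Definition of_type (gam : conf) (e : {set V}) (ty : {ffun {set V} -> 'I_B.+1}) :=
  [forall X : {set V}, (X \subset e) ==> (ty X == gam (e, X))].

(** A pair [(e, X)] stands for the tuples of [e] projected on [X]: whole tuples for dominating
    edges, projections for witnesses. *)
Definition views gam : {set {set V} * {set V}} :=
  [set (sdom (sh gam) e0, sdom (sh gam) e0) | e0 in E & ~~ (e0 \subset sZ (sh gam))]
  :|: [set swit (sh gam) z | z in sZ (sh gam)].

(** If there are fewer cells than machines, the default gives an idle machine some assignment. This
    is harmless: the load bounds hold for every assignment, and whatever is output has been
    confirmed. *)
Definition cell gam (i : 'I_p) : {ffun V -> 'I_p} :=
  nth [ffun=> i] (enum [pred c : {ffun V -> 'I_p} | [forall v, c v < sq (sh gam) v]]) i.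

Definition in_cell gam (X : {set V}) (c : {ffun V -> 'I_p}) (x : ids) :=
  [forall v in X, w1 gam v (x v) %% sq (sh gam) v == c v].

(** Many tuples of [e] may share a projection, and only the number of distinct projections in a cell
    is bounded; hence [undup]. *)
Definition view_tuples (L : seq annotated) gam (e X : {set V}) (i : 'I_p) :
    seq (ids * rtuple V) :=
  undup [seq (restr_ids X a.1.2, restr X a.1.1.2)
        | a <- L & [&& a.1.1.1 == e, of_type gam e a.2 & in_cell gam X (cell gam i) a.1.2]].

Definition send_views (L : seq annotated) (i : 'I_p) : seq rec :=
  flatten [seq flatten [seq
    [seq mk_rec w.1 w.2 gam ord0 ord0 xt.1 xt.2 | xt <- view_tuples L gam w.1 w.2 i]
    | w <- enum (views gam)] | gam <- enum {: conf}].

Definition received_view (R4 : seq (seq rec)) gam (w : {set V} * {set V}) : seq rec :=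
  [seq r <- flatten R4 | [&& rC r == gam, rE r == w.1 & rX r == w.2]].

(* The tuples over [e0] that can occur in the join of a cell: values of [sZ] are
   among those received for their witness, the others come from one tuple of the
   edge that dominates [e0]. *)
Definition candidates R4 gam (e0 : {set V}) : {set ids} :=
  [set x : ids | [&& [forall v, (v \notin e0) ==> (x v == ord0)],
     [forall z in e0 :&: sZ (sh gam),
        has (fun r => rI r z == x z) (received_view R4 gam (swit (sh gam) z))] &
     (e0 \subset sZ (sh gam)) ||
     has (fun r => [forall v in e0 :\: sZ (sh gam), rI r v == x v])
       (received_view R4 gam (sdom (sh gam) e0, sdom (sh gam) e0))]].

Definition queries R4 : {set {set V} * ids} :=
  [set k | (k.1 \in E) && [exists gam, k.2 \in candidates R4 gam k.1]].

Definition queries_to R4 (i : nat) := [seq k <- enum (queries R4) | w2 k.1 k.2 == i].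

Definition send_queries R4 i : seq rec :=
  [seq mk_rec k.1 set0 zero_conf ord0 ord0 k.2 zero_tuple | k <- queries_to R4 i].

Definition bit_rec (b : bool) : rec :=
  mk_rec (if b then setT else set0) set0 zero_conf ord0 ord0 zero_ids zero_tuple.

Definition send_bits (R3 R5 : seq (seq rec)) (i : nat) : seq rec :=
  [seq bit_rec ((rE r, rI r) \in [seq (rE r', rI r') | r' <- flatten R3])
  | r <- nth [::] R5 i].

Definition confirmed R4 (R6 : seq (seq rec)) (k : {set V} * ids) :=
  (k \in queries R4) &&
  (rE (nth (bit_rec false) (nth [::] R6 (w2 k.1 k.2)) (index k (queries_to R4 (w2 k.1 k.2))))
     != set0).

(** Queries and candidates consist of names; the values needed for the output are recovered from the
    records of the hypercube round. *)
Definition dictionary (R4 : seq (seq rec)) v (a : num) : nat :=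
  head 0 [seq rT r v | r <- flatten R4 & (v \in rX r) && (rI r v == a)].

Definition join_output R4 R6 : seq (rtuple V) :=
  [seq [ffun v => dictionary R4 v (x v)] | x : ids <- enum {: ids} &
    [forall e0 in E, confirmed R4 R6 (e0, restr_ids e0 x)]].

(* Rounds 0 to 2 compute degrees and names of values, round 3 stores every tuple
   at the machine chosen by [w2], round 4 is the hypercube, and in rounds 5 and 6
   every cell looks up its candidates. *)
Definition protocol_send (k : nat) (j : 'I_p) (s : seq (item V))
    (h : seq (seq (seq rec))) (i : 'I_p) : seq rec :=
  let R := nth [::] h in
  match k with
  | 0 => send_samples s
  | 1 => send_keys s (R 0) i
  | 2 => send_answers (R 1) j i
  | 3 => send_to_owner (annotate s (R 0) (R 2)) i
  | 4 => send_views (annotate s (R 0) (R 2)) i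
  | 5 => send_queries (R 4) i
  | 6 => send_bits (R 3) (R 5) i
  | _ => [::]
  end.

Definition protocol_output (i : 'I_p) (s : seq (item V)) (h : seq (seq (seq rec))) :=
  join_output (nth [::] h 4) (nth [::] h 6).

Definition join_alg : mpc_alg V p :=
  compile (@enc_rec V code) (@dec_recs V code code0) 7 protocol_send protocol_output.

Section Run.
Variable inp : 'I_p -> seq (item V).

Local Notation sent := (tmsg protocol_send inp).
Local Notation R := (rcv protocol_send inp).

Lemma sent0 j i : sent 0 j i = send_samples (inp j). Proof. by []. Qed.

Let R0 := [seq send_samples (inp j) | j <- enum 'I_p].

Lemma sent1 j i : sent 1 j i = send_keys (inp j) R0 i.
Proof. by rewrite /tmsg /protocol_send nth_thist. Qed.

Lemma sent2 j i : sent 2 j i = send_answers (R 1 j) j i.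
Proof. by rewrite /tmsg /protocol_send nth_thist. Qed.

Lemma sent3 j i : sent 3 j i = send_to_owner (annotate (inp j) R0 (R 2 j)) i.
Proof. by rewrite /tmsg /protocol_send !nth_thist. Qed.

Lemma sent4 j i : sent 4 j i = send_views (annotate (inp j) R0 (R 2 j)) i.
Proof. by rewrite /tmsg /protocol_send !nth_thist. Qed.

Lemma sent5 j i : sent 5 j i = send_queries (R 4 j) i.
Proof. by rewrite /tmsg /protocol_send !nth_thist. Qed.

Lemma sent6 j i : sent 6 j i = send_bits (R 3 j) (R 5 j) i.
Proof. by rewrite /tmsg /protocol_send !nth_thist. Qed.

Lemma output_join i : output join_alg i (inp i) (hist join_alg inp (rounds join_alg) i) =
  join_output (R 4 i) (R 6 i).
Proof.
rewrite output_compile; last exact: dec_recsK.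
by rewrite /protocol_output !nth_thist.
Qed.

End Run.
End Protocol.

(** * Correctness and load of the rounds that compute degrees and names *)

Section Statistics.
Variables (V : finType) (E : {set {set V}}) (p B D g : nat).
Local Notation num := 'I_D.+1.
Local Notation ids := {ffun V -> num}.
Local Notation conf := {ffun {set V} * {set V} -> 'I_B.+1}.
Local Notation key := ({set V} * {set V} * rtuple V)%type.
Local Notation code := ({set V} * {set V} * conf * (num * num) * ids)%type.
Local Notation rec := (code * rtuple V)%type.
Variables (sh : conf -> share V) (w1 : conf -> V -> num -> nat) (w2 : {set V} -> ids -> nat).
Variable inp : 'I_p -> seq (item V).

Local Notation send := (protocol_send E g sh w1 w2).
Local Notation sent := (tmsg send inp).
Local Notation R := (rcv send inp).
Local Notation all_items := (flatten [seq inp j | j <- enum 'I_p]).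
Local Notation R0 := [seq send_samples B D g (inp j) | j <- enum 'I_p].
Local Notation owner := (key_owner p R0).
Local Notation keys_per_item := (2 ^ #|V| + #|V|).

Hypothesis E0 : set0 \notin E.
Hypothesis itemsE : forall it, it \in all_items -> it.1 \in E.
Hypothesis p0 : 0 < p.
Hypothesis g0 : 0 < g.
Hypothesis keys_gp : forall j, size (local_keys (inp j)) <= g * p.
Hypothesis items_D : (size all_items * keys_per_item).+1 * p <= D.

Lemma pkey_inj : injective (@pkey V).
Proof. exact: (pcan_inj choice.pickleK). Qed.

Lemma mem_all j it : it \in inp j -> it \in all_items.
Proof. by move=> itj; apply/flattenP; exists (inp j) => //; rewrite map_f ?mem_enum. Qed.

Lemma sum_inp (G : item V -> nat) :
  \sum_(it <- all_items) G it = \sum_j \sum_(it <- inp j) G it.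
Proof. by rewrite big_flatten big_map big_enum. Qed.

Lemma size_all : size all_items = \sum_j size (inp j).
Proof.
rewrite -sum1_size sum_inp; apply: eq_bigr => j _; exact: sum1_size.
Qed.

Lemma count_all (P : pred (item V)) : count P all_items = \sum_j count P (inp j).
Proof.
rewrite -sum1_count big_mkcond /= sum_inp; apply: eq_bigr => j _.
by rewrite -sum1_count [RHS]big_mkcond.
Qed.

Lemma items_le_D : size all_items <= D.
Proof.
apply: leq_trans items_D; apply: leq_trans (leq_pmulr _ p0).
by apply: leqW; rewrite leq_pmulr // addn_gt0 expn_gt0.
Qed.

Lemma local_keysP (s : seq (item V)) k :
  reflect (exists2 it, it \in s & k \in item_keys it) (k \in local_keys s).
Proof.
rewrite mem_sort mem_undup; apply: (iffP flattenP) => [[_ /mapP[it its ->] ?]|[it its ?]].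
  by exists it.
by exists (item_keys it); rewrite ?map_f.
Qed.

Lemma item_keysP (it : item V) k :
  reflect ((exists2 X : {set V}, X \subset it.1 & k = (it.1, X, restr X it.2)) \/
           (exists2 v, v \in it.1 & k = val_key v (it.2 v))) (k \in item_keys it).
Proof.
rewrite mem_cat; apply: (iffP orP) => [[|]/mapP[x]|[[X]|[v]]].
- by rewrite mem_enum powersetE => ? ->; left; exists x.
- by rewrite mem_enum => ? ->; right; exists x.
- by move=> Xe ->; left; apply: (map_f (fun X => (it.1, X, restr X it.2))); rewrite mem_enum powersetE.
- by move=> ve ->; right; apply: (map_f (fun v => val_key v (it.2 v))); rewrite mem_enum.
Qed.

Lemma size_local_keys (s : seq (item V)) : size (local_keys s) <= size s * keys_per_item.
Proof.
rewrite size_sort; apply: leq_trans (size_undup _) _.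
elim: s => //= it s IH; rewrite size_cat mulSn leq_add //.
rewrite size_cat !size_map -!cardE card_powerset leq_add ?max_card //.
by rewrite leq_pexp2l ?max_card.
Qed.

Lemma local_keys_increasing (s : seq (item V)) : increasing (@pkey V) (local_keys s).
Proof.
rewrite /increasing -(@sorted_map _ _ (@pkey V) ltn) ltn_sorted_uniq_leq.
rewrite (map_inj_uniq pkey_inj) sort_uniq undup_uniq /= sorted_map.
by apply: sort_sorted => k k'; exact: leq_total.
Qed.

Lemma rec_keyK (k : key) a : rec_key (key_rec B k a : rec) = k.
Proof. by case: k => -[]. Qed.

Lemma map_rec_keyK (s : seq key) (F : key -> num) :
  map (@rec_key V B D) [seq key_rec B k (F k) | k <- s] = s.
Proof. by rewrite -map_comp (eq_map (fun k => rec_keyK k (F k))) map_id. Qed.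

Lemma ownerE k :
  owner k = sample_owner (@pkey V) (key0 V) g (fun j : 'I_p => local_keys (inp j)) k.
Proof.
rewrite /key_owner /sample_owner map_flatten -map_comp; congr ((rk _ (flatten _) _).-1 %/ p).
by apply: eq_map => j /=; rewrite map_rec_keyK.
Qed.

Lemma owner_lt k : owner k < p.
Proof. by rewrite ownerE sample_owner_lt // => j; exact: local_keys_increasing. Qed.

Lemma owner_load i : \sum_j size (keys_to p (inp j) R0 i) <= 2 * p * g.
Proof.
apply: leq_trans (_ : _ <= 2 * p * g); last first.
  exact: (@sample_owner_load _ _ (key0 V) g pkey_inj g0 p (fun j : 'I_p => local_keys (inp j))
           (fun j => local_keys_increasing (inp j)) i).
by apply: leq_sum => j _; rewrite size_filter; apply: sub_count => k; rewrite ownerE.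
Qed.

Definition owned (i : nat) : seq key := undup (flatten [seq keys_to p (inp j) R0 i | j <- enum 'I_p]).

Definition key_id (k : key) : nat := index k (owned (owner k)) * p + owner k.

Lemma rcv1_keys (i : 'I_p) :
  map (@rec_key V B D) (flatten (R 1 i)) = flatten [seq keys_to p (inp j) R0 i | j <- enum 'I_p].
Proof.
rewrite map_flatten -map_comp; congr flatten; apply: eq_map => j /=.
by rewrite sent1 map_rec_keyK.
Qed.

Lemma keys_to_mem s i k : (k \in keys_to p s R0 i) = (owner k == i) && (k \in local_keys s).
Proof. by rewrite mem_filter. Qed.

Lemma matches_keys j k it : k.1.1 \in E -> k \in local_keys (inp j) ->
  matches k it -> k \in item_keys it.
Proof.
move=> kE /local_keysP[it' _ /item_keysP[[X Xe kX]|[v _ kv]]] /andP[/eqP e1 /eqP e2].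
  apply/item_keysP; left; exists X; first by rewrite e1 kX.
  by rewrite e1 kX; move: e2; rewrite kX /= => ->.
by move: kE; rewrite kv /= (negPf E0).
Qed.

(** A machine with a tuple matching [k] lists [k] among its own keys, so a machine that does not
    report to the owner has count 0, and no machine reports twice. *)
Lemma total_count (i : 'I_p) k j : k.1.1 \in E -> k \in local_keys (inp j) -> owner k = i ->
  \sum_(r <- flatten (R 1 i) | rec_key r == k) rA r = count (matches k) all_items.
Proof.
move=> kE kj ki; rewrite big_flatten big_map big_enum /= count_all; apply: eq_bigr => j' _.
rewrite sent1 big_map.
under eq_bigl => k' do rewrite rec_keyK.
rewrite (eq_bigr (fun=> count (matches k) (inp j'))) => [|k' /eqP->]; last first.
  rewrite /= inordK // ltnS; apply: leq_trans items_le_D; apply: leq_trans (count_size _ _) _.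
  by rewrite size_all (bigD1 j') //= leq_addr.
rewrite big_const_seq iter_addn_0.
have -> : count (eq_op^~ k) (keys_to p (inp j') R0 i) = (k \in local_keys (inp j')).
  rewrite count_uniq_mem ?keys_to_mem ?ki ?eqxx //.
  by rewrite filter_uniq // (increasing_uniq (local_keys_increasing _)).
case: (boolP (k \in local_keys _)) => kj'; rewrite ?muln1 // muln0.
apply/esym/eqP; rewrite -leqn0 leqNgt -has_count; apply: contra kj' => /hasP[it itj m].
by apply/local_keysP; exists it => //; exact: (matches_keys kE kj m).
Qed.

Lemma answerE (j : 'I_p) k : k \in local_keys (inp j) ->
  answer p (inp j) R0 (R 2 j) k = answer_key p (R 1 (Ordinal (owner_lt k))) (owner k) k.
Proof.
move=> kj; rewrite /answer.
have -> : nth [::] (R 2 j) (owner k) = sent 2 (Ordinal (owner_lt k)) j by rewrite -nth_rcv.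
rewrite sent2 /send_answers.
rewrite nth_rcv sent1 /= /send_keys -map_comp.
have km : k \in keys_to p (inp j) R0 (owner k) by rewrite keys_to_mem eqxx.
rewrite (nth_map k); last by rewrite index_mem.
rewrite (nth_index _ km) /comp rec_keyK; reflexivity.
Qed.

Lemma answer_count (j : 'I_p) k : k.1.1 \in E -> k \in local_keys (inp j) ->
  rA (answer p (inp j) R0 (R 2 j) k) = count (matches k) all_items :> nat.
Proof.
move=> kE kj; rewrite answerE // /answer_key /= (total_count kE kj) // inordK // ltnS.
exact: leq_trans (count_size _ _) items_le_D.
Qed.

Lemma answer_id (j : 'I_p) k : k \in local_keys (inp j) ->
  rB (answer p (inp j) R0 (R 2 j) k) = inord (key_id k).
Proof. by move=> kj; rewrite answerE // /answer_key /= rcv1_keys. Qed.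

Lemma mem_owned j k : k \in local_keys (inp j) -> k \in owned (owner k).
Proof.
move=> kj; rewrite mem_undup; apply/flattenP; exists (keys_to p (inp j) R0 (owner k)).
  by rewrite (map_f (fun j => keys_to p (inp j) R0 _)) ?mem_enum.
by rewrite keys_to_mem eqxx.
Qed.

Lemma key_id_lt j k : k \in local_keys (inp j) -> key_id k < D.+1.
Proof.
move=> /mem_owned; rewrite -index_mem /key_id ltnS => lt.
apply: leq_trans items_D; rewrite mulSn addnC leq_add ?(ltnW (owner_lt k)) //.
rewrite leq_mul2r; apply/orP; right; apply: leq_trans (ltnW lt) _.
apply: leq_trans (size_undup _) _; rewrite [leqLHS]size_flatten /shape -map_comp sumnE big_map big_enum /=.
rewrite size_all big_distrl /=; apply: leq_sum => j' _.
by apply: leq_trans (size_local_keys _); rewrite size_filter count_size.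
Qed.

(** A name gives the owner modulo [p], and its quotient the position in the owner's duplicate-free
    list. The size of [D] keeps [inord] faithful. *)
Lemma key_id_inj j j' k k' : k \in local_keys (inp j) -> k' \in local_keys (inp j') ->
  inord (key_id k) = inord (key_id k') :> num -> k = k'.
Proof.
move=> kj kj' /(congr1 val); rewrite /= !inordK ?(key_id_lt kj) ?(key_id_lt kj') //.
move=> eq_id; have ow : owner k = owner k'.
  have := congr1 (modn^~ p) eq_id.
  by rewrite /key_id /= !modnMDl !modn_small ?owner_lt.
move: eq_id; rewrite /key_id ow => /addIn/eqP; rewrite eqn_pmul2r // => /eqP eq_ix.
have k1 := mem_owned kj; have k2 := mem_owned kj'; rewrite ow in k1.
by rewrite -(nth_index k k1) eq_ix nth_index.
Qed.

Definition val_id v (a : nat) : num := inord (key_id (val_key v a)).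

Definition item_ids (it : item V) : ids :=
  [ffun v => if v \in it.1 then val_id v (it.2 v) else ord0].

Definition item_type (it : item V) : {ffun {set V} -> 'I_B.+1} :=
  [ffun X : {set V} => if X \subset it.1 then
     inord (trunc_log 2 (count (matches (it.1, X, restr X it.2)) all_items)) else ord0].

Lemma annotateE j : annotate p (inp j) R0 (R 2 j) =
  [seq (it, item_ids it, item_type it) | it <- inp j].
Proof.
apply/eq_in_map => it itj; congr (_, _, _).
  apply/ffunP => v; rewrite !ffunE; case: ifP => // ve.
  rewrite answer_id //; apply/local_keysP; exists it => //; apply/item_keysP.
  by right; exists v.
apply/ffunP => X; rewrite !ffunE; case: ifP => // Xe.
rewrite answer_count //; first by rewrite itemsE // (mem_all itj).
by apply/local_keysP; exists it => //; apply/item_keysP; left; exists X.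
Qed.

Lemma val_id_inj v it it' : it \in all_items -> it' \in all_items ->
  v \in it.1 -> v \in it'.1 -> val_id v (it.2 v) = val_id v (it'.2 v) -> it.2 v = it'.2 v.
Proof.
case/flattenP=> _ /mapP[j _ ->] itj /flattenP[_ /mapP[j' _ ->]] itj' ve ve'.
move/(@key_id_inj j j')=> h; have : val_key v (it.2 v) = val_key v (it'.2 v).
  apply: h; apply/local_keysP; [exists it => //|exists it' => //];
    by apply/item_keysP; right; exists v.
by case=> /ffunP/(_ v); rewrite !ffunE set11.
Qed.

Lemma load0 i : \sum_j size (sent 0 j i) <= p * p.
Proof.
have -> : p * p = \sum_(j < p) p by rewrite sum_nat_const card_ord.
apply: leq_sum => j _.
by rewrite sent0 size_map size_samples.
Qed.

Lemma load1 i : \sum_j size (sent 1 j i) <= 2 * p * g.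
Proof.
apply: leq_trans (owner_load i); apply: leq_sum => j _.
by rewrite sent1 size_map.
Qed.

Lemma load2 i : \sum_j size (sent 2 j i) <= g * p.
Proof.
apply: leq_trans (keys_gp i).
rewrite (eq_bigr (fun j : 'I_p => count (fun k => owner k == j) (local_keys (inp i)))); last first.
  by move=> j _; rewrite sent2 size_map nth_rcv sent1 size_map size_filter.
elim: (local_keys _) => [|k s IH] /=; first by rewrite big1.
rewrite big_split /= -[(size s).+1]add1n leq_add // (bigD1 (Ordinal (owner_lt k))) //= eqxx.
rewrite big1 // => j /eqP ne; case: eqP => // eq_o; case: ne; apply: val_inj; by rewrite /= eq_o.
Qed.

End Statistics.

(** * Correctness and loads of the join *)

Section JoinPhase.
Variables (V : finType) (E : {set {set V}}) (p B D M : nat).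
Local Notation num := 'I_D.+1.
Local Notation ids := {ffun V -> num}.
Local Notation conf := {ffun {set V} * {set V} -> 'I_B.+1}.
Local Notation code := ({set V} * {set V} * conf * (num * num) * ids)%type.
Local Notation rec := (code * rtuple V)%type.
Local Notation annotated := (item V * ids * {ffun {set V} -> 'I_B.+1})%type.
Variables (sh : conf -> share V) (w1 : conf -> V -> num -> nat) (w2 : {set V} -> ids -> nat).
Variable inp : 'I_p -> seq (item V).
Variables (xi : item V -> ids) (ty : item V -> {ffun {set V} -> 'I_B.+1}).

Local Notation all_items := (flatten [seq inp j | j <- enum 'I_p]).

Hypothesis coverV : forall v : V, exists2 e, e \in E & v \in e.
Hypothesis E0 : set0 \notin E.
Hypothesis items_restr : forall it, it \in all_items -> restr it.1 it.2 = it.2.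
Hypothesis xi_out : forall it v, it \in all_items -> v \notin it.1 -> xi it v = ord0.
Hypothesis xi_eq : forall it it' v, it \in all_items -> it' \in all_items ->
  v \in it.1 -> v \in it'.1 -> (xi it v == xi it' v) = (it.2 v == it'.2 v).
Hypothesis w2_lt : forall e x, w2 e x < p.
Hypothesis shP : forall gam : conf, share_spec E p M (fun e X => gam (e, X)) (sh gam).

Definition ann j : seq annotated := [seq (it, xi it, ty it) | it <- inp j].
Definition stored_at (i : 'I_p) := [seq send_to_owner w2 (ann j) i | j <- enum 'I_p].
Definition views_at (i : 'I_p) := [seq send_views E sh w1 (ann j) i | j <- enum 'I_p].
Definition queries_at (i : 'I_p) := [seq send_queries E sh w2 (views_at j) i | j <- enum 'I_p].
Definition bits_at (i : 'I_p) := [seq send_bits (stored_at j) (queries_at j) i | j <- enum 'I_p].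

Lemma all_itemsP it : reflect (exists j, it \in inp j) (it \in all_items).
Proof.
apply: (iffP flattenP) => [[_ /mapP[j _ ->] ?]|[j ?]]; first by exists j.
by exists (inp j); rewrite ?map_f ?mem_enum.
Qed.

Lemma views_sub gam w : w \in views E sh gam -> w.1 \in E /\ w.2 \subset w.1.
Proof.
have [_ _ wit dom] := shP gam; rewrite inE => /orP[/imsetP[e0]|/imsetP[z zZ ->]].
  by rewrite inE => /andP[e0E e0Z] ->; have [] := dom _ e0E e0Z.
by have := wit _ zZ; case: (swit _ _) => e X [].
Qed.

Definition viewed (i : 'I_p) gam (w : {set V} * {set V}) (it : item V) :=
  [&& w \in views E sh gam, it.1 == w.1, of_type gam w.1 (ty it) &
      in_cell sh w1 gam w.2 (cell sh gam i) (xi it)].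

Lemma received_viewsP i (r : rec) :
  reflect (exists gam w it, [/\ it \in all_items, viewed i gam w it &
      r = mk_rec w.1 w.2 gam ord0 ord0 (restr_ids w.2 (xi it)) (restr w.2 it.2)])
    (r \in flatten (views_at i)).
Proof.
apply: (iffP flattenP) => [[_ /mapP[j _ ->]]|].
  case/flattenP=> _ /mapP[gam _ ->] /flattenP[_ /mapP[w wv ->]] /mapP[xt].
  rewrite mem_undup => /mapP[a]; rewrite mem_filter => /andP[ac /mapP[it itj aE]] -> ->.
  exists gam, w, it; split; [by apply/all_itemsP; exists j| |by rewrite aE].
  by rewrite mem_enum in wv; rewrite /viewed wv; rewrite aE in ac.
case=> gam [w [it [/all_itemsP[j itj] /and4P[wv iw ityp ic] ->]]].
exists (send_views E sh w1 (ann j) i).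
  by rewrite (map_f (fun j => send_views E sh w1 (ann j) i)) ?mem_enum.
apply/flattenP; eexists; first by apply: (map_f _ (_ : gam \in _)); rewrite mem_enum.
apply/flattenP; eexists; first by apply: (map_f _ (_ : w \in _)); rewrite mem_enum.
apply/mapP; exists (restr_ids w.2 (xi it), restr w.2 it.2) => //.
rewrite mem_undup; apply/mapP; exists (it, xi it, ty it) => //.
by rewrite mem_filter /= iw ityp ic /=; apply/mapP; exists it.
Qed.

Lemma owner_table (o : 'I_p) k : w2 k.1 k.2 = o ->
  (k \in [seq (rE r, rI r) | r <- flatten (stored_at o)]) = (k \in [seq (it.1, xi it) | it <- all_items]).
Proof.
move=> ko; apply/mapP/mapP => [[r /flattenP[_ /mapP[j _ ->]]]|[it /all_itemsP[j itj] kE]].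
  case/mapP=> a; rewrite mem_filter => /andP[_ /mapP[it itj ->]] -> ->.
  by exists it => //; apply/all_itemsP; exists j.
exists (mk_rec it.1 set0 (zero_conf V B) ord0 ord0 (xi it) (zero_tuple V)) => //.
apply/flattenP; exists (send_to_owner w2 (ann j) o).
  by rewrite (map_f (fun j => send_to_owner w2 (ann j) o)) ?mem_enum.
apply/mapP; exists (it, xi it, ty it) => //.
by rewrite mem_filter /= -ko kE eqxx; apply/mapP; exists it.
Qed.

Lemma nth_enum_map (A : Type) (a : A) (F : 'I_p -> A) (i : 'I_p) :
  nth a [seq F j | j <- enum 'I_p] i = F i.
Proof. by rewrite (nth_map i) ?size_enum_ord // nth_ord_enum. Qed.

(** The machine chosen by [w2] stores all tuples with the name vector asked for, wherever they were
    held, so its bit decides membership in the relation. *)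
Lemma confirmedE i k : confirmed E sh w2 (views_at i) (bits_at i) k =
  (k \in queries E sh (views_at i)) && (k \in [seq (it.1, xi it) | it <- all_items]).
Proof.
rewrite /confirmed; have [kQ|//] := boolP (k \in queries E sh (views_at i)).
pose o := Ordinal (w2_lt k.1 k.2).
have -> : nth [::] (bits_at i) (w2 k.1 k.2) = send_bits (stored_at o) (queries_at o) i.
  exact: (nth_enum_map [::] (fun j => send_bits (stored_at j) (queries_at j) i) o).
have -> : send_bits (stored_at o) (queries_at o) i =
    [seq bit_rec V B D (k' \in [seq (rE r', rI r') | r' <- flatten (stored_at o)])
    | k' <- queries_to E sh w2 (views_at i) o].
  by rewrite /send_bits nth_enum_map -map_comp; apply: eq_map => -[].
have kq : k \in queries_to E sh w2 (views_at i) o by rewrite mem_filter eqxx mem_enum.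
rewrite (nth_map k); last by rewrite index_mem.
rewrite (nth_index _ kq) (@owner_table o) //.
have [e eE ke] : exists2 e, e \in E & e = k.1.
  by exists k.1 => //; move: kQ; rewrite inE => /andP[].
have setT0 : [set: V] != set0.
  have [e0|[v _]] := set_0Vmem e; first by move: E0; rewrite -e0 eE.
  by apply/set0Pn; exists v; rewrite inE.
by rewrite /bit_rec /rE /=; case: (k \in _); rewrite ?setT0 ?eqxx.
Qed.

(** Several records may carry the name, but [xi_eq] gives them all the same value at [v], so taking
    the first is safe. *)
Lemma dictionaryE i v (it : item V) r : it \in all_items -> v \in it.1 ->
  r \in flatten (views_at i) -> v \in rX r -> rI r v = xi it v ->
  dictionary (views_at i) v (xi it v) = it.2 v.
Proof.
move=> itA vi rR vr rv; rewrite /dictionary.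
set l := [seq _ | _ <- _ & _].
have lP a : a \in l -> a = it.2 v.
  case/mapP=> r'; rewrite mem_filter => /andP[/andP[vr' /eqP rv']] r'R ->.
  move: vr' rv'; have /received_viewsP[gam [w [it' [it'A /and4P[/views_sub[_ wX] /eqP iw _ _] ->]]]] := r'R.
  rewrite /rX /rI /rT /= !ffunE => vw; rewrite vw => /eqP; rewrite xi_eq //; last first.
    by rewrite iw (subsetP wX).
  by move/eqP.
have : rT r v \in l by apply: map_f; rewrite mem_filter vr rv eqxx.
by case: (l) lP => //= a s lP _; apply: lP; rewrite mem_head.
Qed.

(** Confirmation makes every restriction the name vector of an actual tuple. That the names decode
    follows from candidacy: some received record carries each name, a witness view inside [sZ] and a
    dominating view outside. *)
Lemma join_sound i t : t \in join_output E sh w2 (views_at i) (bits_at i) ->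
  forall e, e \in E -> (e, restr e t) \in all_items.
Proof.
case/mapP=> x; rewrite mem_filter => /andP[/forall_inP conf_x _] ->{t} e eE.
have xP e0 : e0 \in E -> exists2 it, it \in all_items & it.1 = e0 /\ xi it = restr_ids e0 x.
  move=> e0E; have := conf_x _ e0E; rewrite confirmedE => /andP[_ /mapP[it itA [-> ->]]].
  by exists it.
have [it itA [ie xe]] := xP _ eE.
suff -> : restr e [ffun v => dictionary (views_at i) v (x v)] = it.2 by case: (it) itA ie => e' t' /= ? <-.
rewrite -(items_restr itA) ie; apply/ffunP => v; rewrite !ffunE; case: ifP => // ve.
have xv : x v = xi it v by rewrite xe ffunE ve.
have := conf_x _ eE; rewrite confirmedE inE /= => /andP[/andP[_ /existsP[gam hgam]] _].
move: hgam; rewrite inE => /and3P[_ /forall_inP hZ hD].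
have found r : r \in flatten (views_at i) -> v \in rX r -> rI r v = x v ->
    dictionary (views_at i) v (x v) = it.2 v.
  by move=> rR vr rv; rewrite xv (@dictionaryE i v it r) ?ie // rv xv.
have [_ _ wit dom] := shP gam.
have [vZ|vZ] := boolP (v \in sZ (sh gam)).
  have /hZ/hasP[r] : v \in e :&: sZ (sh gam) by rewrite inE ve.
  rewrite mem_filter => /andP[/and3P[_ _ /eqP rX] rR] /eqP; rewrite ffunE ve => rv.
  by apply: (found r) => //; rewrite rX; have := wit _ vZ; case: (swit _ _) => ? ? [].
case/orP: hD => [/subsetP/(_ v ve)|]; first by rewrite (negPf vZ).
case/hasP=> r; rewrite mem_filter => /andP[/and3P[_ _ /eqP rX] rR] /forall_inP rv.
have vD : v \in e :\: sZ (sh gam) by rewrite inE vZ.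
apply: (found r) => //; last by have /eqP := rv _ vD; rewrite ffunE ve.
have [//||_ /subsetP sub _] := dom e; last by rewrite rX sub.
by apply: contra vZ => /subsetP; apply.
Qed.

Lemma card_ord_lt m : #|[pred a : 'I_p | a < m]| <= m.
Proof.
rewrite cardE -(size_map val) -[leqRHS](size_iota 0 m); apply: uniq_leq_size.
  by rewrite (map_inj_uniq val_inj) enum_uniq.
by move=> _ /mapP[a am ->]; rewrite mem_enum inE in am; rewrite mem_iota add0n.
Qed.

Lemma cell_surj gam (c : {ffun V -> 'I_p}) : (forall v, c v < sq (sh gam) v) ->
  exists i, cell sh gam i = c.
Proof.
move=> cq; set P := [pred c : {ffun V -> 'I_p} | [forall v, c v < sq (sh gam) v]].
have cP : c \in enum P by rewrite mem_enum inE; apply/forallP.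
have cardP : #|P| <= p.
  have [_ prodq _ _] := shP gam; apply: leq_trans prodq.
  have -> : #|P| = #|family (fun v => [pred a : 'I_p | a < sq (sh gam) v])|.
    by apply: eq_card => c'; rewrite !inE; apply: eq_forallb.
  rewrite card_family foldrE big_map -big_enum /=.
  elim/big_ind2: _ => // [a b a' b'|v _]; first exact: leq_mul.
  exact: card_ord_lt.
have ip : index c (enum P) < p by apply: leq_trans cardP; rewrite cardE index_mem.
by exists (Ordinal ip); rewrite /cell nth_index.
Qed.

(** The right machine is the cell to which the names of [t] hash, under the type configuration of
    the restrictions of [t]. All views of [t] arrive there, which makes every restriction a
    candidate. *)
Lemma join_complete t : (forall e, e \in E -> (e, restr e t) \in all_items) ->
  exists i, t \in join_output E sh w2 (views_at i) (bits_at i).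
Proof.
move=> tA; pose ed v := odflt set0 [pick e in E | v \in e].
have edP v : ed v \in E /\ v \in ed v.
  rewrite /ed; case: pickP => [e /andP[]//|none].
  by have [e eE ve] := coverV v; have := none e; rewrite /= eE ve.
pose it e : item V := (e, restr e t).
pose x : ids := [ffun v => xi (it (ed v)) v].
have xE e v : e \in E -> v \in e -> xi (it e) v = x v.
  move=> eE ve; have [dE vd] := edP v; apply/eqP; rewrite ffunE xi_eq ?tA //=.
  by rewrite !ffunE ve vd.
have xie e : e \in E -> restr_ids e x = xi (it e).
  move=> eE; apply/ffunP => v; rewrite ffunE; case: ifPn => ve; first by rewrite xE.
  by rewrite xi_out ?tA.
(* The configuration read off the restrictions of [t]; the dummy value on other pairs is never
   looked at by [of_type] here. *)
clearbody x; pose gam : conf := [ffun w : {set V} * {set V} =>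
  if (w.1 \in E) && (w.2 \subset w.1) then ty (it w.1) w.2 else ord0].
have gam_type e : e \in E -> of_type gam e (ty (it e)).
  by move=> eE; apply/forallP => X; apply/implyP => Xe; rewrite ffunE /= eE Xe.
have [q0 prodq wit dom] := shP gam.
have qp v : sq (sh gam) v <= p.
  apply: leq_trans prodq; rewrite (bigD1 v) //= leq_pmulr //.
  by rewrite prodn_gt0.
have cp v : w1 gam v (x v) %% sq (sh gam) v < p by apply: leq_trans (qp v); rewrite ltn_mod.
have [|i ci] := cell_surj (gam := gam) (c := [ffun v => Ordinal (cp v)]).
  by move=> v; rewrite ffunE /= ltn_mod.
exists i.
pose r (w : {set V} * {set V}) : rec :=
  mk_rec w.1 w.2 gam ord0 ord0 (restr_ids w.2 (xi (it w.1))) (restr w.2 (restr w.1 t)).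
have rR w : w \in views E sh gam -> r w \in flatten (views_at i).
  move=> wv; have [eE Xe] := views_sub wv.
  apply/received_viewsP; exists gam, w, (it w.1); split=> //; first exact: tA.
  rewrite /viewed wv eqxx gam_type //= ci; apply/forall_inP => v vX.
  by rewrite ffunE /= xE // (subsetP Xe).
have rIv w v : w \in views E sh gam -> v \in w.2 -> rI (r w) v = x v.
  by move=> /views_sub[eE Xe] vX; rewrite /rI /= ffunE vX xE // (subsetP Xe).
have rview w : w \in views E sh gam -> r w \in received_view (views_at i) gam w.
  by move=> wv; rewrite mem_filter rR // /rC /rE /rX /= !eqxx.
have witv z : z \in sZ (sh gam) -> swit (sh gam) z \in views E sh gam /\ z \in (swit (sh gam) z).2.
  move=> zZ; split; first by rewrite inE (imset_f (swit (sh gam))) ?orbT.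
  by have := wit _ zZ; case: (swit _ _) => ? ? [].
have domv e : e \in E -> ~~ (e \subset sZ (sh gam)) ->
    (sdom (sh gam) e, sdom (sh gam) e) \in views E sh gam.
  move=> eE eZ; rewrite inE; apply/orP; left; apply/imsetP; exists e => //.
  by rewrite inE eE.
have query e : e \in E -> (e, restr_ids e x) \in queries E sh (views_at i).
  move=> eE; rewrite inE /= eE; apply/existsP; exists gam; rewrite inE; apply/and3P; split.
  - by apply/forallP => v; apply/implyP => ve; rewrite ffunE (negPf ve).
  - apply/forall_inP => z; rewrite inE => /andP[ze zZ]; have [wv zX] := witv _ zZ.
    by apply/hasP; exists (r (swit (sh gam) z)); rewrite ?rview // rIv // ffunE ze.
  - have [//|eZ] := boolP (e \subset _); have [_ sub _] := dom _ eE eZ.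
    apply/hasP; exists (r (sdom (sh gam) e, sdom (sh gam) e)); first by rewrite rview ?domv.
    apply/forall_inP => v vD; rewrite rIv ?domv // ?(subsetP sub) // ffunE.
    by move: vD; rewrite inE => /andP[_ ->].
have tE : t = [ffun v => dictionary (views_at i) v (x v)].
  apply/ffunP => v; rewrite ffunE; have [eE ve] := edP v.
  have tv : t v = (it (ed v)).2 v by rewrite /= ffunE ve.
  rewrite -(xE _ _ eE ve) tv; apply/esym.
  have [vZ|vZ] := boolP (v \in sZ (sh gam)).
    have [wv vX] := witv _ vZ.
    by apply: (@dictionaryE _ _ _ (r (swit (sh gam) v))); rewrite ?rR ?tA // rIv // xE.
  have eZ : ~~ (ed v \subset sZ (sh gam)) by apply: contra vZ => /subsetP; apply.
  have [_ /subsetP sub _] := dom _ eE eZ.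
  have vd : v \in sdom (sh gam) (ed v) by rewrite sub // inE vZ.
  by apply: (@dictionaryE _ _ _ (r (sdom (sh gam) (ed v), sdom (sh gam) (ed v))));
    rewrite ?rR ?tA ?domv // rIv ?domv // xE.
rewrite {1}tE; apply: (map_f (fun x : ids => [ffun v => dictionary (views_at i) v (x v)] : rtuple V)).
rewrite mem_filter mem_enum andbT; apply/forall_inP => e eE.
by rewrite confirmedE query //= xie //; apply/mapP; exists (it e) => //; exact: tA.
Qed.

End JoinPhase.

Lemma leq_sum_setU (T : finType) (A B : {set T}) (F : T -> nat) :
  \sum_(x in A :|: B) F x <= \sum_(x in A) F x + \sum_(x in B) F x.
Proof.
rewrite (big_setID A) /= setUK leq_add2l setDUl setDv set0U.
by rewrite [leqRHS](big_setID A) /= leq_addl.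
Qed.

(** * Loads of the hypercube and lookup rounds for fixed hash functions *)

Section JoinLoads.
Variables (V : finType) (E : {set {set V}}) (p B D M : nat).
Local Notation num := 'I_D.+1.
Local Notation ids := {ffun V -> num}.
Local Notation conf := {ffun {set V} * {set V} -> 'I_B.+1}.
Local Notation code := ({set V} * {set V} * conf * (num * num) * ids)%type.
Local Notation rec := (code * rtuple V)%type.
Variables (sh : conf -> share V) (w1 : conf -> V -> num -> nat) (w2 : {set V} -> ids -> nat).
Variable inp : 'I_p -> seq (item V).
Variables (xi : item V -> ids) (ty : item V -> {ffun {set V} -> 'I_B.+1}).

Local Notation all_items := (flatten [seq inp j | j <- enum 'I_p]).

Hypothesis items_uniq : uniq all_items.
Hypothesis items_restr : forall it, it \in all_items -> restr it.1 it.2 = it.2.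
Hypothesis xi_eq : forall it it' v, it \in all_items -> it' \in all_items ->
  v \in it.1 -> v \in it'.1 -> (xi it v == xi it' v) = (it.2 v == it'.2 v).
Hypothesis tyE : forall it (X : {set V}), it \in all_items -> X \subset it.1 ->
  ty it X = trunc_log 2 (count (matches (it.1, X, restr X it.2)) all_items) :> nat.
Hypothesis shP : forall gam : conf, share_spec E p M (fun e X => gam (e, X)) (sh gam).

Local Notation R3 := (stored_at w2 inp xi ty).
Local Notation R4 := (views_at E sh w1 inp xi ty).
Local Notation R5 := (queries_at E sh w1 w2 inp xi ty).
Local Notation ann := (ann inp xi ty).

Definition part gam (e X : {set V}) : {set ids} :=
  [set x | has (fun it : item V =>
    [&& it.1 == e, of_type gam e (ty it) & x == restr_ids X (xi it)]) all_items].

Lemma partP gam e X x : reflect (exists2 it, it \in all_items &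
    [/\ it.1 = e, of_type gam e (ty it) & x = restr_ids X (xi it)]) (x \in part gam e X).
Proof.
rewrite inE; apply: (iffP hasP) => -[it itA].
  by case/and3P=> /eqP ? ? /eqP ?; exists it.
by case=> <- iT ->; exists it => //; rewrite !eqxx iT.
Qed.

Lemma restr_idsE it it' (X : {set V}) : it \in all_items -> it' \in all_items ->
  X \subset it.1 -> X \subset it'.1 ->
  (restr_ids X (xi it) == restr_ids X (xi it')) = (restr X it.2 == restr X it'.2).
Proof.
move=> itA itA' Xe Xe'; apply/eqP/eqP => /ffunP eqX; apply/ffunP => v;
  have := eqX v; rewrite !ffunE; case: ifP => // vX /eqP h; apply/eqP; move: h;
  by rewrite xi_eq // ?(subsetP Xe) ?(subsetP Xe').
Qed.

Lemma count_matches it (X : {set V}) : it \in all_items -> X \subset it.1 ->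
  count (matches (it.1, X, restr X it.2)) all_items =
  count (fun it' : item V => (it'.1 == it.1) && (restr_ids X (xi it') == restr_ids X (xi it))) all_items.
Proof.
move=> itA Xe; apply: eq_in_count => it' itA'; rewrite /matches /=.
by have [e1|//] := eqVneq it'.1 it.1; rewrite restr_idsE // e1.
Qed.

(* Each projection on [X] extends to at least [2 ^ gam (e, X)] tuples of the
   relation, and those that agree with [x] on [X'] extend to fewer than
   [2 * 2 ^ gam (e, X')] tuples altogether. *)
Lemma part_degree gam (e X X' : {set V}) (x : ids) : X \subset e -> X' \subset X ->
  #|[set y in part gam e X | agree X' x y]| * 2 ^ gam (e, X) <= 2 * 2 ^ gam (e, X').
Proof.
move=> Xe X'X; set G := [set _ in _ | _].
have [->|[y0 y0G]] := set_0Vmem G; first by rewrite cards0 mul0n.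
have X'e := subset_trans X'X Xe.
have cnt_ge it (Y : {set V}) : it \in all_items -> 0 < count (matches (it.1, Y, restr Y it.2)) all_items.
  by move=> itA; rewrite -has_count; apply/hasP; exists it => //; rewrite /matches !eqxx.
have tyc it (Y : {set V}) : it \in all_items -> it.1 = e -> of_type gam e (ty it) -> Y \subset e ->
    2 ^ gam (e, Y) <= count (matches (it.1, Y, restr Y it.2)) all_items < 2 ^ (gam (e, Y)).+1.
  move=> itA ie /forallP/(_ Y)/implyP/[swap] Ye /(_ Ye)/eqP <-.
  by rewrite tyE ?ie //; apply: trunc_log_bounds => //; rewrite -ie cnt_ge.
have /andP[/partP[it0 it0A [i0e i0t y0E]] /forall_inP ag0] : (y0 \in part gam e X) && agree X' x y0.
  by move: y0G; rewrite inE.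
have /andP[_ lt0] := tyc it0 X' it0A i0e i0t X'e.
rewrite -expnS; apply: leq_trans (ltnW lt0).
pose same y := fun it : item V => (it.1 == e) && (restr_ids X (xi it) == y).
apply: (@leq_trans (\sum_(y in G) count (same y) all_items)).
  rewrite -sum_nat_const; apply: leq_sum => y; rewrite inE => /andP[/partP[it itA [ie iT ->]] _].
  by have /andP[+ _] := tyc it X itA ie iT Xe; rewrite count_matches ?ie.
under eq_bigr do rewrite -sum1_count big_mkcond.
rewrite exchange_big -sum1_count [leqRHS]big_mkcond /=.
rewrite big_seq [leqRHS]big_seq; apply: leq_sum => it itA.
have [ie|ne] := eqVneq it.1 e; last by rewrite big1 // => y _; rewrite /same (negPf ne).
have [rG|rG] := boolP (restr_ids X (xi it) \in G); last first.
  by rewrite big1 // => y yG; rewrite /same; case: (eqVneq _ y) rG => [->|]; rewrite ?yG ?andbF.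
rewrite (bigD1 (restr_ids X (xi it))) //= big1 ?addn0; last first.
  by move=> y /andP[_ ny]; rewrite /same [_ == y]eq_sym (negPf ny) andbF.
rewrite (_ : matches _ it = true); first by case: ifP.
rewrite /matches /= ie i0e eqxx /= -restr_idsE ?ie ?i0e //.
apply/eqP/ffunP => v; rewrite !ffunE; case: ifP => // vX'.
have vX : v \in X by rewrite (subsetP X'X).
move: rG; rewrite inE => /andP[_ /forall_inP ag]; have /eqP := ag v vX'.
have /eqP := ag0 v vX'; rewrite y0E !ffunE vX => -> -> //.
Qed.

Lemma mem_received_view i gam w (r : rec) : r \in received_view (R4 i) gam w ->
  rI r \in [set x in part gam w.1 w.2 | in_cell sh w1 gam w.2 (cell sh gam i) x].
Proof.
rewrite mem_filter => /andP[/and3P[/eqP rC /eqP rE /eqP rX]].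
case/received_viewsP=> gam' [w' [it [itA /and4P[_ /eqP iw iT ic] rr]]].
have [g1 w11 w12] : [/\ gam' = gam, w'.1 = w.1 & w'.2 = w.2].
  by split; [rewrite -rC|rewrite -rE|rewrite -rX]; rewrite rr.
rewrite rr /rI /= inE w12; apply/andP; split.
  by apply/partP; exists it => //; split; rewrite ?iw // -?g1 -?w11.
rewrite -g1 -w12; apply/forall_inP => v vX; rewrite ffunE vX; exact: (forall_inP ic).
Qed.

Variables (Kd Kw : nat).
Hypotheses (Kd0 : 0 < Kd) (Kw0 : 0 < Kw).
Hypothesis dom_load : forall gam e0 (c : {ffun V -> 'I_p}), e0 \in E -> ~~ (e0 \subset sZ (sh gam)) ->
  #|[set x in part gam (sdom (sh gam) e0) (sdom (sh gam) e0) |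
     in_cell sh w1 gam (sdom (sh gam) e0) c x]| <= Kd.
Hypothesis wit_load : forall gam z (c : {ffun V -> 'I_p}), z \in sZ (sh gam) ->
  #|[set x in part gam (swit (sh gam) z).1 (swit (sh gam) z).2 |
     in_cell sh w1 gam (swit (sh gam) z).2 c x]| <= Kw.

Lemma view_tuples_subset (j i : 'I_p) gam (e X : {set V}) :
  {subset [seq xt.1 | xt <- view_tuples sh w1 (ann j) gam e X i] <=
    [set x in part gam e X | in_cell sh w1 gam X (cell sh gam i) x]}.
Proof.
move=> x /mapP[xt]; rewrite mem_undup => /mapP[a].
rewrite mem_filter => /andP[/and3P[/eqP ae aT ac] /mapP[it itj aE]] -> ->.
have itA : it \in all_items by apply/all_itemsP; exists j.
rewrite aE /= in ae aT ac *; rewrite inE; apply/andP; split.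
  by apply/partP; exists it.
apply/forall_inP => v vX; rewrite ffunE vX; exact: (forall_inP ac).
Qed.

Lemma size_view_tuples (j i : 'I_p) gam (e X : {set V}) : X \subset e ->
  size (view_tuples sh w1 (ann j) gam e X i) <=
  #|[set x in part gam e X | in_cell sh w1 gam X (cell sh gam i) x]|.
Proof.
move=> Xe; rewrite -(size_map fst) cardE; apply: uniq_leq_size; last first.
  by move=> x /view_tuples_subset; rewrite mem_enum.
rewrite map_inj_in_uniq ?undup_uniq // => xt xt'; rewrite !mem_undup.
case/mapP=> a; rewrite mem_filter => /andP[/and3P[/eqP ae _ _] /mapP[it itj aE]] ->.
case/mapP=> a'; rewrite mem_filter => /andP[/and3P[/eqP ae' _ _] /mapP[it' itj' aE']] ->.
rewrite aE aE' /= in ae ae' * => eqX; congr (_, _) => //; apply/eqP.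
rewrite -restr_idsE ?eqX ?ae ?ae' //; apply/all_itemsP; by [exists j|exists j].
Qed.

(** Machines hold disjoint sets of tuples, so for whole edges all senders together stay within the
    count of distinct tuples. A proper projection may be repeated by several senders. *)
Lemma sum_view_tuples (i : 'I_p) gam (e : {set V}) :
  \sum_j size (view_tuples sh w1 (ann j) gam e e i) <=
  #|[set x in part gam e e | in_cell sh w1 gam e (cell sh gam i) x]|.
Proof.
pose P (it : item V) := [&& it.1 == e, of_type gam e (ty it) & in_cell sh w1 gam e (cell sh gam i) (xi it)].
apply: (@leq_trans (count P all_items)).
  have -> : count P all_items = \sum_j count P (inp j).
    by rewrite count_flatten -map_comp sumnE big_map big_enum.
  apply: leq_sum => j _; apply: leq_trans (size_undup _) _.
  by rewrite size_map size_filter count_map.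
rewrite -size_filter -(size_map (fun it => restr_ids e (xi it))) cardE; apply: uniq_leq_size.
  rewrite map_inj_in_uniq ?filter_uniq // => it it'.
  rewrite !mem_filter => /andP[/and3P[/eqP ie _ _] itA] /andP[/and3P[/eqP ie' _ _] itA'].
  move/eqP; rewrite restr_idsE ?ie ?ie' // -{1}ie -ie' !items_restr //.
  by case: it it' ie ie' {itA itA'} => [? ?] [? ?] /= -> -> /eqP->.
move=> x /mapP[it]; rewrite mem_filter => /andP[/and3P[/eqP ie iT ic] itA] ->.
rewrite mem_enum inE; apply/andP; split; first by apply/partP; exists it.
apply/forall_inP => v vX; rewrite ffunE vX; exact: (forall_inP ic).
Qed.

(** Witness views are charged once per sender, hence the factor [p], which multiplies only the small
    bound [Kw]. *)
Lemma load4 (i : 'I_p) : \sum_j size (send_views E sh w1 (ann j) i) <=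
  #|{: conf}| * (#|E| * Kd + p * (#|V| * Kw)).
Proof.
under eq_bigr do rewrite size_flatten /shape -map_comp sumnE big_map big_enum /=.
rewrite exchange_big /= -[leqRHS]sum_nat_const; apply: leq_sum => gam _.
under eq_bigr do rewrite size_flatten /shape -map_comp sumnE big_map big_enum /=.
under eq_bigr do under eq_bigr do rewrite size_map.
rewrite exchange_big /=.
have [_ _ wit dom] := shP gam.
pose G w := \sum_(j < p) size (view_tuples sh w1 (ann j) gam w.1 w.2 i).
set A1 := [set (sdom (sh gam) e0, sdom (sh gam) e0) | e0 in E & ~~ (e0 \subset sZ (sh gam))].
set A2 := [set swit (sh gam) z | z in sZ (sh gam)].
apply: (@leq_trans (\sum_(w in A1) G w + \sum_(w in A2) G w)).
  exact: leq_sum_setU.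
apply: leq_add.
  apply: (@leq_trans (\sum_(w in A1) Kd)).
    apply: leq_sum => w /imsetP[e0]; rewrite inE => /andP[e0E e0Z] ->.
    exact: leq_trans (sum_view_tuples _ _ _) (dom_load _ _ _).
  rewrite sum_nat_const leq_mul2r (leq_trans (leq_imset_card _ _)) ?orbT //.
  by apply: subset_leq_card; apply/subsetP => e; rewrite inE => /andP[].
apply: (@leq_trans (\sum_(w in A2) p * Kw)).
  apply: leq_sum => w /imsetP[z zZ ->].
  apply: (@leq_trans (\sum_(j < p) Kw)); last by rewrite sum_nat_const card_ord.
  apply: leq_sum => j _; apply: leq_trans (wit_load _ zZ); apply: size_view_tuples.
  by have := wit _ zZ; case: (swit _ _) => ? ? [].
rewrite sum_nat_const mulnCA leq_mul2l leq_mul2r.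
by rewrite (leq_trans (leq_imset_card _ _)) ?max_card ?orbT.
Qed.

(** A candidate is determined by its names on [sZ], at most [Kw] for each variable, together with
    one tuple of the dominating edge, at most [Kd]. *)
Lemma card_candidates i gam e0 : e0 \in E ->
  #|candidates sh (R4 i) gam e0| <= Kw ^ #|V| * Kd.
Proof.
move=> e0E; pose Z := sZ (sh gam).
pose W v : {set num} := if v \in Z then
  [set x v | x : ids in [set x in part gam (swit (sh gam) v).1 (swit (sh gam) v).2 |
     in_cell sh w1 gam (swit (sh gam) v).2 (cell sh gam i) x]] else set1 ord0.
pose W' v : {set num} := if v \in e0 then W v else set1 ord0.
pose d := sdom (sh gam) e0.
(* An edge inside [Z] has no dominating edge; the zero vector takes its place. *)
pose Dm : {set ids} := if e0 \subset Z then set1 (zero_ids V D) else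
  [set x in part gam d d | in_cell sh w1 gam d (cell sh gam i) x].
have cW v : #|W' v| <= Kw.
  rewrite /W' /W; case: ifP => _; last by rewrite cards1.
  case: ifP => vZ; last by rewrite cards1.
  exact: leq_trans (leq_imset_card _ _) (wit_load _ vZ).
have cD : #|Dm| <= Kd.
  by rewrite /Dm; case: ifPn => e0Z; [rewrite cards1|exact: dom_load].
pose F : {set ids} := [set x | x \in family (fun v => mem (W' v))].
have cF : #|F| <= Kw ^ #|V|.
  rewrite cardsE card_family foldrE big_map big_enum /= -[leqRHS]prod_nat_const.
  by apply: leq_prod => v _; exact: cW.
pose comb (ab : ids * ids) : ids :=
  [ffun v => if v \in e0 then if v \in Z then ab.1 v else ab.2 v else ord0].
apply: (@leq_trans #|[set comb ab | ab in setX F Dm]|); last first.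
  by apply: leq_trans (leq_imset_card _ _) _; rewrite cardsX leq_mul.
apply: subset_leq_card; apply/subsetP => x; rewrite inE => /and3P[/forallP out /forall_inP hZ hD].
pose x1 : ids := [ffun v => if (v \in e0) && (v \in Z) then x v else ord0].
have x1F : x1 \in F.
  rewrite inE; apply/familyP => v; rewrite ffunE /W' /W.
  case: (boolP (v \in e0)) => ve /=; last by rewrite inE.
  case: (boolP (v \in Z)) => vZ; last by rewrite inE.
  have /hZ/hasP[r rR /eqP <-] : v \in e0 :&: sZ (sh gam) by rewrite inE ve.
  by apply: imset_f; apply: mem_received_view rR.
have [x2 x2D x2E] : exists2 x2, x2 \in Dm & forall v, v \in e0 :\: Z -> x2 v = x v.
  rewrite /Dm; case: ifPn => e0Z.
    exists (zero_ids V D); first by rewrite inE.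
    by move=> v; rewrite inE => /andP[vZ ve]; rewrite (subsetP e0Z) in vZ.
  case/orP: hD => [|/hasP[r rR /forall_inP rE]]; first by rewrite (negPf e0Z).
  by exists (rI r); [exact: mem_received_view rR|move=> v /rE/eqP].
apply/imsetP; exists (x1, x2); first by rewrite in_setX x1F x2D.
apply/ffunP => v; rewrite !ffunE /=; case: (boolP (v \in e0)) => ve /=; last first.
  by have /implyP/(_ ve)/eqP := out v.
by case: (boolP (v \in Z)) => vZ //; rewrite x2E // inE vZ.
Qed.

Lemma card_queries i :
  #|queries E sh (R4 i)| <= #|E| * (#|{: conf}| * (Kw ^ #|V| * Kd)).
Proof.
apply: (@leq_trans (\sum_(e in E) \sum_(gam : conf) #|candidates sh (R4 i) gam e|)).
  rewrite -sum1_card (partition_big fst (mem E)) /=; last first.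
    by move=> k; rewrite inE => /andP[].
  apply: leq_sum => e eE.
  apply: (@leq_trans #|\bigcup_gam candidates sh (R4 i) gam e|).
    rewrite sum1_card -(card_in_imset (f := snd)); last first.
      move=> [e1 x1] [e2 x2]; rewrite !unfold_in /= => /andP[_ /eqP->] /andP[_ /eqP->] /= -> //.
    apply: subset_leq_card; apply/subsetP => _ /imsetP[k + ->].
    rewrite unfold_in inE => /andP[/andP[_ /existsP[gam ck]] /eqP ke].
    by apply/bigcupP; exists gam => //; rewrite -ke.
  exact: card_bigcup_le.
rewrite -[leqRHS]sum_nat_const; apply: leq_sum => e eE; rewrite -[leqRHS]sum_nat_const.
by apply: leq_sum => gam _; exact: card_candidates.
Qed.

(* How often the machine that owns [k] is addressed: once for the tuple itself
   and once for every machine that asks for it. *)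
Definition owner_weight (k : {set V} * ids) : nat :=
  (k \in [seq (it.1, xi it) | it <- all_items]) + \sum_(j < p) (k \in queries E sh (R4 j)).

Lemma owner_weight_le k : owner_weight k <= p.+1.
Proof.
rewrite /owner_weight -[p.+1]add1n leq_add ?leq_b1 //.
apply: (@leq_trans (\sum_(j < p) 1)); last by rewrite sum_nat_const card_ord muln1.
by apply: leq_sum => j _; exact: leq_b1.
Qed.

Lemma owner_weight_sum : \sum_k owner_weight k <=
  size all_items + p * (#|E| * (#|{: conf}| * (Kw ^ #|V| * Kd))).
Proof.
rewrite big_split /= exchange_big /=; apply: leq_add.
  rewrite -(size_map (fun it : item V => (it.1, xi it))).
  have -> (s : seq ({set V} * ids)) : \sum_k (k \in s : nat) = #|[set k in s]|.
    by rewrite cardsE -sum1_card [RHS]big_mkcond; apply: eq_bigr => k _; case: (k \in s).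
  by rewrite cardsE card_size.
apply: (@leq_trans (\sum_(j < p) #|E| * (#|{: conf}| * (Kw ^ #|V| * Kd)))); last first.
  by rewrite sum_nat_const card_ord.
apply: leq_sum => j _.
apply: leq_trans (card_queries j).
by rewrite -sum1_card [leqRHS]big_mkcond; apply: leq_sum => k _; case: (k \in _).
Qed.

(** Storage and queries are addressed by the same [w2], so a single weighted balls-into-bins event
    controls both rounds. *)
Lemma load35 (i : 'I_p) :
  \sum_j size (send_to_owner w2 (ann j) i) + \sum_j size (send_queries E sh w2 (R4 j) i)
  <= \sum_(k | w2 k.1 k.2 == i) owner_weight k.
Proof.
rewrite [leqRHS]big_split /= leq_add //.
  pose P (it : item V) := w2 it.1 (xi it) == i.
  rewrite (eq_bigr (fun j => count P (inp j))); last first.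
    by move=> j _; rewrite size_map size_filter count_map.
  have -> : \sum_j count P (inp j) = count P all_items.
    by rewrite count_flatten -map_comp sumnE big_map big_enum.
  rewrite -size_filter -(size_map (fun it : item V => (it.1, xi it))).
  have -> : \sum_(k | w2 k.1 k.2 == i) (k \in [seq (it.1, xi it) | it <- all_items] : nat) =
      #|[set k | (w2 k.1 k.2 == i) && (k \in [seq (it.1, xi it) | it <- all_items])]|.
    by rewrite cardsE -sum1_card big_mkcondr; apply: eq_bigr => k _; case: (k \in _).
  rewrite cardE; apply: uniq_leq_size.
    rewrite map_inj_in_uniq ?filter_uniq // => it it'; rewrite !mem_filter.
    move=> /andP[_ itA] /andP[_ itA'] [ie xie].
    have := restr_idsE itA itA' (subxx it.1); rewrite ie subxx xie eqxx => /(_ isT)/esym/eqP.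
    rewrite -{1}ie !items_restr //; by case: it it' ie {itA itA' xie} => ? ? [? ?] /= -> ->.
  move=> k /mapP[it]; rewrite mem_filter => /andP[Pi itA] ->.
  by rewrite mem_enum inE [X in X && _]Pi; apply: (map_f (fun it : item V => (it.1, xi it))).
rewrite exchange_big /=; apply: leq_sum => j _.
rewrite size_map size_filter -sum1_count big_enum_cond /=.
rewrite [leqRHS](eq_bigr (fun k => if k \in queries E sh (R4 j) then 1 else 0)).
  by rewrite -big_mkcondr /=; apply: eq_leq; apply: eq_bigl => k; rewrite andbC.
by move=> k _; case: (k \in _).
Qed.

Lemma load6 (i : 'I_p) : (forall e x, w2 e x < p) -> \sum_j size (send_bits (R3 j) (R5 j) i) <=
  #|E| * (#|{: conf}| * (Kw ^ #|V| * Kd)).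
Proof.
move=> w2p; apply: leq_trans (card_queries i).
rewrite (eq_bigr (fun j : 'I_p => count (fun k => w2 k.1 k.2 == j) (enum (queries E sh (R4 i))))).
  rewrite cardE; elim: (enum _) => [|k s IH] /=; first by rewrite big1.
  rewrite big_split /= -[(size s).+1]add1n leq_add // (bigD1 (Ordinal (w2p k.1 k.2))) //= eqxx.
  rewrite big1 // => j /eqP ne; case: eqP => // eq_o; case: ne; apply: val_inj; by rewrite /= eq_o.
by move=> j _; rewrite size_map nth_enum_map size_map size_filter.
Qed.

End JoinLoads.

(** * Most seeds balance both hash functions *)

Section Seeds.
Variables (R : realType) (V : finType) (E : {set {set V}}) (p B D M lam : nat).
Local Notation num := 'I_D.+1.
Local Notation ids := {ffun V -> num}.
Local Notation conf := {ffun {set V} * {set V} -> 'I_B.+1}.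
Variables (sh : conf -> share V) (inp : 'I_p -> seq (item V)).
Variables (xi : item V -> ids) (ty : item V -> {ffun {set V} -> 'I_B.+1}).

Local Notation all_items := (flatten [seq inp j | j <- enum 'I_p]).

Hypothesis xi_eq : forall it it' v, it \in all_items -> it' \in all_items ->
  v \in it.1 -> v \in it'.1 -> (xi it v == xi it' v) = (it.2 v == it'.2 v).
Hypothesis tyE : forall it (X : {set V}), it \in all_items -> X \subset it.1 ->
  ty it X = trunc_log 2 (count (matches (it.1, X, restr X it.2)) all_items) :> nat.
Hypothesis shP : forall gam : conf, share_spec E p M (fun e X => gam (e, X)) (sh gam).
Hypothesis lam0 : 0 < lam.

Definition bucket_seed := {ffun conf * V * num -> 'I_p}.
Definition owner_seed := {ffun {set V} * ids -> 'I_p}.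
Definition bucket_of (om : bucket_seed) gam v a : nat := om (gam, v, a).
Definition owner_of (om : owner_seed) e x : nat := om (e, x).

(** Each hashed variable costs one factor [lam]. The 2 here, and one of the factors 2 in [wit_cap],
    come from rounding degrees to powers of two; the other [#|V|] in [wit_cap] come from rounding
    shares. *)
Definition dom_cap := lam ^ #|V| * (2 * M).
Definition wit_cap := lam ^ #|V| * 2 ^ #|V|.+1.
Definition query_cap := #|E| * (#|{: conf}| * (wit_cap ^ #|V| * dom_cap)).

Definition balanced_buckets (om : bucket_seed) : bool :=
  [forall gam : conf, [forall e0 in E, ~~ (e0 \subset sZ (sh gam)) ==>
    [forall c : {ffun V -> 'I_p}, #|[set x in part inp xi ty gam (sdom (sh gam) e0) (sdom (sh gam) e0) |
        in_cell sh (bucket_of om) gam (sdom (sh gam) e0) c x]| <= dom_cap]]] &&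
  [forall gam : conf, [forall z in sZ (sh gam),
    [forall c : {ffun V -> 'I_p}, #|[set x in part inp xi ty gam (swit (sh gam) z).1 (swit (sh gam) z).2 |
        in_cell sh (bucket_of om) gam (swit (sh gam) z).2 c x]| <= wit_cap]]].

Definition balanced_owners m (om1 : bucket_seed) (om2 : owner_seed) : bool :=
  [forall i : 'I_p, \sum_(k | owner_of om2 k.1 k.2 == i)
     owner_weight E sh (bucket_of om1) inp xi ty k <= lam * m].

Definition hash_events : nat :=
  #|{: {set V} * V * {set V} * {ffun V -> num} * {ffun V -> 'I_p}}|.

Definition tail : R := expR (2 - lam%:R / 2)%R.

Lemma share_le gam v : 0 < sq (sh gam) v <= p.
Proof.
have [q0 prodq _ _] := shP gam; rewrite q0; apply: leq_trans prodq.
by rewrite (bigD1 v) //= leq_pmulr // prodn_gt0.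
Qed.

Definition overfull (gam : conf) (e X : {set V}) m : {set bucket_seed} :=
  hypercube_bad p lam m (fun v a => (gam, v, a)) (sq (sh gam)) X (part inp xi ty gam e X).

Lemma card_overfull (gam : conf) (e X : {set V}) m : X \subset e ->
  (forall X' : {set V}, X' \subset X -> 2 * 2 ^ gam (e, X') <=
     m * \prod_(v in X :\: X') sq (sh gam) v * 2 ^ gam (e, X)) ->
  (#|overfull gam e X m|%:R <= hash_events%:R * (tail * #|{: bucket_seed}|%:R) :> R)%R.
Proof.
move=> Xe degs; apply: hypercube_whp => //; first by move=> v a v' a' [].
  exact: share_le.
move=> X' x X'X; have := part_degree xi_eq tyE gam x Xe X'X.
by move/leq_trans/(_ (degs _ X'X)); rewrite leq_pmul2r // expn_gt0.
Qed.

Lemma not_overfull (gam : conf) (e X : {set V}) m om (c : {ffun V -> 'I_p}) : om \notin overfull gam e X m ->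
  #|[set x in part inp xi ty gam e X | in_cell sh (bucket_of om) gam X c x]| <= lam ^ #|V| * m.
Proof.
rewrite inE negb_exists => /forallP/(_ c); rewrite -leqNgt => /leq_trans; apply.
by rewrite leq_mul2r leq_pexp2l ?max_card ?orbT.
Qed.

Lemma card_unbalanced_buckets :
  (#|[set om | ~~ balanced_buckets om]|%:R <=
     (#|{: conf}| * (2 ^ #|V| + #|V|) * hash_events)%:R * (tail * #|{: bucket_seed}|%:R) :> R)%R.
Proof.
pose T := ({set V} + V)%type.
pose F (gt : conf * T) : {set bucket_seed} := match gt.2 with
  | inl e0 => if (e0 \in E) && ~~ (e0 \subset sZ (sh gt.1)) then
      overfull gt.1 (sdom (sh gt.1) e0) (sdom (sh gt.1) e0) (2 * M) else set0
  | inr z => if z \in sZ (sh gt.1) then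
      overfull gt.1 (swit (sh gt.1) z).1 (swit (sh gt.1) z).2 (2 ^ #|V|.+1) else set0
  end.
have sub : [set om | ~~ balanced_buckets om] \subset \bigcup_gt F gt.
  apply/subsetP => om; rewrite inE; apply: contraR => nF.
  have nFgt gt : om \notin F gt by apply: contra nF => h; apply/bigcupP; exists gt.
  apply/andP; split; apply/forallP => gam.
    apply/forall_inP => e0 e0E; apply/implyP => e0Z; apply/forallP => c.
    by apply: not_overfull; have := nFgt (gam, inl e0); rewrite /F /= e0E e0Z.
  apply/forall_inP => z zZ; apply/forallP => c.
  by apply: not_overfull; have := nFgt (gam, inr z); rewrite /F /= zZ.
apply: (@le_trans _ _ (\sum_gt #|F gt|)%:R%R).
  by rewrite ler_nat; apply: leq_trans (subset_leq_card sub) (card_bigcup_le _).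
have -> : #|{: conf}| * (2 ^ #|V| + #|V|) = #|{: conf * T}|.
  rewrite card_prod card_sum; congr (_ * (_ + _)).
  by rewrite card_subsets.
rewrite natr_sum natrM -mulrA mulr_natl -sumr_const.
have bound0 : (0 <= hash_events%:R * (tail * #|{: bucket_seed}|%:R) :> R)%R.
  by rewrite mulr_ge0 // mulr_ge0 // expR_ge0.
apply: ler_sum => -[gam [e0|z]] _; rewrite /F /=; case: ifP => cond; rewrite ?cards0 //.
  have [_ _ _ dom] := shP gam; have /andP[e0E e0Z] := cond.
  have [_ _ domP] := dom _ e0E e0Z; apply: card_overfull => // X' X'd.
  rewrite -2!mulnA leq_mul2l /= mulnA; apply: leq_trans (domP _ X'd) _.
  by rewrite leq_pmulr // expn_gt0.
have [_ _ wit _] := shP gam; have := wit _ cond; case: (swit _ _) => e X /= [_ Xe _ witP].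
apply: card_overfull => // X' X'X; rewrite expnS -!mulnA leq_mul2l /=.
by apply: leq_trans (witP _ X'X) _; rewrite mulnAC -mulnA.
Qed.

Lemma balanced_buckets_dom om : balanced_buckets om ->
  forall gam e0 (c : {ffun V -> 'I_p}), e0 \in E -> ~~ (e0 \subset sZ (sh gam)) ->
  #|[set x in part inp xi ty gam (sdom (sh gam) e0) (sdom (sh gam) e0) |
     in_cell sh (bucket_of om) gam (sdom (sh gam) e0) c x]| <= dom_cap.
Proof.
case/andP=> /forallP h _ gam e0 c e0E e0Z.
by have /forall_inP/(_ e0 e0E)/implyP/(_ e0Z)/forallP := h gam.
Qed.

Lemma balanced_buckets_wit om : balanced_buckets om ->
  forall gam z (c : {ffun V -> 'I_p}), z \in sZ (sh gam) ->
  #|[set x in part inp xi ty gam (swit (sh gam) z).1 (swit (sh gam) z).2 |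
     in_cell sh (bucket_of om) gam (swit (sh gam) z).2 c x]| <= wit_cap.
Proof.
case/andP=> _ /forallP h gam z c zZ.
by have /forall_inP/(_ z zZ)/forallP := h gam.
Qed.

Hypothesis M0 : 0 < M.

Lemma dom_cap_gt0 : 0 < dom_cap.
Proof. by rewrite !muln_gt0 expn_gt0 lam0. Qed.

Lemma wit_cap_gt0 : 0 < wit_cap.
Proof. by rewrite !muln_gt0 !expn_gt0 lam0. Qed.

(** With the first seed fixed the weights are constants. A ball weighs at most [p + 1], and balanced
    buckets bound the number of queries and thus the total weight. There are [p] buckets, so
    reduction modulo [p] changes nothing. *)
Lemma card_unbalanced_owners m om1 : p.+1 <= m -> size all_items + p * query_cap <= m * p ->
  balanced_buckets om1 ->
  (#|[set om2 | ~~ balanced_owners m om1 om2]|%:R <= p%:R * (tail * #|{: owner_seed}|%:R) :> R)%R.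
Proof.
move=> pm sm bal.
pose W := owner_weight E sh (bucket_of om1) inp xi ty.
pose F (i : 'I_p) := [set om2 : owner_seed | lam * m < \sum_(k | om2 k %% p == i) W k].
have sub : [set om2 | ~~ balanced_owners m om1 om2] \subset \bigcup_i F i.
  apply/subsetP => om2; rewrite inE negb_forall => /existsP[i]; rewrite -ltnNge => lt.
  apply/bigcupP; exists i => //; rewrite inE; apply: leq_trans lt _.
  apply: eq_leq; apply: eq_bigl => -[e x]; rewrite /owner_of /= modn_small //.
apply: (@le_trans _ _ (\sum_i #|F i|)%:R%R).
  by rewrite ler_nat; apply: leq_trans (subset_leq_card sub) (card_bigcup_le _).
apply: (@le_trans _ _ (\sum_(i < p) (tail * #|{: owner_seed}|%:R))%R); last first.
  by rewrite sumr_const card_ord mulr_natl.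
rewrite natr_sum; apply: ler_sum => i _.
apply: balls_into_bins.
- by rewrite leqnn (leq_trans _ (ltn_ord i)).
- by move=> k; apply: leq_trans pm; exact: owner_weight_le.
- apply: leq_trans sm.
  exact: (owner_weight_sum dom_cap_gt0 wit_cap_gt0 (balanced_buckets_dom bal) (balanced_buckets_wit bal)).
Qed.

(** The owner event has a bound only when the buckets are balanced, so failures split into
    unbalanced buckets and, for each balanced first seed, bad second seeds. *)
Lemma good_seeds m : p.+1 <= m -> size all_items + p * query_cap <= m * p ->
  (#|[set om : bucket_seed * owner_seed | ~~ (balanced_buckets om.1 && balanced_owners m om.1 om.2)]|%:R
   <= (#|{: conf}| * (2 ^ #|V| + #|V|) * hash_events + p)%:R * tail
      * #|{: bucket_seed * owner_seed}|%:R :> R)%R.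
Proof.
move=> pm sm; set N1 := _ * hash_events.
pose A1 := [set om : bucket_seed * owner_seed | ~~ balanced_buckets om.1].
pose A2 := [set om : bucket_seed * owner_seed | balanced_buckets om.1 && ~~ balanced_owners m om.1 om.2].
have sub : [set om : bucket_seed * owner_seed |
    ~~ (balanced_buckets om.1 && balanced_owners m om.1 om.2)] \subset A1 :|: A2.
  by apply/subsetP => om; rewrite !inE; case: (balanced_buckets _).
apply: (@le_trans _ _ (#|A1| + #|A2|)%:R%R).
  rewrite ler_nat; apply: leq_trans (subset_leq_card sub) (leq_card_setU _ _).
rewrite natrD card_prod natrM natrD !mulrDl; apply: lerD.
  have -> : A1 = setX [set om | ~~ balanced_buckets om] setT.
    by apply/setP => om; rewrite !inE andbT.
  rewrite cardsX cardsT natrM.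
  by apply: le_trans (ler_wpM2r (ler0n _ _) card_unbalanced_buckets) _; rewrite -!mulrA lexx.
rewrite -sum1_card (eq_bigl (fun om : bucket_seed * owner_seed =>
   xpredT om.1 && (balanced_buckets om.1 && ~~ balanced_owners m om.1 om.2))); last first.
  by move=> om; rewrite inE.
rewrite -(pair_big_dep xpredT (fun om1 om2 => balanced_buckets om1 && ~~ balanced_owners m om1 om2)
   (fun _ _ => 1)) /= natr_sum.
apply: (@le_trans _ _ (\sum_(om1 : bucket_seed) (p%:R * (tail * #|{: owner_seed}|%:R)))%R).
  apply: ler_sum => om1 _; have [bal|unbal] := boolP (balanced_buckets om1); last first.
    by rewrite big_pred0_eq mulr_ge0 // mulr_ge0 // expR_ge0.
  apply: le_trans (card_unbalanced_owners pm sm bal).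
  by rewrite ler_nat -sum1_card; apply: eq_leq; apply: eq_bigl => om2; rewrite inE.
by rewrite sumr_const -[leLHS]mulr_natr -!mulrA [(_ * #|{: bucket_seed}|%:R)%R]mulrC.
Qed.

End Seeds.

(** * One run of the protocol on a given input *)

Section Run.
Variables (V : finType) (E : {set {set V}}) (n p B D g M lam m : nat).
Local Notation num := 'I_D.+1.
Local Notation ids := {ffun V -> num}.
Local Notation conf := {ffun {set V} * {set V} -> 'I_B.+1}.
Local Notation code := ({set V} * {set V} * conf * (num * num) * ids)%type.
Local Notation keys_per_item := (2 ^ #|V| + #|V|).
Variables (sh : conf -> share V) (w1 : conf -> V -> num -> nat) (w2 : {set V} -> ids -> nat).
Variables (Rl : {set V} -> {fset rtuple V}) (inp : 'I_p -> seq (item V)).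

Local Notation all_items := (flatten [seq inp j | j <- enum 'I_p]).
Local Notation send := (protocol_send E g sh w1 w2).
Local Notation sent := (tmsg send inp).

Hypothesis wf : well_formed E Rl.
Hypothesis sizeRl : input_size E Rl = n.
Hypothesis even : even_distribution E Rl inp.

Lemma input_itemsE :
  input_items E Rl = [seq (e, t) | e <- enum E, t <- enum_fset (Rl e)].
Proof. by []. Qed.

Lemma mem_all_items it : (it \in all_items) = (it.1 \in E) && (it.2 \in Rl it.1).
Proof.
have [/perm_mem -> _] := even; rewrite input_itemsE; apply/allpairsPdep/andP.
  by case=> e [t [+ tR ->]]; rewrite mem_enum.
by case: it => e t [eE tR]; exists e, t; rewrite mem_enum.
Qed.

Lemma uniq_all_items : uniq all_items.
Proof.
have [/perm_uniq -> _] := even; rewrite input_itemsE.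
apply: allpairs_uniq_dep; rewrite ?enum_uniq //.
by move=> [e t] [e' t'] _ _ /= [-> ->].
Qed.

Lemma size_all_items : size all_items = n.
Proof.
have [/perm_size -> _] := even; rewrite input_itemsE size_allpairs_dep -sizeRl.
by rewrite sumnE big_map big_enum.
Qed.

Lemma items_in_E it : it \in all_items -> it.1 \in E.
Proof. by rewrite mem_all_items => /andP[]. Qed.

Lemma items_normal it : it \in all_items -> restr it.1 it.2 = it.2.
Proof. by rewrite mem_all_items => /andP[eE tR]; apply: wf. Qed.

Lemma in_joinE t : in_join E Rl t <-> forall e, e \in E -> (e, restr e t) \in all_items.
Proof.
split=> [/forall_inP h e eE|h]; first by rewrite mem_all_items eE h.
by apply/forall_inP => e /h; rewrite mem_all_items => /andP[].
Qed.

Section Legality.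
Variable N : nat.
Hypothesis code_N : #|{: code}| <= N.

Let occurs (t : rtuple V) := forall v, t v = 0 \/ exists2 it, it \in all_items & t v = it.2 v.

Lemma occurs_zero : occurs (zero_tuple V).
Proof. by move=> v; left; rewrite ffunE. Qed.

Lemma occurs_restr it X : it \in all_items -> occurs (restr X it.2).
Proof. by move=> itA v; rewrite ffunE; case: ifP => _; [right; exists it|left]. Qed.

Lemma occurs_key j k : k \in local_keys (inp j) -> occurs k.2.
Proof.
case/local_keysP=> it /(mem_all (p := p)) itA.
case/item_keysP=> [[X _ ->]|[v _ ->]]; first exact: occurs_restr.
move=> u; rewrite ffunE inE; case: eqP => [->|_]; last by left.
by right; exists it.
Qed.

Lemma mem_samples (x0 : ({set V} * {set V} * rtuple V)) l k : k \in samples x0 g l -> k \in l.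
Proof.
by case/mapP=> i; rewrite mem_filter => /andP[il _] ->; rewrite mem_nth.
Qed.

Lemma occurs_sent k j i r : r \in sent k j i -> occurs (rT r).
Proof.
have occ_ann R0 R2 a : a \in annotate p (inp j) R0 R2 -> a.1.1 \in all_items.
  by case/mapP=> it itj ->; apply: mem_all itj.
have nilP : r \in [::] -> occurs (rT r) by [].
move: k => [|[|[|[|[|[|[|k]]]]]]].
- by rewrite sent0 => /mapP[key /mem_samples kj ->]; apply: occurs_key kj.
- rewrite sent1 => /mapP[key]; rewrite mem_filter => /andP[_ kj] ->; exact: occurs_key kj.
- by rewrite sent2 => /mapP[r' _ ->]; apply: occurs_zero.
- by rewrite sent3 => /mapP[a _ ->]; apply: occurs_zero.
- rewrite sent4 => /flattenP[_ /mapP[gam _ ->] /flattenP[_ /mapP[w _ ->]]].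
  case/mapP=> xt; rewrite mem_undup => /mapP[a]; rewrite mem_filter => /andP[_ /occ_ann aA] -> ->.
  exact: occurs_restr.
- by rewrite sent5 => /mapP[a _ ->]; apply: occurs_zero.
- by rewrite sent6 => /mapP[a _ ->]; apply: occurs_zero.
- exact: nilP.
Qed.

(** A value copied from outside the schema of its tuple is 0 by the normal form, hence a small
    number; inside the schema it belongs to the active domain. *)
Lemma join_words_legal : words_legal (join_alg E p g sh w1 w2) inp
  (fun w => in_adom E Rl w || (w <= N)).
Proof.
move=> k j i _; rewrite /join_alg msg_compile; last exact: dec_recsK.
apply/allP => w /flattenP[_ /mapP[r rs ->]].
rewrite inE => /predU1P[->|/mapP[v _ ->]].
  by apply/orP; right; apply: leq_trans code_N; apply: ltnW; exact: ltn_ord.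
have [-> //|[it itA tv]] := occurs_sent rs v; first by rewrite orbT.
have [vi|vi] := boolP (v \in it.1); last first.
  by rewrite -[r.2]/(rT r) tv -(items_normal itA) ffunE (negPf vi) orbT.
apply/orP; left; move: itA; rewrite mem_all_items => /andP[eE tR].
apply/existsP; exists it.1; rewrite eE; apply/existsP; exists v; rewrite vi.
by apply/hasP; exists it.2 => //; rewrite -[r.2]/(rT r) tv.
Qed.

End Legality.

Hypothesis coverV : forall v : V, exists2 e, e \in E & v \in e.
Hypothesis E0 : set0 \notin E.
Hypothesis p0 : 0 < p.
Hypothesis n0 : 0 < n.
Hypothesis g0 : 0 < g.
Hypothesis BE : B = trunc_log 2 n.
Hypothesis gp : (n + p.-1) %/ p * keys_per_item <= g * p.
Hypothesis Dn : (n * keys_per_item).+1 * p <= D.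

Lemma keys_gp j : size (local_keys (inp j)) <= g * p.
Proof.
apply: leq_trans gp; apply: leq_trans (size_local_keys _) _; rewrite leq_mul2r.
by have [_ /(_ j)] := even; rewrite sizeRl => ->; rewrite orbT.
Qed.

Lemma items_D : (size all_items * keys_per_item).+1 * p <= D.
Proof. by rewrite size_all_items. Qed.

Local Notation xi := (item_ids B D g inp).
Local Notation ty := (item_type B inp).

Lemma item_ids_out it v : it \in all_items -> v \notin it.1 -> xi it v = ord0.
Proof. by move=> _ ve; rewrite ffunE (negPf ve). Qed.

Lemma item_ids_eq it it' v : it \in all_items -> it' \in all_items ->
  v \in it.1 -> v \in it'.1 -> (xi it v == xi it' v) = (it.2 v == it'.2 v).
Proof.
move=> itA itA' ve ve'; rewrite !ffunE ve ve'; apply/eqP/eqP => [|->//].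
exact: (val_id_inj p0 g0 keys_gp items_D).
Qed.

Lemma item_typeE it (X : {set V}) : it \in all_items -> X \subset it.1 ->
  ty it X = trunc_log 2 (count (matches (it.1, X, restr X it.2)) all_items) :> nat.
Proof.
move=> _ Xe; rewrite ffunE Xe inordK // ltnS BE leq_trunc_log //.
by rewrite -size_all_items count_size.
Qed.

Local Notation R3' := (stored_at w2 inp xi ty).
Local Notation R4' := (views_at E sh w1 inp xi ty).
Local Notation R5' := (queries_at E sh w1 w2 inp xi ty).
Local Notation R6' := (bits_at E sh w1 w2 inp xi ty).
Local Notation ann := (ann inp xi ty).

Lemma annE j : annotate p (inp j) [seq send_samples B D g (inp j) | j <- enum 'I_p]
    (rcv send inp 2 j) = ann j.
Proof. exact: (annotateE sh w1 w2 E0 items_in_E p0 g0 keys_gp items_D). Qed.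

Lemma rcv3E i : rcv send inp 3 i = R3' i.
Proof. by apply: eq_map => j; rewrite sent3 annE. Qed.

Lemma rcv4E i : rcv send inp 4 i = R4' i.
Proof. by apply: eq_map => j; rewrite sent4 annE. Qed.

Lemma rcv5E i : rcv send inp 5 i = R5' i.
Proof. by apply: eq_map => j; rewrite sent5 rcv4E. Qed.

Lemma rcv6E i : rcv send inp 6 i = R6' i.
Proof. by apply: eq_map => j; rewrite sent6 rcv3E rcv5E. Qed.

Hypothesis w2_lt : forall e x, w2 e x < p.
Hypothesis shP : forall gam : conf, share_spec E p M (fun e X => gam (e, X)) (sh gam).

Lemma join_computes : computes (join_alg E p g sh w1 w2) inp E Rl.
Proof.
move=> t; rewrite in_joinE; split=> [/(join_complete w1 ty coverV E0 item_ids_out item_ids_eq w2_lt shP)[i ti]|[i]].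
  by exists i; rewrite output_join rcv4E rcv6E.
rewrite output_join rcv4E rcv6E => h e.
exact: (join_sound E0 items_normal item_ids_eq w2_lt shP h).
Qed.

Hypotheses (lam0 : 0 < lam) (M0 : 0 < M).
Hypothesis dom_load : forall gam e0 (c : {ffun V -> 'I_p}), e0 \in E -> ~~ (e0 \subset sZ (sh gam)) ->
  #|[set x in part inp xi ty gam (sdom (sh gam) e0) (sdom (sh gam) e0) |
     in_cell sh w1 gam (sdom (sh gam) e0) c x]| <= dom_cap V M lam.
Hypothesis wit_load : forall gam z (c : {ffun V -> 'I_p}), z \in sZ (sh gam) ->
  #|[set x in part inp xi ty gam (swit (sh gam) z).1 (swit (sh gam) z).2 |
     in_cell sh w1 gam (swit (sh gam) z).2 c x]| <= wit_cap V lam.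
Hypothesis own_load : forall i : 'I_p, \sum_(k | w2 k.1 k.2 == i)
  owner_weight E sh w1 inp xi ty k <= lam * m.

(** The bounds of the rounds added up: samples, keys, answers, storage with queries, views, bits. *)
Definition load_cap := p * p + 2 * p * g + g * p + lam * m +
  #|{: conf}| * (#|E| * dom_cap V M lam + p * (#|V| * wit_cap V lam)) + query_cap E B M lam.

Lemma sent_le k i : \sum_j size (sent k j i) <= load_cap.
Proof.
rewrite /load_cap.
have l35 : \sum_j size (sent 3 j i) + \sum_j size (sent 5 j i) <= lam * m.
  apply: leq_trans (own_load i).
  under eq_bigr do rewrite sent3 annE.
  under [X in _ + X <= _]eq_bigr do rewrite sent5 rcv4E.
  exact: (load35 E sh w1 w2 ty uniq_all_items items_normal item_ids_eq i).
move: k => [|[|[|[|[|[|[|k]]]]]]].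
- by have := load0 E sh w1 w2 g0 keys_gp i; lia.
- by have := load1 E sh w1 w2 inp g0 i; lia.
- by have := load2 E sh w1 w2 p0 g0 keys_gp i; lia.
- lia.
- have := load4 uniq_all_items items_normal item_ids_eq shP dom_load wit_load i.
  under [X in _ -> X <= _]eq_bigr do rewrite sent4 annE.
  lia.
- lia.
- have := load6 (dom_cap_gt0 V lam0 M0) (wit_cap_gt0 V lam0) dom_load wit_load i w2_lt.
  under [X in _ -> X <= _]eq_bigr do rewrite sent6 rcv3E rcv5E.
  rewrite -/(query_cap E B M lam); lia.
- by rewrite big1.
Qed.

Lemma join_max_load : max_load (join_alg E p g sh w1 w2) inp <= #|V|.+1 * load_cap.
Proof.
apply/bigmax_leqP => k _; apply/bigmax_leqP => i _.
rewrite /join_alg (recv_load_compile _ _ _ _ _ _ (m := #|V|.+1)) ?leq_mul2l ?sent_le ?orbT //.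
  exact: dec_recsK.
exact: size_enc_rec.
Qed.

End Run.

(** * Asymptotics *)

Definition log_size (n : nat) : nat := (trunc_log 2 n).+1.

Lemma log_size_ltn n : n < 2 ^ log_size n.
Proof. exact: trunc_log_ltn. Qed.

Lemma log_size_le n : 0 < n -> log_size n <= n.
Proof. by move=> n0; apply: leq_trans (ltn_expl _ _) (trunc_logP _ n0). Qed.

(** As [exp(1/2) <= 2], the binary logarithm is at most twice the natural one. *)
Lemma log_size_ln (R : realType) n : 0 < n -> ((log_size n)%:R <= 2 * (1 + ln n%:R) :> R)%R.
Proof.
move=> n0; have nR : (0 < n%:R :> R)%R by rewrite ltr0n.
have := trunc_logP (isT : 1 < 2) n0; rewrite -(ler_nat R) natrX => le_n.
have : (((trunc_log 2 n)%:R / 2) <= ln n%:R :> R)%R.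
  rewrite -ler_expR lnK ?posrE //; apply: le_trans le_n.
  rewrite mulrC expRM_natr; apply: lerXn2r; rewrite ?nnegrE ?expR_ge0 //.
  by have := @expR_half_le R 1; rewrite ler01 lexx /= -mulr2n mul1r; apply.
have : (0 <= ln (n%:R : R))%R by apply: ln_ge0; rewrite ler1n.
rewrite /log_size -[(trunc_log 2 n).+1]addn1 natrD; lra.
Qed.

(** With [l = log_size n] one has [N <= exp(2 l d)] and [p^c <= exp(l c)], so the multiplier
    [2 * (2 * d + c + 2)] leaves the exponent [2 - 2 l], which is at most 0. *)
Lemma tail_small (R : realType) n p N d c : 0 < p -> p ^ 3 <= n -> N <= (n + p) ^ d ->
  (N%:R * expR (2 - (2 * (2 * d + c + 2) * log_size n)%:R / 2) <= 1 / p%:R ^+ c :> R)%R.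
Proof.
move=> p0 pn Nd; set l := log_size n.
have l0 : 0 < l by [].
have pn' : p <= n by apply: leq_trans pn; rewrite -{1}[p]expn1 leq_pexp2l.
have nl := log_size_ltn n; rewrite -/l in nl.
have exp2 k : ((2 ^ k)%:R <= expR k%:R :> R)%R.
  rewrite natrX -[k%:R%R]mul1r expRM_natr; apply: lerXn2r; rewrite ?nnegrE ?expR_ge0 //.
  by apply: le_trans (expR_ge1Dx _).
have pl : (p%:R <= expR l%:R :> R)%R.
  by apply: le_trans (exp2 l); rewrite ler_nat (leq_trans pn') // ltnW.
have npl : ((n + p)%:R <= expR (2 * l)%:R :> R)%R.
  apply: le_trans (exp2 (2 * l)); rewrite ler_nat mul2n -addnn expnD.
  have : 2 <= 2 ^ l by rewrite -{1}[2]expn1 leq_pexp2l.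
  move: (2 ^ l) nl => x; nia.
have NR : (N%:R <= expR (2 * l * d)%:R :> R)%R.
  rewrite natrM expRM_natr; apply: le_trans (_ : ((n + p) ^ d)%:R <= _)%R.
    by rewrite ler_nat.
  by rewrite natrX; apply: lerXn2r; rewrite ?nnegrE ?expR_ge0.
have pc0 : (0 < p%:R ^+ c :> R)%R by rewrite exprn_gt0 // ltr0n.
rewrite ler_pdivlMr //.
have pcl : (p%:R ^+ c <= expR (l * c)%:R :> R)%R.
  by rewrite natrM expRM_natr; apply: lerXn2r; rewrite ?nnegrE ?expR_ge0.
apply: (@le_trans _ _ (expR (2 * l * d)%:R * expR (2 - (2 * (2 * d + c + 2) * l)%:R / 2) * expR (l * c)%:R)%R).
  apply: ler_pM => //; first by rewrite mulr_ge0 // expR_ge0.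
    by rewrite ltW.
  by rewrite ler_wpM2r // expR_ge0.
have -> : ((2 * (2 * d + c + 2) * l)%:R / 2 = ((2 * d + c + 2) * l)%:R :> R)%R.
  by rewrite -mulnA [in LHS]natrM mulrC mulKf // pnatr_eq0.
rewrite -!expRD -[leRHS]expR0 ler_expR.
have : (1 <= l%:R :> R)%R by rewrite ler1n.
rewrite !(natrM, natrD); move: (l%:R)%R (d%:R)%R (c%:R)%R => x y z; nra.
Qed.

Definition polylog (x : nat -> nat -> nat) :=
  exists C a, forall n p, x n p <= C * log_size n ^ a.

Definition polynomial_size (x : nat -> nat -> nat) :=
  exists d, forall n p, 0 < p -> p ^ 3 <= n -> x n p <= (n + p) ^ d.

Definition polylog_of (M x : nat -> nat -> nat) :=
  exists C a, forall n p, 1 < p -> p ^ 3 <= n -> x n p <= C * log_size n ^ a * M n p.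

Section Growth.
Implicit Types (x y M : nat -> nat -> nat).

Lemma log_size_exp_le n a b : a <= b -> log_size n ^ a <= log_size n ^ b.
Proof. by move=> ab; rewrite leq_pexp2l. Qed.

Lemma polylog_const k : polylog (fun _ _ => k).
Proof. by exists k, 0 => n p; rewrite expn0 muln1. Qed.

Lemma polylog_log : polylog (fun n _ => log_size n).
Proof. by exists 1, 1 => n p; rewrite expn1 mul1n. Qed.

Lemma polylog_mul x y : polylog x -> polylog y -> polylog (fun n p => x n p * y n p).
Proof.
move=> [C [a xP]] [C' [a' yP]]; exists (C * C'), (a + a') => n p.
by rewrite expnD mulnACA leq_mul.
Qed.

Lemma polylog_exp x k : polylog x -> polylog (fun n p => x n p ^ k).
Proof.
move=> [C [a xP]]; exists (C ^ k), (a * k) => n p.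
by rewrite expnM -expnMn; case: k => // k; rewrite leq_exp2r.
Qed.

Lemma polylog_of_add M x y : polylog_of M x -> polylog_of M y ->
  polylog_of M (fun n p => x n p + y n p).
Proof.
move=> [C [a xP]] [C' [a' yP]]; exists (C + C'), (a + a') => n p p1 pn.
rewrite !mulnDl leq_add //; first apply: leq_trans (xP _ _ p1 pn) _; last apply: leq_trans (yP _ _ p1 pn) _.
  by rewrite leq_mul2r leq_mul2l log_size_exp_le ?orbT // leq_addr.
by rewrite leq_mul2r leq_mul2l log_size_exp_le ?orbT // leq_addl.
Qed.

Lemma polylog_of_mul M x y : polylog x -> polylog_of M y ->
  polylog_of M (fun n p => x n p * y n p).
Proof.
move=> [C [a xP]] [C' [a' yP]]; exists (C * C'), (a + a') => n p p1 pn.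
by rewrite expnD mulnACA -mulnA leq_mul // yP.
Qed.

Lemma polylog_of_self M : polylog_of M M.
Proof. by exists 1, 0 => n p _ _; rewrite expn0 !mul1n. Qed.

Lemma polylog_of_le M x y : (forall n p, 1 < p -> p ^ 3 <= n -> x n p <= y n p) ->
  polylog_of M y -> polylog_of M x.
Proof.
move=> xy [C [a yP]]; exists C, a => n p p1 pn.
exact: leq_trans (xy _ _ p1 pn) (yP _ _ p1 pn).
Qed.

Lemma polynomial_const k : polynomial_size (fun _ _ => k).
Proof.
exists k => n p p0 pn; apply: leq_trans (ltnW (ltn_expl k (isT : 1 < 2))) _.
case: k => // k; rewrite leq_exp2r //.
have : 0 < p ^ 3 by rewrite expn_gt0 p0.
lia.
Qed.

Lemma polynomial_le x y : (forall n p, 0 < p -> p ^ 3 <= n -> x n p <= y n p) ->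
  polynomial_size y -> polynomial_size x.
Proof. by move=> xy [d yP]; exists d => n p p0 pn; apply: leq_trans (xy _ _ p0 pn) (yP _ _ p0 pn). Qed.

Lemma polynomial_mul x y : polynomial_size x -> polynomial_size y ->
  polynomial_size (fun n p => x n p * y n p).
Proof.
move=> [d xP] [d' yP]; exists (d + d') => n p p0 pn.
by rewrite expnD leq_mul ?xP ?yP.
Qed.

Lemma polynomial_exp x k : polynomial_size x -> polynomial_size (fun n p => x n p ^ k).
Proof.
move=> [d xP]; exists (d * k) => n p p0 pn.
by rewrite expnM; case: k => // k; rewrite leq_exp2r // xP.
Qed.

Lemma polynomial_add x y : polynomial_size x -> polynomial_size y ->
  polynomial_size (fun n p => x n p + y n p).
Proof.
move=> px py; apply: (@polynomial_le _ (fun n p => (x n p).+1 * (y n p).+1)).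
  by move=> n p _ _; lia.
have S z : polynomial_size z -> polynomial_size (fun n p => (z n p).+1).
  move=> [d zP]; exists d.+1 => n p p0 pn; rewrite expnS.
  have : 0 < p ^ 3 by rewrite expn_gt0 p0.
  have : 0 < (n + p) ^ d by rewrite expn_gt0 addn_gt0 p0 orbT.
  have := zP _ _ p0 pn; nia.
by apply: polynomial_mul; apply: S.
Qed.

Lemma polynomial_n : polynomial_size (fun n _ => n).
Proof. by exists 1 => n p _ _; rewrite expn1 leq_addr. Qed.

Lemma polynomial_p : polynomial_size (fun _ p => p).
Proof. by exists 1 => n p _ _; rewrite expn1 leq_addl. Qed.

Lemma polynomial_log : polynomial_size (fun n _ => log_size n).
Proof.
apply: polynomial_le polynomial_n => n p p0 pn; apply: log_size_le.
by apply: leq_trans pn; rewrite expn_gt0 p0.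
Qed.

End Growth.

(** * Growth of the parameters and of the total load *)

Section Sizes.
Variables (V : finType) (E : {set {set V}}) (kappa : R).

(* The spacing of the samples; every machine has at most [key_gap n p * p] keys. *)
Definition key_gap n p := ((n + p.-1) %/ p * (2 ^ #|V| + #|V|)) %/ p + 1.
Definition id_bound n p := (n * (2 ^ #|V| + #|V|)).+1 * p.
Definition type_bound n := trunc_log 2 n.
(** Meets both conditions of balls into bins: [n %/ p + 1] and the queries cover the mean load,
    [p + 1] a single ball. *)
Definition owner_cap c n p :=
  n %/ p + 1 + query_cap E (type_bound n) (target_load V n p kappa) (c * log_size n) + p + 1.

Local Notation conf n := {ffun {set V} * {set V} -> 'I_(type_bound n).+1}.
Local Notation num n p := 'I_(id_bound n p).+1.

Lemma card_conf n : #|{: conf n}| = log_size n ^ (2 ^ #|V| * 2 ^ #|V|).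
Proof. by rewrite card_ffun card_ord card_prod card_subsets. Qed.

Lemma polynomial_id_bound : polynomial_size (fun n p => (id_bound n p).+1).
Proof.
apply: (@polynomial_le _ (fun n p => ((n * (2 ^ #|V| + #|V|) + 1) * p + 1))).
  by move=> n p _ _; rewrite /id_bound addn1 addn1.
apply: polynomial_add (polynomial_const 1); apply: polynomial_mul polynomial_p.
apply: polynomial_add (polynomial_const 1); apply: polynomial_mul (polynomial_const _).
exact: polynomial_n.
Qed.

Lemma polynomial_code : polynomial_size (fun n p =>
  #|{: {set V} * {set V} * conf n * (num n p * num n p) * {ffun V -> num n p}}|).
Proof.
have D := polynomial_id_bound; apply: (@polynomial_le _ (fun n p =>
    2 ^ #|V| * 2 ^ #|V| * log_size n ^ (2 ^ #|V| * 2 ^ #|V|) *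
    ((id_bound n p).+1 * (id_bound n p).+1) * (id_bound n p).+1 ^ #|V|)).
  by move=> n p _ _; rewrite !card_prod card_conf card_subsets card_ffun !card_ord.
apply: polynomial_mul (polynomial_exp _ D).
apply: polynomial_mul (polynomial_mul D D); apply: polynomial_mul (polynomial_const _) _.
exact: polynomial_exp polynomial_log.
Qed.

Lemma polynomial_events : polynomial_size (fun n p =>
  #|{: conf n}| * (2 ^ #|V| + #|V|) * hash_events V p (id_bound n p) + p).
Proof.
apply: polynomial_add polynomial_p; apply: (@polynomial_le _ (fun n p =>
    log_size n ^ (2 ^ #|V| * 2 ^ #|V|) * (2 ^ #|V| + #|V|) *
    (2 ^ #|V| * #|V| * 2 ^ #|V| * (id_bound n p).+1 ^ #|V| * p ^ #|V|))).
  move=> n p _ _; rewrite card_conf /hash_events !card_prod card_subsets !card_ffun !card_ord.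
  exact: leqnn.
apply: polynomial_mul.
  apply: polynomial_mul (polynomial_const _); exact: polynomial_exp polynomial_log.
apply: polynomial_mul (polynomial_exp _ polynomial_p).
exact: polynomial_mul (polynomial_const _) (polynomial_exp _ polynomial_id_bound).
Qed.

Hypothesis kappa1 : (1 <= kappa)%R.

Local Notation M := (fun n p => target_load V n p kappa).

Lemma root_le p : 0 < p -> ((p%:R : R) `^ (1 / kappa) <= p%:R)%R.
Proof.
move=> p0; apply: ler1_powR; first by rewrite ler1n.
by rewrite ler_pdivrMr ?mul1r //; exact: lt_le_trans ltr01 kappa1.
Qed.

Lemma root_gt0 p : 0 < p -> (0 < (p%:R : R) `^ (1 / kappa))%R.
Proof. by move=> p0; apply: powR_gt0; rewrite ltr0n. Qed.

Lemma target_load_ge n p : 0 < p -> n %/ p <= M n p.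
Proof.
move=> p0; rewrite -(ler_nat R).
have le1 : ((n %/ p)%:R <= n%:R / (p%:R : R) `^ (1 / kappa))%R.
  apply: (@le_trans _ _ (n%:R / p%:R)%R).
    by rewrite ler_pdivlMr ?ltr0n // -natrM ler_nat leq_trunc_div.
  by rewrite ler_wpM2l // lef_pV2 ?posrE ?ltr0n ?root_gt0 // root_le.
have n0 : (0 <= n%:R / (p%:R : R) `^ (1 / kappa))%R by rewrite divr_ge0 // ltW // root_gt0.
apply: (le_trans le1); apply: ltW; apply: le_lt_trans (truncnS_gt _).
by rewrite ler_peMl // exprn_ege1 // ler1n.
Qed.

Lemma target_load_le n p : 0 < p -> p <= n ->
  ((M n p)%:R <= (2 ^+ #|V| + 1) * (n%:R / (p%:R : R) `^ (1 / kappa)) :> R)%R.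
Proof.
move=> p0 pn; rewrite /target_load -addn1 natrD mulrDl [(1 * (n%:R / _))%R]mul1r lerD //.
  by rewrite truncn_le mulr_ge0 ?exprn_ge0 // divr_ge0 // powR_ge0.
by rewrite ler_pdivlMr ?root_gt0 // [(1 * (_ `^ _))%R]mul1r (le_trans (root_le p0)) // ler_nat.
Qed.

(** Here [p ^ 3 <= n] enters the loads: the samples, and the [p] copies of each witness view, stay
    below the target. *)
Lemma square_le n p : 1 < p -> p ^ 3 <= n -> p * p <= M n p.
Proof.
move=> p1 pn; have p0 := ltnW p1; apply: leq_trans (target_load_ge n p0).
by rewrite leq_divRL // -[p * p * p]/(p ^ 2 * p) -expnSr.
Qed.

Lemma polylog_conf : polylog (fun n _ => #|{: conf n}|).
Proof.
have [C [a h]] := polylog_exp (2 ^ #|V| * 2 ^ #|V|) polylog_log.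
exists C, a => n p; rewrite card_conf; exact: (h n p).
Qed.

Variable c : nat.
Local Notation lam := (fun n (_ : nat) => c * log_size n).

Lemma polylog_lam : polylog lam.
Proof. exact: polylog_mul (polylog_const c) polylog_log. Qed.

Lemma polylog_wit_cap : polylog (fun n p => wit_cap V (lam n p)).
Proof. exact: polylog_mul (polylog_exp _ polylog_lam) (polylog_const _). Qed.

Lemma polylog_of_dom_cap : polylog_of M (fun n p => dom_cap V (M n p) (lam n p)).
Proof.
apply: polylog_of_mul (polylog_exp _ polylog_lam) _.
exact: polylog_of_mul (polylog_const 2) (polylog_of_self _).
Qed.

Lemma polylog_of_query_cap :
  polylog_of M (fun n p => query_cap E (type_bound n) (M n p) (lam n p)).
Proof.
apply: polylog_of_mul (polylog_const _) _; apply: polylog_of_mul polylog_conf _.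
exact: polylog_of_mul (polylog_exp _ polylog_wit_cap) polylog_of_dom_cap.
Qed.

Lemma polylog_of_square : polylog_of M (fun _ p => p * p).
Proof. by apply: polylog_of_le (polylog_of_self _) => n p; apply: square_le. Qed.

Lemma polylog_of_p : polylog_of M (fun _ p => p).
Proof.
by apply: polylog_of_le polylog_of_square => n p p1 _; rewrite leq_pmulr // ltnW.
Qed.

Lemma polylog_of_1 : polylog_of M (fun _ _ => 1).
Proof. by apply: polylog_of_le polylog_of_p => n p p1 _; exact: ltnW. Qed.

Lemma polylog_of_div : polylog_of M (fun n p => n %/ p).
Proof.
by apply: polylog_of_le (polylog_of_self _) => n p p1 _; apply: target_load_ge; exact: ltnW.
Qed.

Lemma polylog_of_owner_cap : polylog_of M (fun n p => owner_cap c n p).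
Proof.
apply: polylog_of_add polylog_of_1; apply: polylog_of_add polylog_of_p.
apply: polylog_of_add polylog_of_query_cap.
exact: polylog_of_add polylog_of_div polylog_of_1.
Qed.

Lemma polylog_of_gap : polylog_of M (fun n p => key_gap n p * p).
Proof.
apply: (@polylog_of_le _ _ (fun n p => (2 ^ #|V| + #|V|) * (n %/ p + 1) + p)).
  move=> n p p1 _; have p0 := ltnW p1.
  rewrite /key_gap mulnDl mul1n leq_add2r; apply: leq_trans (leq_trunc_div _ _) _.
  rewrite mulnC leq_mul2l; apply/orP; right.
  rewrite (_ : n %/ p + 1 = (n + p) %/ p); last by rewrite divnDr ?dvdnn // divnn p0.
  by apply: leq_div2r; rewrite leq_add2l leq_pred.
apply: polylog_of_add polylog_of_p; apply: polylog_of_mul (polylog_const _) _.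
exact: polylog_of_add polylog_of_div polylog_of_1.
Qed.

Lemma polylog_of_load_cap : polylog_of M (fun n p =>
  load_cap E p (type_bound n) (key_gap n p) (M n p) (c * log_size n) (owner_cap c n p)).
Proof.
apply: polylog_of_add polylog_of_query_cap.
apply: polylog_of_add.
  apply: polylog_of_add.
    apply: polylog_of_add polylog_of_gap; apply: polylog_of_add polylog_of_square _.
    apply: (@polylog_of_le _ _ (fun n p => 2 * (key_gap n p * p))).
      by move=> n p _ _; rewrite -mulnA [p * _]mulnC.
    exact: polylog_of_mul (polylog_const 2) polylog_of_gap.
  exact: polylog_of_mul polylog_lam polylog_of_owner_cap.
apply: polylog_of_mul polylog_conf _; apply: polylog_of_add.
  exact: polylog_of_mul (polylog_const _) polylog_of_dom_cap.
apply: (@polylog_of_le _ _ (fun n p => (#|V| * wit_cap V (lam n p)) * p)).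
  by move=> n p _ _; rewrite mulnC.
apply: polylog_of_mul polylog_of_p; exact: polylog_mul (polylog_const _) polylog_wit_cap.
Qed.

End Sizes.

Section Algorithm.
Variables (V : finType) (E : {set {set V}}).
Variable shares : nat * nat * ({set V} -> {set V} -> nat) -> share V.

Definition seeds n p : finType :=
  (bucket_seed V p (type_bound n) (id_bound V n p) * owner_seed V p (id_bound V n p))%type.

Definition seed n p (s : nat) : option (seeds n p) :=
  nth None [seq Some om | om <- enum (seeds n p)] s.

Definition config_share n p (gam : {ffun {set V} * {set V} -> 'I_(type_bound n).+1}) : share V :=
  shares (n, p, fun e X => gam (e, X) : nat).

Definition kappa_join n p (s : nat) : mpc_alg V p :=
  join_alg E p (key_gap V n p) (@config_share n p)
    (fun gam v a => if seed n p s is Some om then bucket_of om.1 gam v a else 0)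
    (fun e x => if seed n p s is Some om then owner_of om.2 e x else 0).

Lemma seedE n p (s : 'I_#|seeds n p|) : seed n p s = Some (enum_val s).
Proof.
rewrite /seed (nth_map (enum_val s)); last by rewrite -cardE.
by rewrite -enum_val_nth.
Qed.

End Algorithm.

Local Open Scope ring_scope.

Theorem theorem4p19 (V : finType) (E : {set {set V}})
  (hE : E != set0) (hE0 : set0 \notin E)
  (hcov : forall v : V, exists2 e, e \in E & v \in e)
  (kappa : R) (hk : is_kappa E kappa) :
  exists r : nat, forall c : nat, exists (C : R) (a d : nat)
    (Nseeds : nat -> nat -> ({set V} -> {set V} -> R) -> nat)
    (alg : forall (n p : nat), ({set V} -> {set V} -> R) -> nat -> mpc_alg V p),
  forall (n p : nat) (Sig : {set V} -> {set V} -> R)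
         (Rl : {set V} -> {fset rtuple V}) (inp : 'I_p -> seq (item V)),
    (0 < p)%N -> (p ^ 3 <= n)%N ->
    well_formed E Rl -> input_size E Rl = n -> uniformized E Rl Sig ->
    even_distribution E Rl inp ->
    [/\ (0 < Nseeds n p Sig)%N,
        (forall s : nat, (s < Nseeds n p Sig)%N ->
           rounds (alg n p Sig s) = r /\
           words_legal (alg n p Sig s) inp
             (fun w => in_adom E Rl w || (w <= (n + p) ^ d)%N)) &
        exists G : {set 'I_(Nseeds n p Sig)},
          (forall s, s \in G ->
             computes (alg n p Sig s) inp E Rl /\
             (max_load (alg n p Sig s) inp)%:R
               <= C * n%:R / (p%:R `^ (1 / kappa)) * (1 + ln (n%:R : R)) ^+ a) /\
          (1 - 1 / (p%:R ^+ c)) * (Nseeds n p Sig)%:R <= (#|G|%:R : R)].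
Proof.
have kappa1 := kappa_ge1 hE hE0 hk.
have [dcode codeP] := polynomial_code V.
have [dev evP] := polynomial_events V.
(* Shares are a function of [n], [p] and [gam] alone, never of the data, so all machines agree on
   them; [s0] fills in where no shares are guaranteed. *)
have /boolp.choice[shares sharesP] : forall x : nat * nat * ({set V} -> {set V} -> nat),
    exists s, (1 < x.1.2)%N -> (0 < x.1.1)%N ->
      (forall e (X : {set V}), e \in E -> X \subset e -> (2 ^ x.2 e X <= x.1.1)%N) ->
      share_spec E x.1.2 (target_load V x.1.1 x.1.2 kappa) x.2 s.
  move=> [[n p] gam] /=.
  have s0 : share V := Share (fun=> 0%N) set0 (fun=> (set0, set0)) (fun=> set0).
  have [[p1 n0 gamn]|no] := pselect [/\ (1 < p)%N, (0 < n)%N &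
      forall e (X : {set V}), e \in E -> X \subset e -> (2 ^ gam e X <= n)%N].
    by have [s sP] := shares_exist hE hE0 hk p1 n0 gamn; exists s.
  by exists s0 => p1 n0 gamn; case: no.
exists 7%N => c; pose c0 := (2 * (2 * dev + c + 2))%N.
have [C [a loadP]] := polylog_of_load_cap E kappa1 c0.
(* [#|V|.+1] words per record, [C] and [a] from the polylogarithmic bound, [2 ^ a] from
   [log_size_ln], and the last factor from [target_load_le]. *)
exists ((#|V|.+1 * C * 2 ^ a)%N%:R * (2 ^+ #|V| + 1)), a, dcode,
  (fun n p _ => #|{: seeds V n p}|), (fun n p _ s => kappa_join E shares n p s).
move=> n p Sig Rl inp p0 pn wf size_n _ even.
have n0 : (0 < n)%N by apply: leq_trans pn; rewrite expn_gt0 p0.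
have pn' : (p <= n)%N by apply: leq_trans pn; rewrite -{1}[p]expn1 leq_pexp2l.
have gap0 : (0 < key_gap V n p)%N by rewrite /key_gap addn1.
have gapP : ((n + p.-1) %/ p * (2 ^ #|V| + #|V|) <= key_gap V n p * p)%N.
  by rewrite /key_gap addn1; apply: ltnW; rewrite ltn_ceil.
split.
- by apply/card_gt0P; exists ([ffun=> Ordinal p0], [ffun=> Ordinal p0]).
- by move=> s _; split=> //; exact: (join_words_legal wf even (codeP n p p0 pn)).
(* With one machine the required fraction of good seeds is 0 and the empty set will do; the
   construction of shares divides by [ln p]. *)
have [p1|] := ltnP 1 p; last first.
  move=> p_le1; exists set0; split=> [s|]; first by rewrite inE.
  have p1 : p%:R = 1 :> R by apply/eqP; rewrite pnatr_eq1 eqn_leq p_le1.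
  by rewrite p1 cards0 expr1n divr1 subrr mul0r.
pose sh := @config_share V shares n p.
pose xi := item_ids (type_bound n) (id_bound V n p) (key_gap V n p) inp.
pose ty := item_type (type_bound n) inp.
pose M := target_load V n p kappa; pose lam := (c0 * log_size n)%N.
pose m := owner_cap E kappa c0 n p.
have shP (gam : {ffun {set V} * {set V} -> 'I_(type_bound n).+1}) :
      share_spec E p M (fun e X => gam (e, X)) (sh gam).
  apply: (sharesP (n, p, fun e X => gam (e, X) : nat)) => // e X _ _ /=.
  apply: leq_trans (trunc_logP (isT : (1 < 2)%N) n0).
  by rewrite leq_exp2l // -ltnS ltn_ord.
have lam0 : (0 < lam)%N by rewrite muln_gt0 /c0 muln_gt0 addn2.
have M0 : (0 < M)%N by [].
have Dn : ((n * (2 ^ #|V| + #|V|)).+1 * p <= id_bound V n p)%N by [].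
have xiE := item_ids_eq (type_bound n) size_n even p0 gap0 gapP Dn.
have tyP := item_typeE size_n even (erefl (type_bound n)).
pose good (om : seeds V n p) := balanced_buckets E M lam sh inp xi ty om.1 &&
  balanced_owners E lam sh inp xi ty m om.1 om.2.
have pm : (p.+1 <= m)%N by rewrite /m /owner_cap addn1 ltnS leq_addl.
have mP : (size (flatten [seq inp j | j <- enum 'I_p]) + p * query_cap E (type_bound n) M lam <= m * p)%N.
  rewrite (size_all_items size_n even) /m /owner_cap -/M -/lam.
  have := ltn_ceil n p0; set x := (n %/ p)%N; set y := query_cap _ _ _ _; nia.
have bad := good_seeds Rdefinitions.R xiE tyP shP lam0 M0 pm mP.
have bad_small : #|[set om | ~~ good om]|%:R <= 1 / p%:R ^+ c * #|{: seeds V n p}|%:R :> R.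
  apply: le_trans bad _; rewrite ler_wpM2r //.
  exact: (tail_small _ c p0 pn (evP n p p0 pn)).
pose G : {set 'I_#|{: seeds V n p}|} := [set s | good (enum_val s)].
exists G; split=> [s|]; last first.
  have -> : #|G| = #|[set om | good om]|.
    have -> : G = enum_val @^-1: [set om | good om].
      by apply/setP => s; rewrite !inE.
    by apply: on_card_preimset; apply: onW_bij; exact: enum_val_bij.
  have := cardsC [set om | good om].
  have -> : ~: [set om | good om] = [set om | ~~ good om] by apply/setP => om; rewrite !inE.
  move/(congr1 (fun k => k%:R : R)); rewrite natrD => cE.
  move: bad_small; rewrite mulrBl mul1r -cE; move: (_ * (_ + _)) => x; lra.
rewrite inE => /andP[goodb goodo].
rewrite /kappa_join seedE /=.
have ow e x : (owner_of (enum_val s).2 e x < p)%N by exact: ltn_ord.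
split; first exact: (join_computes _ wf size_n even hcov hE0 p0 gap0 gapP Dn ow shP).
have own_load (i : 'I_p) := forallP goodo i.
have := join_max_load wf size_n even hE0 p0 n0 gap0 (erefl _) gapP Dn ow shP lam0 M0
  (balanced_buckets_dom goodb) (balanced_buckets_wit goodb) own_load.
have := loadP n p p1 pn; rewrite -/M -/lam -/m => load_le max_le.
have {load_le}max_le := leq_trans max_le (leq_mul (leqnn _) load_le).
move: max_le; rewrite -(ler_nat R) => /le_trans; apply.
have lnn : 0 <= ln (n%:R : R) by apply: ln_ge0; rewrite ler1n.
have logn := log_size_ln R n0.
apply: (@le_trans _ _ ((#|V|.+1 * C)%N%:R * ((2 * (1 + ln (n%:R : R))) ^+ a *
    ((2 ^+ #|V| + 1) * (n%:R / (p%:R : R) `^ (1 / kappa)))))).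
  rewrite !mulnA -mulnA natrM ler_wpM2l // natrM ler_pM //.
    by rewrite natrX lerXn2r // nnegrE // mulr_ge0 // addr_ge0.
  exact: (target_load_le V kappa1 p0 pn').
rewrite exprMn [in leRHS]natrM natrX.
move: (_ ^+ a) (_ ^+ a) (_ ^+ #|V|) (_^-1) (_ * C)%N => x y z u k.
by rewrite le_eqVlt; apply/orP; left; apply/eqP; ring.
Qed.
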